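(* Let $k$ be a field of characteristic $0$ containing all $2$-power roots of unity, let $\alpha_1,\alpha_2,\alpha_3$ be algebraically independent over $k$, let $K$ be the field generated over $k$ by the elementary symmetric functions of $\alpha_1,\alpha_2,\alpha_3$, and let $E/K$ be the elliptic curve $y^2=(x-\alpha_1)(x-\alpha_2)(x-\alpha_3)$. For $i\in\mathbb{Z}/3\mathbb{Z}$ put $a_i=\alpha_{i+1}-\alpha_{i+2}$ and choose $\sqrt{a_i}\in\bar K$ with square $a_i$. Write $K(x(E[2^n]))$ (resp. $K(x(E[2^\infty]))$) for the extension of $K$ obtained by adjoining the $x$-coordinates of all (nonzero) elements of $E[2^n]$ (resp. $E[2^\infty]$). With $K_n$, $K_n'$, $K_\infty'$ and the notation $L(\mu_2)$ as defined in the context: (a) $K_n=K(x(E[2^n]))(\sqrt{a_i})$ for all $n\ge2$ and $i=1,2,3$; (b) $K_n'(\zeta_{2^n})\subseteq K(x(E[2^n]))$ for all $n\ge1$; (c) $K_\infty'(\mu_2)=K(x(E[2^\infty]))$.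
   Context: Fields. Fix an algebraic closure $\bar K$ of $K$ containing the $\alpha_i$. For $n\ge 0$, $E[2^n]\subset E(\bar K)$ is the group of $2^n$-torsion points and $K_n$ is the extension of $K$ generated by their coordinates. Put $E[2^\infty]=\bigcup_n E[2^n]$. Fix a compatible system $\{\zeta_{2^n}\}_{n\ge0}$ of primitive $2^n$-th roots of unity; for an extension $L/K$, $L(\mu_2):=\bigcup_{n\ge1}L(\zeta_{2^n})$. Let $T_2(E)=\varprojlim_n E[2^n]$ be the $2$-adic Tate module and $V_2(E)=T_2(E)\otimes\mathbb{Q}_2$. The tree. Let $\mathcal{L}$ be the set of $\mathbb{Z}_2$-lattices $\Lambda\subset V_2(E)$ with $\Lambda\supset T_2(E)$ but $\Lambda\not\supset\frac12T_2(E)$. Put $\Lambda_0=T_2(E)$. Via $V_2(E)/T_2(E)\cong E[2^\infty]$, the map $\Lambda\mapsto\Lambda/\Lambda_0$ is a bijection from $\mathcal{L}$ to the cyclic subgroups of $E[2^\infty]$. Let $\mathcal{L}_n$ be the set of $\Lambda\in\mathcal{L}$ with $\Lambda/\Lambda_0$ cyclic of order $2^n$; $\mathcal{L}_{\le n}=\bigcup_{m\le n}\mathcal{L}_m$, $\mathcal{L}_{\ge n}=\bigcup_{m\ge n}\mathcal{L}_m$. Joining two lattices by an edge when one contains the other with quotient $\mathbb{Z}/2\mathbb{Z}$ makes $\mathcal{L}$ a $3$-regular tree, with $\mathcal{L}_n$ the vertices at distance $n$ from the root $\Lambda_0$. For $\Lambda\in\mathcal{L}_n$, $n\ge1$, the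 parent $\tilde\Lambda$ is the unique neighbor of $\Lambda$ in $\mathcal{L}_{n-1}$. For $\Lambda\in\mathcal{L}_n$, $n\ge2$, $\Lambda'$ denotes its twin, the unique other vertex of $\mathcal{L}_n$ with the same parent. The three vertices of $\mathcal{L}_1$ are $\Lambda(\alpha_i)$, $i\in\mathbb{Z}/3\mathbb{Z}$, where $\Lambda(\alpha_i)$ corresponds to the subgroup $\langle(\alpha_i,0)\rangle$ (indices of the $\alpha$'s are taken in $\mathbb{Z}/3\mathbb{Z}$); for $\Lambda=\Lambda(\alpha_i)$ put $\Lambda':=\Lambda(\alpha_{i+1})$. Decorations. A decoration on $\mathcal{L}$ is a function $\Psi:\mathcal{L}_{\ge1}\to\bar K$ such that: (I) $\Psi(\Lambda)\ne\Psi(\Lambda')$ for every $\Lambda\in\mathcal{L}_{\ge1}$; (II) $\Psi(\Lambda(\alpha_i))=\alpha_{i+1}-\alpha_{i+2}$ for $i\in\mathbb{Z}/3\mathbb{Z}$; (III) for every $\Lambda\in\mathcal{L}_2$, $\Psi(\Lambda)$ is a root of $x^2-2\big(2\Psi((\tilde\Lambda)')+\Psi(\tilde\Lambda)\big)x+\Psi(\tilde\Lambda)^2$, and for every $\Lambda\in\mathcal{L}_n$ with $n\ge3$, $\Psi(\Lambda)$ is a root of $x^2-2\big(\Psi((\tilde\Lambda)')-2\Psi(\tilde\Lambda)\big)x+\Psi((\tilde\Lambda)')^2$. For a decoration $\Psi$ (decorations exist, and the following fields do not depend on the choice), put $K_n'=K(\{\Psi(\Lambda)\}_{\Lambda\in\mathcal{L}_{\ge1}\cap\mathcal{L}_{\le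 n}})$ for $n\ge0$ and $K_\infty'=\bigcup_{n\ge0}K_n'$. *)

(* Defs.v *)
From HB Require Import structures.
From mathcomp Require Import all_boot all_order all_algebra.
From mathcomp Require Import boolp classical_sets.
From mathcomp Require Import mpoly.

Set Implicit Arguments.
Unset Strict Implicit.
Unset Printing Implicit Defensive.

Import GRing.Theory.
Local Open Scope classical_set_scope.
Local Open Scope ring_scope.

Section Subfields.
Variable L : fieldType.

Definition subfield_set (F : set L) : Prop :=
  GRing.divring_closed (mem F).

Definition adjoin (F S : set L) : set L := smallest subfield_set (F `|` S).

Definition algebraic_over (F : set L) : Prop :=
  forall x : L, exists p : {poly L},
    [/\ p \is a polyOver (mem F), p != 0 & root p x].

(* F(mu_2), zeta n being a primitive 2^n-th root of unity; since zeta n is a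
   power of zeta n.+1, the union is increasing. *)
Definition adjoin_mu2 (zeta : nat -> L) (F : set L) : set L :=
  \bigcup_(n in [set n | (1 <= n)%N]) adjoin F [set zeta n].

End Subfields.

Definition compatible_roots (L : fieldType) (zeta : nat -> L) : Prop :=
  forall n : nat, (2 ^ n).-primitive_root (zeta n) /\ zeta n.+1 ^+ 2 = zeta n.

Section BaseField.
Variables (k L : fieldType) (iota : {rmorphism k -> L}) (alpha : 'I_3 -> L).

Definition alg_independent : Prop :=
  forall p : {mpoly k[3]}, mmap iota alpha p = 0 -> p = 0.

(* k (e_1, e_2, e_3), with e_j the elementary symmetric functions *)
Definition baseK : set L :=
  adjoin (range iota)
    (range (fun j : 'I_3 => (mesym 3 L j.+1).@[alpha])).

End BaseField.

(* Chord-and-tangent group law on y^2 = f(x), where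
   f = (X - alpha_0)(X - alpha_1)(X - alpha_2); [point] is the ambient set
   (affine plane plus a point at infinity), [oncurve] the set E(L). *)
Section Curve.
Variables (L : fieldType) (alpha : 'I_3 -> L).

Inductive point := Infinity | Affine (x y : L).

Definition cubic : {poly L} := \prod_(i < 3) ('X - (alpha i)%:P).

Definition oncurve : set point := [set P | match P with
  | Infinity => True
  | Affine x y => y ^+ 2 = cubic.[x]
  end].

Definition oppP (P : point) : point :=
  if P is Affine x y then Affine x (- y) else Infinity.

(* Third intersection with the curve of the line of slope s through (x1, y1),
   reflected in the x-axis; the three abscissae sum to s^2 + \sum_i alpha_i. *)
Definition chord (s x1 y1 x2 : L) : point :=
  let x3 := s ^+ 2 + \sum_(i < 3) alpha i - x1 - x2 in
  Affine x3 (- (s * (x3 - x1) + y1)).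

Definition addP (P Q : point) : point :=
  match P, Q with
  | Infinity, _ => Q
  | _, Infinity => P
  | Affine x1 y1, Affine x2 y2 =>
      if x1 != x2 then chord ((y2 - y1) / (x2 - x1)) x1 y1 x2
      else if y1 == - y2 then Infinity
      else chord (cubic^`().[x1] / (2%:R * y1)) x1 y1 x2
  end.

Definition mulP (m : nat) (P : point) : point := iter m (addP P) Infinity.

Definition torsion2 (n : nat) : set point :=
  [set P | oncurve P /\ mulP (2 ^ n) P = Infinity].

Definition torsion2_infty : set point := \bigcup_n torsion2 n.

Definition xcoords (S : set point) : set L :=
  [set x | exists y, S (Affine x y)].

Definition coords (S : set point) : set L :=
  [set c | exists x y, S (Affine x y) /\ (c = x \/ c = y)].

(* V_2(E) = T_2(E) (x) Q_2 is modelled as the inverse limit of E[2^oo] along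
   multiplication by 2: the tensor t (x) 2^-m is the sequence n |-> t_(n + m).
   T_2(E) is then the subgroup of the sequences v with v 0 = O, and v |-> v 0
   induces the isomorphism V_2(E) / T_2(E) = E[2^oo]. *)
Definition vec := nat -> point.

Definition V2 : set vec :=
  [set v | forall n, torsion2_infty (v n) /\ mulP 2 (v n.+1) = v n].

Definition T2 : set vec :=
  [set v | V2 v /\ forall n, torsion2 n (v n)].

Definition addV (v w : vec) : vec := fun n => addP (v n) (w n).
Definition subV (v w : vec) : vec := fun n => addP (v n) (oppP (w n)).
Definition mulV (m : nat) (v : vec) : vec := fun n => mulP m (v n).

Definition halfT2 : set vec := [set v | V2 v /\ T2 (mulV 2 v)].

(* A 2-adic integer, given by representatives z n of its classes mod 2^n *)
Definition Z2 : set (nat -> nat) :=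
  [set z | forall n, z n.+1 = z n %[mod 2 ^ n]].

(* w = z v : on a point killed by 2^N, z acts as the integer z N. *)
Definition is_scaleV (z : nat -> nat) (v w : vec) : Prop :=
  forall n N, mulP (2 ^ N) (v n) = Infinity -> w n = mulP (z N) (v n).

Definition Z2span (e1 e2 : vec) : set vec :=
  [set w | exists z1 z2 w1 w2, [/\ Z2 z1, Z2 z2, is_scaleV z1 e1 w1,
                                   is_scaleV z2 e2 w2 & w = addV w1 w2]].

(* Z_2-lattices of the 2-dimensional Q_2-space V_2(E): the Z_2-spans of the
   pairs that span V_2(E) over Q_2 = Z_2[1/2], i.e. of the Q_2-bases. *)
Definition lattice (Lam : set vec) : Prop :=
  exists e1 e2, [/\ V2 e1, V2 e2, Lam = Z2span e1 e2 &
                    forall v, V2 v -> exists m, Lam (mulV (2 ^ m) v)].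

(* A is contained in B and B / A is cyclic of order d. *)
Definition cyclic_quotient (A B : set vec) (d : nat) : Prop :=
  A `<=` B /\
  exists v, [/\ B v,
    forall w, B w -> exists m, A (subV w (mulV m v)) &
    forall m, A (mulV m v) <-> (d %| m)%N].

Definition tree : set (set vec) :=
  [set Lam | [/\ lattice Lam, T2 `<=` Lam & ~ (halfT2 `<=` Lam)]].

Definition level (n : nat) : set (set vec) :=
  [set Lam | tree Lam /\ cyclic_quotient T2 Lam (2 ^ n)].

Definition adjacent (A B : set vec) : Prop :=
  cyclic_quotient A B 2 \/ cyclic_quotient B A 2.

Definition is_parent (n : nat) (Lam Par : set vec) : Prop :=
  [/\ level n.+1 Lam, level n Par & adjacent Lam Par].

Definition lattice_of (i : 'I_3) : set vec :=
  [set v | V2 v /\ (v 0%N = Infinity \/ v 0%N = Affine (alpha i) 0)].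

(* [is_twin n A B] : A lies in level n and B = A'. In level 1 this is the
   cyclic convention, which is not symmetric; 'I_3 carries the ring structure
   of Z/3Z. *)
Definition is_twin (n : nat) (A B : set vec) : Prop :=
  match n with
  | 0 => False
  | 1 => exists i : 'I_3, A = lattice_of i /\ B = lattice_of (i + 1)
  | m.+1 => [/\ level m.+1 A, level m.+1 B, A <> B &
                exists Par, is_parent m A Par /\ is_parent m B Par]
  end.

(* Only the values of Psi on the vertices of level >= 1 are relevant. *)
Definition decoration (Psi : set vec -> L) : Prop :=
  [/\ forall n A B, is_twin n A B -> Psi A <> Psi B,
      forall i : 'I_3, Psi (lattice_of i) = alpha (i + 1) - alpha (i + 2%:R),
      forall A Par Par', level 2 A -> is_parent 1 A Par ->
        is_twin 1 Par Par' ->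
        root ('X^2 - (2%:R * (2%:R * Psi Par' + Psi Par)) *: 'X
              + (Psi Par ^+ 2)%:P) (Psi A) &
      forall n A Par Par', (2 <= n)%N -> level n.+1 A -> is_parent n A Par ->
        is_twin n Par Par' ->
        root ('X^2 - (2%:R * (Psi Par' - 2%:R * Psi Par)) *: 'X
              + (Psi Par' ^+ 2)%:P) (Psi A)].

Variable K : set L.

Definition Kdiv (n : nat) : set L := adjoin K (coords (torsion2 n)).
Definition Kx (n : nat) : set L := adjoin K (xcoords (torsion2 n)).
Definition Kx_infty : set L := adjoin K (xcoords torsion2_infty).

Definition Kdec (Psi : set vec -> L) (n : nat) : set L :=
  adjoin K [set x | exists m Lam, [/\ (1 <= m <= n)%N, level m Lam & x = Psi Lam]].

Definition Kdec_infty (Psi : set vec -> L) : set L := \bigcup_n Kdec Psi n.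

End Curve.

(* Main.v *)
From Pilot Require Import Defs.
From HB Require Import structures.
From mathcomp Require Import all_boot all_order all_algebra.
From mathcomp Require Import boolp classical_sets.
From mathcomp Require Import mpoly.
From mathcomp Require Import ring.

Set Implicit Arguments.
Unset Strict Implicit.
Unset Printing Implicit Defensive.

Import GRing.Theory.
Local Open Scope classical_set_scope.
Local Open Scope ring_scope.

(** The chord-and-tangent law makes E(Kbar) an abelian group, in which doubling
    is surjective and the 2-torsion has order 4; so E[2^n] has a basis, and the
    vertices of level n of the tree are the lattices [Lat P] attached to the
    points P of order 2^n, with [Lat (2 P)] as the parent of [Lat P] and [Lat (P
    + R)] as its twin, R being a point of order 2 outside <P>.

    A decoration has the following meaning.  Let D be the curve E / <2 Q>, given
    as the target of a chain of normalised isogenies of degree 2, with the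
    generator of the kernel of the dual isogeny at abscissa 0.  Its other two
    roots are, up to a common sign, the values of Psi at the vertices Q and Q +
    R: both are the roots of the same quadratic equation over the preceding
    values ([fits_first], [fits_next]).  As Psi separates twins, this holds up
    to the order of the two roots, for every decoration ([fits_of_point],
    [point_of_reach]).

    (b) The isogenies are rational on abscissae and surjective, and a
    2^m-torsion point of the target is the image of a 2^(m + 1)-torsion point of
    the source. So the roots of D, hence the values of Psi, are rational
    functions of the abscissae of E[2^n] ([psi_Kx]); the roots of unity lie in
    K.

    (c) Conversely let F = K'_oo, and let sigma be an embedding of Kbar in
    itself that fixes F.  It fixes the roots of all curves D, so it commutes
    with the isogenies.  The image of P in E / <2 P> is a fixed point of order
    2, hence sigma P - P lies in <2 P>, and sigma preserves every cyclic
    subgroup ([act_gen]).  Therefore sigma acts on E[2^N] as a scalar u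
    ([act_scalar]).  The Weil pairing of a basis is a primitive 2^N-th root of
    unity, which is fixed, and sigma raises it to the power u^2; so u^2 = 1
    modulo 2^N, which leaves u = 1 or -1 modulo 2^(N - 1) ([act_pm]).  So sigma
    fixes all abscissae, and an element outside F is moved by some sigma
    ([fixed_field]).

    (a) The product of two ordinates is rational in the abscissae of P, Q and P
    + Q ([mul_ordinates]), so all ordinates of E[2^n] are known from one that is
    not 0.  For a point of order 4 above (C j, 0), with d and e the differences
    of the other two roots with C j, the abscissa is C j + sqrt d sqrt e and the
    ordinate is a multiple of sqrt d - sqrt e by a rational function of the
    abscissae ([point4]).

    The Weil pairing is computed from Miller functions, that is from products of
    quotients of lines.  The same computation, on the four lines through three
    points and their partial sums, gives the associativity of the group law and
    the cocycle identity of these quotients ([four_lines]). *)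

(** * Linear combinations of equations *)

Section LinearCombinations.
Variable R : comNzRingType.
Implicit Types (l r c : R).

(** The equations li = ri imply l = r as soon as l - r is a combination of the
    li - ri; the coefficients are given and [ring] proves the last premise. *)
Lemma comb1 c1 l1 r1 l r :
  l1 = r1 -> l - r = c1 * (l1 - r1) -> l = r.
Proof. by move=> -> /eqP; rewrite subrr mulr0 subr_eq0 => /eqP. Qed.

Lemma comb2 c1 c2 l1 r1 l2 r2 l r :
  l1 = r1 -> l2 = r2 -> l - r = c1 * (l1 - r1) + c2 * (l2 - r2) -> l = r.
Proof.
by move=> -> -> /eqP; rewrite !subrr !mulr0 !addr0 subr_eq0 => /eqP.
Qed.

Lemma comb3 c1 c2 c3 l1 r1 l2 r2 l3 r3 l r :
  l1 = r1 -> l2 = r2 -> l3 = r3 ->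
  l - r = c1 * (l1 - r1) + c2 * (l2 - r2) + c3 * (l3 - r3) -> l = r.
Proof.
by move=> -> -> -> /eqP; rewrite !subrr !mulr0 !addr0 subr_eq0 => /eqP.
Qed.

Lemma comb4 c1 c2 c3 c4 l1 r1 l2 r2 l3 r3 l4 r4 l r :
  l1 = r1 -> l2 = r2 -> l3 = r3 -> l4 = r4 ->
  l - r = c1 * (l1 - r1) + c2 * (l2 - r2) + c3 * (l3 - r3) + c4 * (l4 - r4) ->
  l = r.
Proof.
by move=> -> -> -> -> /eqP; rewrite !subrr !mulr0 !addr0 subr_eq0 => /eqP.
Qed.

End LinearCombinations.

(** * The chord-and-tangent law is a group law *)

Section Collinearity.
Variables (L : fieldType) (alpha : 'I_3 -> L).

Definition e1 : L := alpha 0 + alpha 1 + alpha 2%:R.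
Definition e2 : L :=
  alpha 0 * alpha 1 + alpha 0 * alpha 2%:R + alpha 1 * alpha 2%:R.
Definition e3 : L := alpha 0 * alpha 1 * alpha 2%:R.

Lemma big_ord3 (R : Type) (idx : R) (op : Monoid.law idx) (F : 'I_3 -> R) :
  \big[op/idx]_(i < 3) F i = op (op (F 0) (F 1)) (F 2%:R).
Proof.
rewrite !big_ord_recr big_ord0 /= Monoid.mul1m.
by congr (op (op (F _) (F _)) (F _)); apply: val_inj.
Qed.

Lemma sum_rootsE : \sum_(i < 3) alpha i = e1.
Proof. by rewrite big_ord3. Qed.

Lemma cubic_coefE :
  cubic alpha = 'X^3 - e1 *: 'X^2 + e2 *: 'X - e3%:P.
Proof.
rewrite /cubic big_ord3 /= /e1 /e2 /e3 -!mul_polyC !(rmorphD, rmorphM) /=.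
by ring.
Qed.

Lemma cubicE x : (cubic alpha).[x] = x ^+ 3 - e1 * x ^+ 2 + e2 * x - e3.
Proof. by rewrite cubic_coefE !hornerE. Qed.

Lemma cubicP x :
  (cubic alpha).[x] = (x - alpha 0) * (x - alpha 1) * (x - alpha 2%:R).
Proof. by rewrite /cubic big_ord3 /= !hornerE. Qed.

Lemma dcubicE x : (cubic alpha)^`().[x] = 3%:R * x ^+ 2 - 2%:R * e1 * x + e2.
Proof. by rewrite cubic_coefE !derivE !hornerE /=; ring. Qed.

Lemma dcubicP x : (cubic alpha)^`().[x] =
  (x - alpha 0) * (x - alpha 1) + (x - alpha 0) * (x - alpha 2%:R)
   + (x - alpha 1) * (x - alpha 2%:R).
Proof. by rewrite dcubicE /e1 /e2; ring. Qed.

Lemma cubic_root x : (cubic alpha).[x] = 0 -> exists i, x = alpha i.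
Proof.
rewrite cubicP => /eqP; rewrite !mulf_eq0 !subr_eq0 => /orP[/orP[]|] /eqP ->.
- by exists 0.
- by exists 1.
- by exists 2%:R.
Qed.

Lemma cubic_alpha i : (cubic alpha).[alpha i] = 0.
Proof.
have iE : [|| i == 0, i == 1 | i == 2%:R] by case: i => [[|[|[|]]]].
rewrite cubicP; case/or3P: iE => /eqP ->; rewrite subrr ?mulr0 ?mul0r //.
Qed.

(** Vieta's formulas for f - (s X + c)^2 = (X - x1) (X - x2) (X - x3): the line
    of slope s and intercept c meets the curve in points of abscissae x1, x2 and
    x3, counted with multiplicity.  Equations in place of distinct points cover
    chords and tangents alike. *)
Definition meets (s c x1 x2 x3 : L) : Prop :=
  [/\ x1 + x2 + x3 = e1 + s ^+ 2,
      x1 * x2 + x1 * x3 + x2 * x3 = e2 - 2%:R * s * c &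
      x1 * x2 * x3 = e3 + c ^+ 2].

Lemma meetsE s c x1 x2 x3 : meets s c x1 x2 x3 -> forall x,
  (cubic alpha).[x] - (s * x + c) ^+ 2 = (x - x1) * (x - x2) * (x - x3).
Proof.
case=> h1 h2 h3 x; rewrite cubicE.
by apply: (comb3 (c1 := x ^+ 2) (c2 := - x) (c3 := 1) h1 h2 h3); ring.
Qed.

Lemma meets_perm s c x1 x2 x3 : meets s c x1 x2 x3 -> meets s c x2 x1 x3.
Proof.
by case=> h1 h2 h3; split; rewrite -?h1 -?h2 -?h3; ring.
Qed.

Lemma meets_rot s c x1 x2 x3 : meets s c x1 x2 x3 -> meets s c x2 x3 x1.
Proof.
by case=> h1 h2 h3; split; rewrite -?h1 -?h2 -?h3; ring.
Qed.

Lemma meets_opp s c x1 x2 x3 : meets s c x1 x2 x3 -> meets (- s) (- c) x1 x2 x3.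
Proof.
by case=> h1 h2 h3; split; rewrite ?h1 ?h2 ?h3; ring.
Qed.

End Collinearity.

(** The properties that make the chord-and-tangent law a group law, bundled with
    the roots so that the group structure can be inferred. *)
Record curve (L : fieldType) := Curve {
  root_of :> 'I_3 -> L;
  root_inj : injective root_of;
  two_neq0 : 2%:R != 0 :> L }.

Section PointAddition.
Variables (L : fieldType) (C : curve L).

Notation f := (cubic C).
Notation on := (oncurve C).
Notation "P +' Q" := (addP C P Q) (at level 50).
Notation Aff := (@Affine L).
Notation O := (@Infinity L).

Lemma roots_neq : [/\ C 0 != C 1, C 0 != C 2%:R & C 1 != C 2%:R].
Proof. by split; apply/eqP => /root_inj. Qed.

(** The curve is smooth at its points of order 2. *)
Lemma simple_root x : f.[x] = 0 -> f^`().[x] != 0.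
Proof.
have [n01 n02 n12] := roots_neq.
rewrite cubicP dcubicP => /eqP; rewrite !mulf_eq0 => /orP[/orP[]|] /eqP z.
- have {z} -> : x = C 0 by apply/eqP; rewrite -subr_eq0 z.
  by rewrite subrr !mul0r !add0r mulf_neq0 // subr_eq0.
- have {z} -> : x = C 1 by apply/eqP; rewrite -subr_eq0 z.
  by rewrite subrr mulr0 mul0r add0r addr0 mulf_neq0 // subr_eq0 // eq_sym.
- have {z} -> : x = C 2%:R by apply/eqP; rewrite -subr_eq0 z.
  by rewrite subrr !mulr0 !addr0 mulf_neq0 // subr_eq0 // eq_sym.
Qed.

Lemma eqN_eq0 (y : L) : (y == - y) = (y == 0).
Proof.
by rewrite -subr_eq0 opprK -mulr2n -mulr_natl mulf_eq0 (negbTE (two_neq0 C)).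
Qed.

Lemma on_sameX x y1 y2 : on (Aff x y1) -> on (Aff x y2) ->
  y1 = y2 \/ y1 = - y2.
Proof.
move=> h1 h2; have /eqP : y1 ^+ 2 = y2 ^+ 2 by rewrite h1 h2.
by rewrite eqf_sqr => /orP[]/eqP; [left|right].
Qed.

Lemma meets_slope s c x1 x2 x3 y1 y2 : on (Aff x1 y1) ->
  meets C s c x1 x2 x3 -> y1 = s * x1 + c -> y2 = s * x2 + c ->
  Aff x1 y1 +' Aff x2 y2 = Aff x3 (- (s * x3 + c)).
Proof.
move=> on1 h l1 l2; have [h1 h2 h3] := h.
have x3E : x3 = s ^+ 2 + e1 C - x1 - x2
  by apply: (comb1 (c1 := 1) h1); ring.
rewrite /addP; case: eqVneq => [xE|ne] /=; last first.
  have -> : (y2 - y1) / (x2 - x1) = s.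
    have ne' : x2 - x1 != 0 by rewrite subr_eq0 eq_sym.
    by apply: (mulIf ne'); rewrite divfK // l1 l2; ring.
  by rewrite /chord sum_rootsE -x3E l1; congr Aff; ring.
have yE : y2 = y1 by rewrite l1 l2 xE.
rewrite yE eqN_eq0.
(* the line is tangent at a double root of f - (s X + c)^2 *)
have ht : f^`().[x1] = s * (2%:R * y1).
  rewrite dcubicE l1; rewrite -xE in h1 h2 h3.
  by apply: (comb2 (c1 := 2%:R * x1) (c2 := - 1) h1 h2); ring.
case: eqVneq => [y0|yn0].
  have /simple_root : f.[x1] = 0 by rewrite -on1 y0 expr0n.
  by rewrite ht y0 !mulr0 eqxx.
have -> : f^`().[x1] / (2%:R * y1) = s.
  by rewrite ht mulfK // mulf_neq0 // two_neq0.
by rewrite /chord sum_rootsE -x3E l1; congr Aff; ring.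
Qed.

Lemma add_meets x1 y1 x2 y2 : on (Aff x1 y1) -> on (Aff x2 y2) ->
  ~ (x1 = x2 /\ y1 = - y2) ->
  exists s c x3, [/\ meets C s c x1 x2 x3, y1 = s * x1 + c, y2 = s * x2 + c,
    Aff x1 y1 +' Aff x2 y2 = Aff x3 (- (s * x3 + c)) &
    on (Aff x3 (- (s * x3 + c)))].
Proof.
move=> on1 on2 nopp.
have [s [l12 l21]] : exists s, s * (x2 - x1) = y2 - y1 /\
    s * (y1 + y2) = x1 ^+ 2 + x1 * x2 + x2 ^+ 2 - e1 C * (x1 + x2) + e2 C.
  move: (on1) (on2) => /=; rewrite !cubicE => eq1 eq2.
  have [xE|ne] := eqVneq x1 x2.
    have /(on_sameX on1) : on (Aff x1 y2) by rewrite /= xE cubicE.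
    case=> yE; last by case: nopp.
    exists (f^`().[x1] / (2%:R * y1)); rewrite -xE -yE !subrr mulr0; split=> //.
    have y0 : y1 != 0.
      by apply/eqP => y0; apply: nopp; rewrite -xE -yE y0 oppr0.
    have -> : y1 + y1 = 2%:R * y1 by ring.
    by rewrite dcubicE divfK ?mulf_neq0 ?two_neq0 //; ring.
  have ne' : x2 - x1 != 0 by rewrite subr_eq0 eq_sym.
  exists ((y2 - y1) / (x2 - x1)); rewrite divfK //; split=> //.
  apply: (mulIf ne'); rewrite mulrAC divfK //.
  by apply: (comb2 (c1 := -1) (c2 := 1) eq1 eq2); ring.
pose c := y1 - s * x1; pose x3 := s ^+ 2 + e1 C - x1 - x2.
have l1 : y1 = s * x1 + c by rewrite /c; ring.
have l2 : y2 = s * x2 + c by apply: (comb1 (c1 := -1) l12); rewrite /c; ring.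
have hc : meets C s c x1 x2 x3.
  have h1 : x1 + x2 + x3 = e1 C + s ^+ 2 by rewrite /x3; ring.
  have h2 : x1 * x2 + x1 * x3 + x2 * x3 = e2 C - 2%:R * s * c.
    rewrite l1 l2 in l21.
    by apply: (comb1 (c1 := 1) l21); rewrite /x3; ring.
  split=> //; move: on1; rewrite /= cubicE => on1.
  rewrite l1 in on1.
  by apply: (comb3 (c1 := - 1) (c2 := x1) (c3 := - x1 ^+ 2) on1 h2 h1); ring.
exists s, c, x3; split=> //; first exact: meets_slope.
have := meetsE hc x3; rewrite subrr mulr0 => /eqP; rewrite subr_eq0 => /eqP z.
by rewrite /= sqrrN z.
Qed.

Lemma addP0 P : P +' O = P. Proof. by case: P. Qed.

Lemma addPC P Q : on P -> on Q -> P +' Q = Q +' P.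
Proof.
case: P Q => [|x1 y1] [|x2 y2] // on1 on2.
case: (pselect (x1 = x2 /\ y1 = - y2)) => [[xE yE]|n].
  by rewrite /addP xE yE eqxx opprK !eqxx.
have [s [c [x3 [hc l1 l2 -> _]]]] := add_meets on1 on2 n.
by rewrite (meets_slope on2 (meets_perm hc) l2 l1).
Qed.

Lemma on_add P Q : on P -> on Q -> on (P +' Q).
Proof.
case: P Q => [|x1 y1] [|x2 y2] // on1 on2.
case: (pselect (x1 = x2 /\ y1 = - y2)) => [[xE yE]|n].
  by rewrite /addP xE yE !eqxx.
by have [s [c [x3 [_ _ _ -> ]]]] := add_meets on1 on2 n.
Qed.

Lemma on_opp P : on P -> on (oppP P).
Proof. by case: P => //= x y; rewrite sqrrN. Qed.

Lemma oppPK : involutive (@oppP L).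
Proof. by case=> //= x y; rewrite opprK. Qed.

Lemma addNP P : oppP P +' P = O.
Proof. by case: P => //= x y; rewrite !eqxx. Qed.

Lemma addPN P : P +' oppP P = O.
Proof. by case: P => //= x y; rewrite !eqxx opprK !eqxx. Qed.

Lemma addP_opp P Q : on P -> on Q -> oppP (P +' Q) = oppP P +' oppP Q.
Proof.
case: P Q => [|x1 y1] [|x2 y2] // on1 on2.
case: (pselect (x1 = x2 /\ y1 = - y2)) => [[xE yE]|n].
  by rewrite /addP /= xE yE opprK !eqxx.
have [s [c [x3 [hc l1 l2 -> _]]]] := add_meets on1 on2 n.
have on1' : on (Aff x1 (- y1)) by exact: (on_opp on1).
rewrite [RHS](meets_slope on1' (meets_opp hc)) /=; first by congr Aff; ring.
  by rewrite l1; ring.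
by rewrite l2; ring.
Qed.

(** The line through A, B and -(A + B), reflected in the x-axis, passes through
    -A, A + B and -B. *)
Lemma addKP A B : on A -> on B -> oppP A +' (A +' B) = B.
Proof.
case: A B => [|x1 y1] [|x2 y2] // on1 on2; first by rewrite addP0 addNP.
case: (pselect (x1 = x2 /\ y1 = - y2)) => [[xE yE]|n].
  by rewrite {2}/addP xE yE !eqxx addP0 /= opprK.
have [s [c [x3 [hc l1 l2 -> _]]]] := add_meets on1 on2 n.
have on1' : on (Aff x1 (- y1)) by exact: (on_opp on1).
rewrite (meets_slope on1' (s := - s) (c := - c) (x3 := x2)).
- by congr Aff; rewrite l2; ring.
- by apply: meets_opp; apply: meets_perm; do 2! apply: meets_rot.
- by rewrite l1; ring.
- by ring.
Qed.

Lemma addNKP A B : on A -> on B -> A +' (oppP A +' B) = B.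
Proof. by move=> /on_opp/addKP h /h; rewrite oppPK. Qed.

(** Four lines: A, B, -S; S, D, -V; B, D, -U; A, U, -W.  Both l1 l2 / (x - xS)
    and l3 l4 / (x - xU) have the form x^2 + b x + g - a y, and both vanish on A
    + B + D.  Their difference is a line that vanishes on A + B + D, so it is
    zero unless A, B and D are collinear. *)
Lemma four_lines s1 c1 s2 c2 s3 c3 s4 c4 x1 y1 x2 y2 x3 y3 xS xU xV xW :
  on (Aff x1 y1) ->
  y1 = s1 * x1 + c1 -> y2 = s1 * x2 + c1 -> meets C s1 c1 x1 x2 xS ->
  - (s1 * xS + c1) = s2 * xS + c2 -> y3 = s2 * x3 + c2 ->
  meets C s2 c2 xS x3 xV ->
  y2 = s3 * x2 + c3 -> y3 = s3 * x3 + c3 -> meets C s3 c3 x2 x3 xU ->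
  y1 = s4 * x1 + c4 -> - (s3 * xU + c3) = s4 * xU + c4 ->
  meets C s4 c4 x1 xU xW ->
  y3 <> s1 * x3 + c1 -> (x1 = x2 -> y1 != 0) ->
  [/\ forall x y, on (Aff x y) ->
        (y - (s1 * x + c1)) * (y - (s2 * x + c2)) * (x - xU) =
        (y - (s3 * x + c3)) * (y - (s4 * x + c4)) * (x - xS),
      xV = xW, (s1 + s2) * ((s2 * xV + c2) - (s4 * xV + c4)) = 0 &
      s1 + s2 = 0 -> (x3 - x1) * (x3 - x2) = 0].
Proof.
move=> on1 l11 l12 h1 l2S l23 h2 l32 l33 h3 l41 l4U h4 ncol tg.
set a := s1 + s2; set a' := s3 + s4.
set b := s1 * s2 + xS - e1 C; set b' := s3 * s4 + xU - e1 C.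
set g := s1 * c2 + s2 * c1 + xS * b; set g' := s3 * c4 + s4 * c3 + xU * b'.
have [h11 h12 h13] := h1; have [h21 h22 h23] := h2.
have [h31 h32 h33] := h3; have [h41 h42 h43] := h4.
have q11 : b - a * s1 = - (x1 + x2)
  by apply: (comb1 (c1 := 1) h11); rewrite /b /a; ring.
have q12 : e2 C + g - a * c1 = x1 * x2.
  apply: (comb3 (c1 := - 1) (c2 := - s1) (c3 := xS) h12 l2S h11).
  by rewrite /g /b /a; ring.
have q21 : b - a * s2 = - (x3 + xV)
  by apply: (comb1 (c1 := 1) h21); rewrite /b /a; ring.
have q22 : e2 C + g - a * c2 = x3 * xV.
  apply: (comb3 (c1 := - 1) (c2 := - s2) (c3 := xS) h22 l2S h21).
  by rewrite /g /b /a; ring.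
have r11 : b' - a' * s3 = - (x2 + x3)
  by apply: (comb1 (c1 := 1) h31); rewrite /b' /a'; ring.
have r12 : e2 C + g' - a' * c3 = x2 * x3.
  apply: (comb3 (c1 := - 1) (c2 := - s3) (c3 := xU) h32 l4U h31).
  by rewrite /g' /b' /a'; ring.
have r21 : b' - a' * s4 = - (x1 + xW)
  by apply: (comb1 (c1 := 1) h41); rewrite /b' /a'; ring.
have r22 : e2 C + g' - a' * c4 = x1 * xW.
  apply: (comb3 (c1 := - 1) (c2 := - s4) (c3 := xU) h42 l4U h41).
  by rewrite /g' /b' /a'; ring.
(* the difference vanishes at A and at D *)
have dA : (b - b') * x1 + (g - g') - (a - a') * y1 = 0.
  have qA : x1 ^+ 2 + b * x1 + (e2 C + g) - a * y1 = 0
    by rewrite l11; apply: (comb2 (c1 := x1) (c2 := 1) q11 q12); ring.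
  have rA : x1 ^+ 2 + b' * x1 + (e2 C + g') - a' * y1 = 0
    by rewrite l41; apply: (comb2 (c1 := x1) (c2 := 1) r21 r22); ring.
  by apply: (comb2 (c1 := 1) (c2 := - 1) qA rA); ring.
have dD : (b - b') * x3 + (g - g') - (a - a') * y3 = 0.
  have qD : x3 ^+ 2 + b * x3 + (e2 C + g) - a * y3 = 0
    by rewrite l23; apply: (comb2 (c1 := x3) (c2 := 1) q21 q22); ring.
  have rD : x3 ^+ 2 + b' * x3 + (e2 C + g') - a' * y3 = 0
    by rewrite l33; apply: (comb2 (c1 := x3) (c2 := 1) r11 r12); ring.
  by apply: (comb2 (c1 := 1) (c2 := - 1) qD rD); ring.
(* it is a multiple of l1, because it vanishes on A + B *)
have dl : b - b' = (a - a') * s1.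
  have [xE|ne] := eqVneq x1 x2; last first.
    have ne' : x1 - x2 != 0 by rewrite subr_eq0.
    have rB : x2 ^+ 2 + b' * x2 + (e2 C + g') - a' * y2 = 0
      by rewrite l32; apply: (comb2 (c1 := x2) (c2 := 1) r11 r12); ring.
    have qB : x2 ^+ 2 + b * x2 + (e2 C + g) - a * y2 = 0
      by rewrite l12; apply: (comb2 (c1 := x2) (c2 := 1) q11 q12); ring.
    have dB : (b - b') * x2 + (g - g') - (a - a') * y2 = 0
      by apply: (comb2 (c1 := 1) (c2 := - 1) qB rB); ring.
    apply: (mulIf ne').
    by apply: (comb4 (c1 := 1) (c2 := - 1) (c3 := a - a') (c4 := a' - a)
      dA dB l11 l12); ring.
  have y0 := tg xE.
  suff r1 : b' - a' * s1 = - (x1 + x2).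
    by apply: (comb2 (c1 := 1) (c2 := - 1) q11 r1); ring.
  have y2E : y2 = y1 by rewrite l11 l12 xE.
  have n2 : 2%:R * y1 != 0 by rewrite mulf_neq0 ?two_neq0.
  (* a' (x1 - xU) = 2 y1, from the two lines through A and through U, -U *)
  have k : 2%:R * y1 = a' * (x1 - xU).
    rewrite y2E -xE in l32.
    by apply: (comb3 (c1 := 1) (c2 := 1) (c3 := - 1) l32 l41 l4U);
       rewrite /a'; ring.
  have t1 : f^`().[x1] = 2%:R * y1 * s1.
    rewrite dcubicE l11; rewrite -xE in h11 h12.
    by apply: (comb2 (c1 := 2%:R * x1) (c2 := - 1) h11 h12); ring.
  have t3 : f^`().[x1] = 2%:R * y1 * s3 + (x1 - x3) * (x1 - xU).
    rewrite dcubicE -y2E l32; rewrite -xE in h31 h32 *.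
    by apply: (comb2 (c1 := 2%:R * x1) (c2 := - 1) h31 h32); ring.
  apply: (mulIf n2); rewrite -xE in r11 *.
  apply: (comb4 (c1 := a') (c2 := - a') (c3 := 2%:R * y1) (c4 := x1 - x3)
     t1 t3 r11 k); ring.
have aE : a = a'.
  apply/eqP; rewrite -subr_eq0; apply/eqP.
  have : (a - a') * (y3 - (s1 * x3 + c1)) = 0.
    by apply: (comb4 (c1 := 1) (c2 := - 1) (c3 := x3 - x1) (c4 := a - a')
      dA dD dl l11); ring.
  move=> /eqP; rewrite mulf_eq0 => /orP[/eqP //|].
  by rewrite subr_eq0 => /eqP.
have bE : b = b' by apply/eqP; rewrite -subr_eq0 dl aE subrr mul0r.
have gE : g = g'.
  by apply/eqP; rewrite -subr_eq0 -dA aE bE !subrr !mul0r subr0 add0r.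
have VW : xV = xW.
  apply: (comb4 (c1 := 1) (c2 := 1) (c3 := - 1) (c4 := - 1) q11 q21 r11 r21).
  by rewrite -bE; apply: (comb1 (c1 := a + a') aE); rewrite /a /a'; ring.
split=> //.
- move=> x y; rewrite /= cubicE => onZ.
  transitivity ((x - xS) * (x - xU) * (x ^+ 2 + b * x + (e2 C + g) - a * y)).
    have k : e3 C = c1 * c2 + xS * (e2 C + g).
      by apply: (comb3 (c1 := - 1) (c2 := - xS) (c3 := c1) h13 q12 l2S);
         rewrite /a; ring.
    by apply: (comb3 (c1 := x - xU) (c2 := xU - x) (c3 := (x - xU) * y)
       onZ k l2S); rewrite /a /g /b; ring.
  have k : e3 C = c3 * c4 + xU * (e2 C + g').
    by apply: (comb3 (c1 := - 1) (c2 := - xU) (c3 := c3) h33 r12 l4U);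
       rewrite /a'; ring.
  rewrite aE bE gE; apply: esym.
  by apply: (comb3 (c1 := x - xS) (c2 := xS - x) (c3 := (x - xS) * y)
     onZ k l4U); rewrite /a' /g' /b'; ring.
- rewrite -VW -bE -aE -gE in r21 r22.
  by apply: (comb4 (c1 := xV) (c2 := 1) (c3 := - xV) (c4 := - 1)
    r21 r22 q21 q22); ring.
- move=> a0.
  by apply: (comb4 (c1 := x3) (c2 := 1) (c3 := - x3) (c4 := - 1)
    q21 q22 q11 q12); rewrite a0; ring.
Qed.

Lemma on_line s c x1 x2 x3 x : meets C s c x1 x2 x3 -> on (Aff x (s * x + c)) ->
  [\/ x = x1, x = x2 | x = x3].
Proof.
move=> /meetsE/(_ x) + /= onx; rewrite -onx subrr => /esym/eqP.
rewrite !mulf_eq0 !subr_eq0 => /orP[/orP[]|] /eqP.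
- exact: Or31.
- exact: Or32.
- exact: Or33.
Qed.

(** The normalised function with divisor A + B - (A + B) - O, evaluated at Z. *)
Definition mil (A B Z : Defs.point L) : L :=
  match A, B, Z with
  | Affine x1 y1, Affine x2 y2, Affine x y =>
      if (x1 == x2) && (y1 == - y2) then x - x1 else
      let s := if x1 != x2 then (y2 - y1) / (x2 - x1)
               else f^`().[x1] / (2%:R * y1) in
      (y - y1 - s * (x - x1)) / (x - (s ^+ 2 + e1 C - x1 - x2))
  | _, _, _ => 1
  end.

Lemma mil_meets s c x1 x2 x3 y1 y2 x y : on (Aff x1 y1) ->
  meets C s c x1 x2 x3 -> y1 = s * x1 + c -> y2 = s * x2 + c ->
  mil (Aff x1 y1) (Aff x2 y2) (Aff x y) = (y - (s * x + c)) / (x - x3).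
Proof.
move=> on1 h l1 l2; have /= := meets_slope on1 h l1 l2.
have [h1 _ _] := h; have x3E : x3 = s ^+ 2 + e1 C - x1 - x2
  by apply: (comb1 (c1 := 1) h1); ring.
case: (eqVneq x1 x2) => [xE|ne] /=.
  case: eqVneq => //= ny; rewrite /chord sum_rootsE => -[xx yy].
  suff -> : f^`().[x1] / (2%:R * y1) = s.
    by rewrite -x3E l1; congr (_ / _); ring.
  have y10 : y1 != 0.
    apply: contra ny => /eqP y0; have -> : y2 = y1 by rewrite l1 l2 xE.
    by rewrite y0 oppr0.
  have n2 : 2%:R * y1 != 0 by rewrite mulf_neq0 // two_neq0.
  apply: (mulIf n2); rewrite divfK // dcubicE l1.
  have [k1 k2 _] := h; rewrite -xE in k1 k2.
  by apply: (comb2 (c1 := 2%:R * x1) (c2 := - 1) k1 k2); ring.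
have -> : (y2 - y1) / (x2 - x1) = s.
  have ne' : x2 - x1 != 0 by rewrite subr_eq0 eq_sym.
  by apply: (mulIf ne'); rewrite divfK // l1 l2; ring.
by move=> _; rewrite -x3E l1; congr (_ / _); ring.
Qed.

Lemma on_x_neq x y x' y' : on (Aff x y) -> on (Aff x' y') ->
  Aff x y <> Aff x' y' -> Aff x y <> oppP (Aff x' y') -> x - x' != 0.
Proof.
move=> onZ onP n1 n2; rewrite subr_eq0; apply/eqP => xE; subst x'.
by case: (on_sameX onZ onP) => yE; [apply: n1|apply: n2]; rewrite yE.
Qed.

(** The identity behind both associativity and the cocycle relation of [mil]. *)
Lemma addP_generic A B D : on A -> on B -> on D -> A <> O -> B <> O -> D <> O ->
  B <> oppP A -> D <> oppP B -> A +' B <> oppP D -> D <> A -> D <> B ->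
  (D <> oppP A -> (A +' B) +' D = A +' (B +' D)) /\
  (forall Z, on Z -> (A +' B) +' D = A +' (B +' D) ->
     (forall P, [\/ P = A +' B, P = B +' D | P = (A +' B) +' D] ->
        Z <> P /\ Z <> oppP P) ->
     mil A B Z * mil (A +' B) D Z = mil B D Z * mil A (B +' D) Z).
Proof.
move=> onA onB onD nA nB nD nAB nBD nS nDA nDB.
have nU : B +' D <> oppP A.
  move=> UE; apply: nS; rewrite -[A]oppPK -UE addP_opp // addPC.
  - by rewrite addNKP //; apply: on_opp.
  - by rewrite -addP_opp //; apply: on_opp; apply: on_add.
  - by [].
case: A B D onA onB onD nA nB nD nAB nBD nS nDA nDB nU
  => [|x1 y1] [|x2 y2] [|x3 y3] // onA onB onD _ _ _ nAB nBD nS nDA nDB nU.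
have [|s1 [c1 [xS [h1 l11 l12 SE onS]]]] := add_meets onA onB.
  by case=> xE yE; apply: nAB; rewrite /= xE yE opprK.
have [|s3 [c3 [xU [h3 l32 l33 UE onU]]]] := add_meets onB onD.
  by case=> xE yE; apply: nBD; rewrite /= xE yE opprK.
rewrite SE UE in nS nU *.
have [|s2 [c2 [xV [h2 l2S l23 VE onV]]]] := add_meets onS onD.
  by case=> yE xE; apply: nS; rewrite /= xE yE.
have [|s4 [c4 [xW [h4 l41 l4U WE onW]]]] := add_meets onA onU.
  by case=> xE yE; apply: nU; rewrite /= yE xE opprK.
have ncol : y3 <> s1 * x3 + c1.
  move=> yE; have onl : on (Aff x3 (s1 * x3 + c1)) by rewrite -yE.
  case: (on_line h1 onl) => xE; subst x3.
  - by apply: nDA; rewrite yE l11.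
  - by apply: nDB; rewrite yE l12.
  - by apply: nS; rewrite yE.
have tg : x1 = x2 -> y1 != 0.
  move=> xE; apply/eqP => y0; apply: nAB => /=.
  by rewrite y0 oppr0 -xE l12 -xE -l11 y0.
have [q vw a0 xx] := four_lines onA l11 l12 h1 l2S l23 h2 l32 l33 h3 l41 l4U h4
  ncol tg.
rewrite VE WE; split=> [nDA'|].
  rewrite -vw; congr Aff; congr (- _).
  move/eqP: a0; rewrite mulf_eq0 subr_eq0 => /orP[/eqP/xx/eqP|/eqP //].
  rewrite mulf_eq0 !subr_eq0 => /orP[]/eqP xE; subst x3.
    by case: (on_sameX onD onA) => yE; [case: nDA|case: nDA']; rewrite yE.
  by case: (on_sameX onD onB) => yE; [case: nDB|case: nBD]; rewrite yE.
case=> [|x y] onZ _ nP; first by rewrite /mil; do ?case: ifP.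
rewrite (mil_meets x y onA h1 l11 l12) (mil_meets x y onS h2 l2S l23).
rewrite (mil_meets x y onB h3 l32 l33) (mil_meets x y onA h4 l41 l4U).
have [z1 z1'] := nP _ (Or31 _ _ erefl); have nzS := on_x_neq onZ onS z1 z1'.
have [z2 z2'] := nP _ (Or32 _ _ erefl); have nzU := on_x_neq onZ onU z2 z2'.
have [z3 z3'] := nP _ (Or33 _ _ erefl); have nzV := on_x_neq onZ onV z3 z3'.
rewrite -vw; apply: (mulIf nzS); apply: (mulIf nzU); apply: (mulIf nzV).
have -> (u v : L) : u / (x - xS) * (v / (x - xV)) * (x - xS) * (x - xU) *
  (x - xV) = u * v * (x - xU) by field; rewrite nzS nzV.
rewrite (q x y onZ).
by field; rewrite nzU nzV.
Qed.

(** The case D = A is commutativity, and those where one of A + B, B + D, A + D,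
    A + B + D is O follow from [addKP]. *)
Lemma addPA_D A B D : on A -> on B -> on D -> D <> B ->
  (A +' B) +' D = A +' (B +' D).
Proof.
move=> onA onB onD nDB.
case: (pselect (A = O)) => [-> //|nA].
case: (pselect (B = O)) => [->|nB]; first by rewrite addP0.
case: (pselect (D = O)) => [->|nD]; first by rewrite !addP0.
have [onA' onB' onD'] := And3 (on_opp onA) (on_opp onB) (on_opp onD).
case: (pselect (B = oppP A)) => [->|nAB].
  by rewrite addPN addNKP.
case: (pselect (D = oppP B)) => [->|nBD].
  by rewrite addPN addP0 addPC ?(addPC onA) ?addKP //; exact: on_add.
case: (pselect (D = oppP A)) => [->|nDA'].
  rewrite addPC ?addKP ?(addPC onB) //; last exact: on_add.
  by rewrite addNKP.
case: (pselect (D = A)) => [->|nDA].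
  by rewrite addPC ?(addPC onB) //; exact: on_add.
case: (pselect (A +' B = oppP D)) => [SE|nS].
  have DE : D = oppP B +' oppP A by rewrite -addP_opp // addPC // SE oppPK.
  by rewrite SE addNP DE addNKP // addPN.
by case: (addP_generic onA onB onD nA nB nD nAB nBD nS nDA nDB) => + _; apply.
Qed.

(** By commutativity, D = B <> A is the mirror image of A = B <> D. *)
Lemma addPA A B D : on A -> on B -> on D -> (A +' B) +' D = A +' (B +' D).
Proof.
move=> onA onB onD.
case: (pselect (D = B)) => [->|]; last exact: addPA_D.
case: (pselect (A = B)) => [->|n]; first by rewrite addPC //; exact: on_add.
by rewrite addPC ?(addPC onA) -?addPA_D //; do ?exact: on_add.
Qed.

End PointAddition.

HB.instance Definition _ (L : fieldType) := gen_eqMixin (Defs.point L).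
HB.instance Definition _ (L : fieldType) := gen_choiceMixin (Defs.point L).

Record cpoint (L : fieldType) (C : curve L) :=
  CPoint { pt_of :> Defs.point L; pt_on : `[< oncurve C pt_of >] }.

HB.instance Definition _ (L : fieldType) (C : curve L) :=
  [isSub for @pt_of L C].
HB.instance Definition _ (L : fieldType) (C : curve L) :=
  [Choice of cpoint C by <:].

Section GroupOfPoints.
Variables (L : fieldType) (C : curve L).
Implicit Types P Q : cpoint C.

Lemma onP P : oncurve C P.
Proof. by have := pt_on P; rewrite asboolE. Qed.

Definition mkP (P : Defs.point L) (h : oncurve C P) : cpoint C :=
  CPoint (asboolT h).

Definition zeroC : cpoint C := @mkP (@Infinity L) I.
Definition addC P Q : cpoint C := mkP (on_add (onP P) (onP Q)).
Definition oppC P : cpoint C := mkP (on_opp (onP P)).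

Fact addCA : associative addC.
Proof. by move=> P Q R; apply: val_inj => /=; rewrite addPA //; apply: onP. Qed.
Fact addCC : commutative addC.
Proof. by move=> P Q; apply: val_inj => /=; rewrite addPC //; apply: onP. Qed.
Fact add0C : left_id zeroC addC.
Proof. by move=> P; apply: val_inj. Qed.
Fact addNC : left_inverse zeroC oppC addC.
Proof. by move=> P; apply: val_inj => /=; rewrite addNP. Qed.

HB.instance Definition _ := GRing.isZmodule.Build (cpoint C) addCA addCC add0C
  addNC.

Lemma val_add P Q : val (P + Q) = addP C (val P) (val Q). Proof. by []. Qed.
Lemma val_opp P : val (- P) = oppP (val P). Proof. by []. Qed.

Lemma val_mul n P : val (P *+ n) = mulP C n (val P).
Proof.
elim: n => // n IH; rewrite mulrS val_add IH /mulP iterS.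
by [].
Qed.

End GroupOfPoints.

(** * Elements of order a power of 2 in an abelian group *)

Section DyadicOrder.
Variable G : zmodType.
Implicit Types P Q A B : G.

Definition ord2 m P : Prop := forall j, P *+ j = 0 <-> (2 ^ m %| j)%N.

Definition gen P : set G := [set Q | exists j, Q = P *+ j].

Definition span A B : set G := [set Q | exists a b, Q = A *+ a + B *+ b].

Lemma ord2_tors m P : ord2 m P -> P *+ (2 ^ m) = 0.
Proof. by move=> ->. Qed.

Lemma ord2_top m P : ord2 m.+1 P -> P *+ (2 ^ m) <> 0.
Proof. by move=> h /h; rewrite gtnNdvd ?expn_gt0 // ltn_exp2l. Qed.

Lemma ord2P m P : P *+ (2 ^ m.+1) = 0 -> P *+ (2 ^ m) <> 0 -> ord2 m.+1 P.
Proof.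
move=> h0 h1 j; split=> [hj|/dvdnP[q ->]];
  last by rewrite mulnC mulrnA h0 mul0rn.
have [u v e _] := egcdnP j (expn_gt0 2 m.+1).
have g0 : P *+ gcdn (2 ^ m.+1) j = 0.
  have := congr1 (fun k => P *+ k) e.
  by rewrite mulrnDr [(u * _)%N]mulnC [(v * _)%N]mulnC !mulrnA h0 hj !mul0rn
    add0r.
have /dvdn_pfactor : (gcdn (2 ^ m.+1) j %| 2 ^ m.+1)%N by exact: dvdn_gcdl.
case=> // k; rewrite leq_eqVlt => /orP[/eqP ->|km] gE.
  by rewrite -gE dvdn_gcdr.
case: h1; have -> : (2 ^ m = gcdn (2 ^ m.+1) j * 2 ^ (m - k))%N.
  by rewrite gE -expnD subnKC.
by rewrite mulrnA g0 mul0rn.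
Qed.

Lemma ord2_0 P : ord2 0 P <-> P = 0.
Proof.
split=> [h|-> j]; first by have := ord2_tors h; rewrite expn0.
by rewrite mul0rn dvd1n.
Qed.

Lemma ord2_ex m P : P *+ (2 ^ m) = 0 -> exists2 k, (k <= m)%N & ord2 k P.
Proof.
elim: m => [|m IH] h.
  by exists 0%N => //; apply/ord2_0; move: h; rewrite expn0.
have [/IH[k km hk]|/eqP n] := eqVneq (P *+ (2 ^ m)) 0.
  by exists k => //; apply: leq_trans km _.
by exists m.+1 => //; apply: ord2P.
Qed.

Lemma ord2_mul m P : ord2 m.+1 P -> ord2 m (P *+ 2).
Proof. by move=> h j; rewrite -mulrnA h expnS dvdn_pmul2l. Qed.

Lemma ord2_half m P Q : Q *+ 2 = P -> ord2 m.+1 P -> ord2 m.+2 Q.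
Proof.
move=> <- h; apply: ord2P; first by rewrite expnS mulrnA; apply: ord2_tors.
by rewrite expnS mulrnA; apply: ord2_top.
Qed.

Lemma mulrn_mod m P j : P *+ (2 ^ m) = 0 -> P *+ j = P *+ (j %% 2 ^ m).
Proof.
by move=> h; rewrite {1}(divn_eq j (2 ^ m)) mulrnDr mulnC mulrnA h mul0rn add0r.
Qed.

Lemma ord2_eqmod m P i j : ord2 m P ->
  P *+ i = P *+ j <-> i = j %[mod 2 ^ m].
Proof.
move=> h; split=> [|e]; last first.
  by rewrite (mulrn_mod i (ord2_tors h)) e -mulrn_mod //; apply: ord2_tors.
wlog ij : i j / (j <= i)%N => [W|e].
  case: (leqP j i) => [|/ltnW] ij; first exact: W.
  by move=> /esym/(W _ _ ij)/esym.
apply/eqP; rewrite eqn_mod_dvd //; apply/h.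
by rewrite mulrnBr // e subrr.
Qed.

Lemma mulrn_opp m P j : P *+ (2 ^ m) = 0 ->
  - (P *+ j) = P *+ (j * (2 ^ m).-1).
Proof.
move=> h; apply/eqP; rewrite -subr_eq0 -opprD oppr_eq0 -mulrnDr -mulnS.
by rewrite prednK ?expn_gt0 // mulnC mulrnA h mul0rn.
Qed.

Lemma gen_opp m P Q : P *+ (2 ^ m) = 0 -> gen P Q -> gen P (- Q).
Proof.
by move=> h [j ->]; exists (j * (2 ^ m).-1)%N; apply: mulrn_opp.
Qed.

Lemma gen_add P Q R : gen P Q -> gen P R -> gen P (Q + R).
Proof. by case=> i -> [j ->]; exists (i + j)%N; rewrite mulrnDr. Qed.

Lemma gen_mul P Q n : gen P Q -> gen P (Q *+ n).
Proof. by case=> i ->; exists (i * n)%N; rewrite mulrnA. Qed.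

Lemma gen_id P : gen P P. Proof. by exists 1%N. Qed.

Lemma gen_tors2 m P Q : ord2 m.+1 P -> gen P Q -> Q *+ 2 = 0 ->
  Q = 0 \/ Q = P *+ (2 ^ m).
Proof.
move=> h [j ->]; rewrite -mulrnA => /h; rewrite expnSr dvdn_pmul2r //.
case/dvdnP=> q ->; rewrite mulnC mulrnA.
have t2 : P *+ (2 ^ m) *+ 2 = 0 by rewrite -mulrnA -expnSr; apply: ord2_tors.
rewrite (@mulrn_mod 1 _ q) ?expn1 // modn2; case: odd; last by left.
by right.
Qed.

(** A common multiple of A and B other than 0 would have a multiple of order 2,
    and this is the only element of order 2 of <A> and of <B>. *)
Lemma ord2_indep m n A B a b : ord2 m A -> ord2 n B ->
  (0 < m -> 0 < n -> A *+ (2 ^ m.-1) <> B *+ (2 ^ n.-1))%N ->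
  A *+ a = B *+ b -> (2 ^ m %| a)%N /\ (2 ^ n %| b)%N.
Proof.
case: m => [|m]; case: n => [|n] hA hB top.
- by rewrite !dvd1n.
- have /ord2_0 -> := hA; rewrite mul0rn => /esym/hB ->.
  by rewrite dvd1n.
- have /ord2_0 -> := hB; rewrite mul0rn => /hA ->.
  by rewrite dvd1n.
move=> e; have [z|/eqP nz] := eqVneq (A *+ a) 0.
  by split; [apply/hA|apply/hB; rewrite -e].
have [|k _ hk] := @ord2_ex m.+1 (A *+ a).
  by rewrite mulrnAC (ord2_tors hA) mul0rn.
case: k hk => [/ord2_0 //|k hk].
pose c := A *+ a *+ (2 ^ k).
have c0 : c <> 0 by exact: ord2_top hk.
have c2 : c *+ 2 = 0 by rewrite -mulrnA -expnSr; apply: ord2_tors.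
have [//|cA] : c = 0 \/ c = A *+ (2 ^ m).
  by apply: gen_tors2 => //; do ?apply: gen_mul; apply: gen_id.
have [//|cB] : c = 0 \/ c = B *+ (2 ^ n).
  by apply: gen_tors2 => //; rewrite /c e; do ?apply: gen_mul; apply: gen_id.
by case: (top isT isT); rewrite /= -cA -cB.
Qed.

(** Dividing by 2 along two chains e, e' stays in the span as long as the span
    contains the 2-torsion. *)
Lemma span_chain (e e' : nat -> G) :
  (forall n, e n.+1 *+ 2 = e n) -> (forall n, e' n.+1 *+ 2 = e' n) ->
  (forall n Q, Q *+ 2 = 0 -> span (e n.+1) (e' n.+1) Q) ->
  forall n Q, span (e 0%N) (e' 0%N) (Q *+ (2 ^ n)) -> span (e n) (e' n) Q.
Proof.
move=> he he' h2; elim=> [|n IH] Q; first by rewrite expn0.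
rewrite expnS mulrnA => /IH[a [b Q2]].
have [|c [d QE]] := h2 n (Q - (e n.+1 *+ a + e' n.+1 *+ b)).
  by rewrite mulrnBl Q2 mulrnDl -!mulrnA !(mulnC _ 2%N) !mulrnA he he' subrr.
exists (a + c)%N, (b + d)%N; rewrite !mulrnDr.
move/eqP: QE; rewrite subr_eq => /eqP ->.
by rewrite addrACA; congr (_ + _); rewrite addrC.
Qed.

End DyadicOrder.

(** * Torsion points *)

Section TwoTorsion.
Variables (L : closedFieldType) (C : curve L).
Implicit Types P Q : cpoint C.

Fact on_T i : oncurve C (Affine (C i) 0).
Proof. by rewrite /= cubic_alpha expr0n. Qed.

Definition T i : cpoint C := mkP (on_T i).

Lemma T_neq0 i : T i <> 0. Proof. by []. Qed.

Lemma T_inj : injective T.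
Proof. by move=> i j /(congr1 val)[] /root_inj. Qed.

Lemma T_double i : T i *+ 2 = 0.
Proof.
by apply: val_inj; rewrite mulr2n val_add /= !eqxx oppr0 eqxx.
Qed.

Lemma opp_eq P : P *+ 2 = 0 <-> - P = P.
Proof.
rewrite mulr2n; split=> [/eqP|{1}<-]; last by rewrite addNr.
by rewrite addr_eq0 => /eqP <-.
Qed.

Lemma tors2P P : P *+ 2 = 0 -> P = 0 \/ exists i, P = T i.
Proof.
move/opp_eq/(congr1 val); rewrite val_opp; have := onP P.
case: P => -[|x y] h /=; first by move=> _ _; left; apply: val_inj.
move=> onP [] /esym/eqP; rewrite (eqN_eq0 C) => /eqP y0; right.
have [i xi] : exists i, x = C i by apply: cubic_root; rewrite -onP y0 expr0n.
by exists i; apply: val_inj; rewrite /= y0 xi.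
Qed.

Lemma T_add i j k : i != j -> i != k -> j != k -> T i + T j = T k.
Proof.
move=> ij ik jk; have [] := @tors2P (T i + T j).
- by rewrite mulrnDl !T_double addr0.
- have /opp_eq {1}<- := T_double i; move/eqP;
    rewrite addrC subr_eq0 => /eqP/T_inj/eqP.
  by rewrite eq_sym (negbTE ij).
case=> l E; rewrite E; have li : l != i.
  apply/eqP => li; move: E; rewrite li => /eqP;
    rewrite -subr_eq0 addrAC subrr add0r.
  by move/eqP/T_neq0.
have lj : l != j.
  apply/eqP => lj; move: E; rewrite lj => /eqP; rewrite -subr_eq0 addrK.
  by move/eqP/T_neq0.
congr T; move: ij ik jk li lj {E}.
by case: i j k l => [[|[|[|//]]] ?] [[|[|[|//]]] ?] [[|[|[|//]]] ?]
  [[|[|[|//]]] ?] //= *; apply: val_inj.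
Qed.

Lemma tors2_span A B Q : A *+ 2 = 0 -> B *+ 2 = 0 -> A <> 0 -> B <> 0 ->
  A <> B ->
  Q *+ 2 = 0 -> span A B Q.
Proof.
move=> /tors2P[//|[i ->]] /tors2P[//|[j ->]] _ _ ij /tors2P[->|[k ->]].
  by exists 0%N, 0%N; rewrite !mulr0n addr0.
have [->|ki] := eqVneq k i; first by exists 1%N, 0%N; rewrite addr0.
have [->|kj] := eqVneq k j; first by exists 0%N, 1%N; rewrite add0r.
exists 1%N, 1%N; rewrite !mulr1n (T_add (k := k)) //; rewrite 1?eq_sym //.
by apply/eqP => ij'; apply: ij; rewrite ij'.
Qed.

Lemma sqrt_ex (a : L) : {r | r ^+ 2 = a}.
Proof.
apply/cid; have [r hr] := @solve_monicpoly L 2 (fun i =>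
  if i == 0%N then a else 0) isT.
exists r; move: hr; rewrite !big_ord_recl big_ord0 /= => ->.
by rewrite expr0 mulr1 mul0r !addr0.
Qed.

Definition sqrtL a := sval (sqrt_ex a).
Lemma sqrtLK a : sqrtL a ^+ 2 = a. Proof. exact: svalP (sqrt_ex a). Qed.

(** Halving (x0, y0): the tangents through -(x0, y0) have slope r0 + r1 + r2,
    where ri is a square root of x0 - C i, the signs being such that r0 r1 r2 =
    y0. *)
Lemma half_ex P : {Q | Q *+ 2 = P}.
Proof.
apply/cid; case: (pselect (P = 0)) => [->|]; first by exists 0; rewrite mul0rn.
have := onP P; case: P => -[|x0 y0] hP /= onP0 nP0.
  by case: nP0; apply: val_inj.
pose r0 := sqrtL (x0 - C 0); pose r1 := sqrtL (x0 - C 1).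
have R0 : r0 ^+ 2 = x0 - C 0 by exact: sqrtLK.
have R1 : r1 ^+ 2 = x0 - C 1 by exact: sqrtLK.
have [r2 R2 yE] : exists2 r2, r2 ^+ 2 = x0 - C 2%:R & r0 * r1 * r2 = y0.
  pose r2 := sqrtL (x0 - C 2%:R).
  have R2 : r2 ^+ 2 = x0 - C 2%:R by exact: sqrtLK.
  have /eqP : (r0 * r1 * r2) ^+ 2 = y0 ^+ 2.
    by rewrite !exprMn R0 R1 R2 onP0 cubicP.
  rewrite eqf_sqr => /orP[] /eqP yE; first by exists r2.
  by exists (- r2); rewrite ?sqrrN // mulrN yE opprK.
pose s := r0 + r1 + r2; pose x := x0 + r0 * r1 + r0 * r2 + r1 * r2.
pose c := - y0 - s * x0.
have C0 : C 0 = x0 - r0 ^+ 2 by rewrite R0; ring.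
have C1 : C 1 = x0 - r1 ^+ 2 by rewrite R1; ring.
have C2 : C 2%:R = x0 - r2 ^+ 2 by rewrite R2; ring.
have hc : meets C s c x x x0.
  by split; rewrite /e1 /e2 /e3 C0 C1 C2 /c /x -?yE /s; ring.
have onQ : oncurve C (Affine x (s * x + c)).
  by have /eqP := meetsE hc x; rewrite subrr !mul0r subr_eq0 /= => /eqP ->.
exists (mkP onQ); apply: val_inj; rewrite mulr2n val_add /=.
rewrite -/(addP C (Affine x (s * x + c)) (Affine x (s * x + c))).
rewrite (meets_slope onQ hc) //=; congr Affine; rewrite /c; ring.
Qed.

Definition halfpt P : cpoint C := sval (half_ex P).
Lemma halfK P : halfpt P *+ 2 = P. Proof. exact: svalP (half_ex P). Qed.

Definition halves P n : cpoint C := iter n halfpt P.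

Lemma halvesS P n : halves P n.+1 *+ 2 = halves P n.
Proof. exact: halfK. Qed.

Lemma halves_mul P n k : halves P (n + k) *+ (2 ^ k) = halves P n.
Proof.
elim: k => [|k IH]; first by rewrite addn0.
by rewrite addnS expnS mulrnA halvesS.
Qed.

Lemma ord2_halves P m n : ord2 m.+1 P -> ord2 (m + n).+1 (halves P n).
Proof.
elim: n => [|n IH] h; first by rewrite addn0.
by rewrite addnS; apply: ord2_half (IH h); apply: halvesS.
Qed.

Lemma ord2_T i : ord2 1 (T i).
Proof. by apply: ord2P; [exact: T_double|exact: T_neq0]. Qed.

Lemma tors2_other P : exists i, T i <> P.
Proof.
case: (pselect (T 0 = P)) => [<-|]; last by exists 0.
by exists 1 => /T_inj.
Qed.

(** Halving T 0 and T 1 repeatedly gives a basis, by [span_chain]. *)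
Lemma tors_basis N : (0 < N)%N -> exists A B : cpoint C,
  [/\ ord2 N A, ord2 N B, A *+ (2 ^ N.-1) = T 0, B *+ (2 ^ N.-1) = T 1 &
      forall Q, Q *+ (2 ^ N) = 0 -> span A B Q].
Proof.
case: N => // N _; exists (halves (T 0) N), (halves (T 1) N).
have hm i : halves (T i) N *+ (2 ^ N) = T i by rewrite (halves_mul _ 0).
split=> //; try exact: (ord2_halves (m := 0) _ (ord2_T _)).
pose e i n := if n is n.+1 then halves (T i) n else 0.
have he i n : e i n.+1 *+ 2 = e i n.
  by case: n => [|n]; rewrite /= ?T_double ?halvesS.
have h2 n Q : Q *+ 2 = 0 -> span (e 0 n.+1) (e 1 n.+1) Q.
  move/(tors2_span (T_double 0) (T_double 1) (@T_neq0 _) (@T_neq0 _)).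
  case=> [/T_inj //|a [b ->]].
  exists (2 ^ n * a)%N, (2 ^ n * b)%N => /=.
  by rewrite !mulrnA !(halves_mul _ 0).
move=> Q Q0; apply: (span_chain (he 0) (he 1) h2 (n := N.+1)).
by rewrite Q0; exists 0%N, 0%N; rewrite !mulr0n addr0.
Qed.

End TwoTorsion.

(** * The Weil pairing *)

Section MillerFunctions.
Variables (L : closedFieldType) (C : curve L).
Implicit Types A B D E P Q Z : cpoint C.

Definition milC A B Z : L := mil C (val A) (val B) (val Z).

(** For affine points, the abscissae of Z and P differ, so that the vertical
    line through P does not vanish at Z. *)
Definition away Z P : Prop := Z <> P /\ Z <> - P.

Lemma away_x Z P x y x' y' : away Z P ->
  val Z = Affine x y -> val P = Affine x' y' -> x - x' != 0.
Proof.
case=> n1 n2 zE pE; apply: (@on_x_neq _ C _ y _ y').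
- by rewrite -zE; apply: onP.
- by rewrite -pE; apply: onP.
- by rewrite -zE -pE => /val_inj.
- by rewrite -zE -pE -val_opp => /val_inj.
Qed.

Lemma awayC Z P : away Z P -> away P Z.
Proof. by case=> n1 n2; split=> e; [apply: n1|apply: n2]; rewrite e ?opprK. Qed.

Lemma mil0l B Z : milC 0 B Z = 1. Proof. by []. Qed.
Lemma mil0r A Z : milC A 0 Z = 1. Proof. by rewrite /milC; case: (val A). Qed.
Lemma mil_O A B : milC A B 0 = 1.
Proof. by rewrite /milC /=; case: (val A) => //; case: (val B). Qed.

Lemma affine_ex P : P <> 0 -> exists x y, val P = Affine x y.
Proof.
case: P => -[|x y] h n; last by exists x, y.
by case: n; apply: val_inj.
Qed.

Lemma line_ex A B x1 y1 x2 y2 : val A = Affine x1 y1 -> val B = Affine x2 y2 ->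
  A + B <> 0 -> exists s c x3, [/\ meets C s c x1 x2 x3, y1 = s * x1 + c,
   y2 = s * x2 + c, val (A + B) = Affine x3 (- (s * x3 + c)) &
   forall Z x y, val Z = Affine x y ->
     milC A B Z = (y - (s * x + c)) / (x - x3)].
Proof.
move=> AE BE n0; have [] := @add_meets _ C x1 y1 x2 y2.
- by rewrite -AE; apply: onP.
- by rewrite -BE; apply: onP.
- case=> xE yE; apply: n0; apply/eqP; rewrite addrC addr_eq0; apply/eqP.
  by apply: val_inj; rewrite val_opp AE BE /= xE yE opprK.
move=> s [c [x3 [h l1 l2 SE _]]]; exists s, c, x3; split=> //.
  by rewrite val_add AE BE.
move=> Z x y ZE; rewrite /milC AE BE ZE; apply: (mil_meets _ _ _ h) => //.
by rewrite -AE; apply: onP.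
Qed.

Lemma milNE A Z x1 y1 x y : val A = Affine x1 y1 -> val Z = Affine x y ->
  milC A (- A) Z = x - x1.
Proof. by move=> AE ZE; rewrite /milC val_opp AE ZE /= eqxx opprK eqxx. Qed.

Lemma milC_sym A B Z : milC A B Z = milC B A Z.
Proof.
case: (pselect (A = 0)) => [->|/affine_ex[x1 [y1 AE]]]; first by rewrite mil0r.
case: (pselect (B = 0)) => [->|/affine_ex[x2 [y2 BE]]]; first by rewrite mil0r.
case: (pselect (Z = 0)) => [->|/affine_ex[x [y ZE]]]; first by rewrite !mil_O.
case: (pselect (A + B = 0)) => [S0|n0].
  have BN : B = - A by apply/eqP; rewrite -addr_eq0 addrC S0.
  have NE : val (- A) = Affine x1 (- y1) by rewrite val_opp AE.
  by have := milNE NE ZE; rewrite opprK BN (milNE AE ZE) => ->.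
have [s [c [x3 [h l1 l2 _ eq]]]] := line_ex AE BE n0; rewrite (eq _ _ _ ZE).
rewrite /milC AE BE ZE (mil_meets _ _ _ (meets_perm h)) //.
by rewrite -BE; apply: onP.
Qed.

Lemma mil_neq0 A B Z : away Z A -> away Z B -> away Z (A + B) ->
  milC A B Z != 0.
Proof.
move=> zA zB zS.
case: (pselect (A = 0)) => [->|/affine_ex[x1 [y1 AE]]];
  first by rewrite oner_neq0.
case: (pselect (B = 0)) => [->|/affine_ex[x2 [y2 BE]]].
  by rewrite mil0r oner_neq0.
case: (pselect (Z = 0)) => [->|/affine_ex[x [y ZE]]].
  by rewrite mil_O oner_neq0.
case: (pselect (A + B = 0)) => [/eqP|n0].
  rewrite addrC addr_eq0 => /eqP ->; rewrite (milNE AE ZE).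
  exact: away_x zA ZE AE.
have [s [c [x3 [h l1 l2 SE eq]]]] := line_ex AE BE n0; rewrite (eq _ _ _ ZE).
have nS := away_x zS ZE SE; rewrite mulf_neq0 ?invr_eq0 //.
rewrite subr_eq0; apply/eqP => yE; have := meetsE h x; rewrite -yE.
have := onP Z; rewrite ZE /= => ->; rewrite subrr => /esym/eqP.
by rewrite !mulf_eq0 (negbTE nS) (negbTE (away_x zA ZE AE))
  (negbTE (away_x zB ZE BE)).
Qed.

(** [mil] is a symmetric 2-cocycle: both sides are the normalised function with
    divisor A + B + D - (A + B + D) - 2 O. *)
Lemma mil_cocycle A B D Z : Z <> 0 -> away Z (A + B) -> away Z (B + D) ->
  away Z A -> away Z D -> away Z (A + B + D) ->
  milC A B Z * milC (A + B) D Z = milC B D Z * milC A (B + D) Z.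
Proof.
move=> nZ zS zU zA zD zV; have [x [y ZE]] := affine_ex nZ.
have special A' D' : away Z (B + D') -> away Z A' -> away Z D' ->
    A' <> 0 -> B <> 0 -> D' <> 0 -> A' + B = 0 ->
    milC A' B Z * milC (A' + B) D' Z = milC B D' Z * milC A' (B + D') Z.
  move=> zU' zA' zD' nA nB nD AB.
  have [x1 [y1 AE]] := affine_ex nA; have [x3 [y3 DE]] := affine_ex nD.
  have BE : B = - A' by apply/eqP; rewrite -addr_eq0 addrC AB.
  rewrite AB mil0l mulr1 BE (milNE AE ZE).
  case: (pselect (- A' + D' = 0)) => [U0|nU].
    rewrite U0 mil0r mulr1; move/eqP: U0; rewrite addrC subr_eq0 => /eqP ->.
    by rewrite milC_sym (milNE AE ZE).
  have NE : val (- A') = Affine x1 (- y1) by rewrite val_opp AE.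
  have [s [c [xU [h l1 l3 UE eq]]]] := line_ex NE DE nU; rewrite (eq _ _ _ ZE).
  have -> : milC A' (- A' + D') Z = (y - (- s * x + - c)) / (x - x3).
    rewrite /milC AE UE ZE (mil_meets (s := - s) (c := - c) (x3 := x3)) //.
    - by rewrite -AE; apply: onP.
    - by apply: meets_opp; apply: meets_perm; do 2! apply: meets_rot.
    - by apply: oppr_inj; rewrite l1; ring.
    - by ring.
  rewrite -BE in UE; have := away_x zU' ZE UE; have := away_x zD' ZE DE.
  have := meetsE h x; have := onP Z; rewrite ZE /= => <- e n3 nU'.
  apply: (mulIf n3); apply: (mulIf nU').
  rewrite -[LHS](_ : (x - x1) * (x - x3) * (x - xU) = _) // -e.
  by field; rewrite n3 nU'.
case: (pselect (A = 0)) => [->|nA]; first by rewrite !mil0l add0r mul1r mulr1.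
case: (pselect (B = 0)) => [->|nB]; first by rewrite mil0r mil0l addr0 add0r.
case: (pselect (D = 0)) => [->|nD]; first by rewrite !mil0r addr0 mulr1 mul1r.
case: (pselect (A + B = 0)) => [AB|nAB]; first exact: special.
case: (pselect (B + D = 0)) => [BD|nBD].
  have DB : D + B = 0 by rewrite addrC.
  have zS' : away Z (B + A) by rewrite addrC.
  have := special D A zS' zD zA nD nB nA DB; rewrite DB mil0l mulr1 => e.
  by rewrite BD mil0r mulr1 (milC_sym B D) e (milC_sym B A) (addrC B A)
    (milC_sym D).
case: (pselect (A + B + D = 0)) => [V0|nV].
  have [x1 [y1 AE]] := affine_ex nA; have [x3 [y3 DE]] := affine_ex nD.
  have [x2 [y2 BE]] := affine_ex nB.
  have SE : A + B = - D by apply/eqP; rewrite -addr_eq0 V0.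
  have UE : B + D = - A by apply/eqP; rewrite -addr_eq0 addrC addrA V0.
  rewrite SE UE (milNE AE ZE) (milC_sym (- D)) (milNE DE ZE).
  have [s [c [x3' [h l1 l2 SE' eq]]]] := line_ex AE BE nAB.
  move: (SE'); rewrite SE val_opp DE /= => -[x3E y3E]; subst x3'.
  rewrite (eq _ _ _ ZE) divfK; last exact: away_x zD ZE DE.
  rewrite /milC BE DE ZE (mil_meets (s := s) (c := c) (x3 := x1)).
  - by rewrite divfK //; apply: away_x zA ZE AE.
  - by rewrite -BE; apply: onP.
  - exact: meets_rot.
  - by [].
  - exact: oppr_inj.
case: (pselect (D = A)) => [->|nDA].
  by rewrite (milC_sym B A) (addrC B) (milC_sym A (A + B)).
have gen A' D' : A' <> 0 -> D' <> 0 -> A' + B <> 0 -> B + D' <> 0 ->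
    A' + B + D' <> 0 -> D' <> A' -> D' <> B -> away Z (A' + B) ->
    away Z (B + D') -> away Z (A' + B + D') ->
    milC A' B Z * milC (A' + B) D' Z = milC B D' Z * milC A' (B + D') Z.
  move=> nA' nD' nAB' nBD' nV' nDA' nDB' zS' zU' zV'.
  have nv (X Y : cpoint C) : X <> Y -> val X <> val Y by move=> n /val_inj.
  have nz (X : cpoint C) : X <> 0 -> val X <> @Infinity L
    by move=> n e; apply: n; apply: val_inj.
  have [||||||||_] :=
    @addP_generic _ C (val A') (val B) (val D') (onP _) (onP _) (onP _);
      try exact: nz; try exact: nv.
  - rewrite -val_opp; apply: nv => e; apply: nAB'; rewrite e; exact: subrr.
  - rewrite -val_opp; apply: nv => e; apply: nBD'; rewrite e; exact: subrr.
  - rewrite -val_opp -val_add; apply: nv => e; apply: nV'; rewrite e;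
      exact: addNr.
  apply; first exact: onP; first by apply: addPA; apply: onP.
  move=> P; rewrite -!val_add => PE.
  have {PE} [Q -> [q1 q2]] : exists2 Q : cpoint C, P = val Q & away Z Q.
    by case: PE => ->; [exists (A' + B)|exists (B + D')|exists (A' + B + D')].
  by rewrite -val_opp; split; apply: nv.
case: (pselect (D = B)) => [DB|nDB]; last exact: gen.
have E3 : D + B + A = A + B + D by rewrite -addrA addrC (addrC B).
have nAD : A <> D by move=> e; apply: nDA.
have nAB' : A <> B by rewrite -DB.
have := gen D A nD nA; rewrite E3 (addrC D B) (addrC B A) (milC_sym D B).
rewrite (milC_sym B A) (milC_sym D (A + B)) (milC_sym (B + D) A).
by move/(_ nBD nAB nV nAD nAB' zU zS zV) => <-.
Qed.

(** Weil reciprocity for the lines through A, B and through D, E.  The sign is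
    the tame symbol at O, where both functions have a simple pole unless one of
    the two lines is vertical. *)
Definition tame (S U : cpoint C) : L := if (S == 0) || (U == 0) then 1 else - 1.

Lemma mil_reciprocity A B D E : A <> 0 -> B <> 0 -> D <> 0 -> E <> 0 ->
  (forall X Y, [\/ X = A, X = B | X = A + B] -> [\/ Y = D, Y = E | Y = D + E] ->
     X <> 0 \/ Y <> 0 -> away X Y) ->
  milC A B D * milC A B E * milC D E (A + B) =
  tame (A + B) (D + E) * (milC A B (D + E) * milC D E A * milC D E B).
Proof.
move=> nA nB nD nE aw.
have [xA [yA AE]] := affine_ex nA; have [xB [yB BE]] := affine_ex nB.
have [xD [yD DE]] := affine_ex nD; have [xE [yE EE]] := affine_ex nE.
have vert A' D' E' xA' yA' xD' yD' xE' yE' : val A' = Affine xA' yA' ->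
    val D' = Affine xD' yD' -> val E' = Affine xE' yE' -> D' + E' <> 0 ->
    away A' (D' + E') ->
    milC A' (- A') D' * milC A' (- A') E' =
    milC A' (- A') (D' + E') * milC D' E' A' * milC D' E' (- A').
  move=> AE' DE' EE' nU aU.
  have [s [c [xU [h l1 l2 UE eq]]]] := line_ex DE' EE' nU.
  have NE : val (- A') = Affine xA' (- yA') by rewrite val_opp AE'.
  rewrite (milNE AE' DE') (milNE AE' EE') (milNE AE' UE).
  rewrite (eq _ _ _ AE') (eq _ _ _ NE).
  have nAU := away_x aU AE' UE.
  have := meetsE h xA'; have := onP A'; rewrite AE' /= => <- e.
  apply: (mulIf nAU); apply: (mulIf nAU).
  transitivity (- ((yA' ^+ 2 - (s * xA' + c) ^+ 2) * (xU - xA'))).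
    by rewrite e; ring.
  by field; rewrite nAU.
rewrite /tame; case: eqVneq => [S0|/eqP nS] /=.
  have BN : B = - A by apply/eqP; rewrite -addr_eq0 addrC S0.
  rewrite S0 mil_O mulr1 mul1r BN.
  case: (pselect (D + E = 0)) => [U0|nU].
    have EN : E = - D by apply/eqP; rewrite -addr_eq0 addrC U0.
    have NA : val (- A) = Affine xA (- yA) by rewrite val_opp AE.
    have ND : val (- D) = Affine xD (- yD) by rewrite val_opp DE.
    rewrite U0 mil_O mul1r EN (milNE AE DE) (milNE AE ND) (milNE DE AE).
    by rewrite (milNE DE NA); ring.
  apply: (vert _ _ _ _ _ _ _ _ _ AE DE EE nU).
  by apply: aw; [exact: Or31|exact: Or33|left].
case: eqVneq => [U0|/eqP nU].
  have EN : E = - D by apply/eqP; rewrite -addr_eq0 addrC U0.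
  rewrite U0 mil_O !mul1r EN.
  rewrite [RHS](vert _ _ _ _ _ _ _ _ _ DE AE BE nS); first by ring.
  by apply: awayC; apply: aw; [exact: Or33|exact: Or31|right].
have [s [c [xS [h l1 l2 SE eq]]]] := line_ex AE BE nS.
have [s' [c' [xU [h' l1' l2' UE eq']]]] := line_ex DE EE nU.
rewrite (eq _ _ _ DE) (eq _ _ _ EE) (eq _ _ _ UE).
rewrite (eq' _ _ _ AE) (eq' _ _ _ BE) (eq' _ _ _ SE).
have nDS : xD - xS != 0.
  by apply: (away_x (awayC (aw _ _ _ _ _)) DE SE);
    [exact: Or33|exact: Or31|left].
have nES : xE - xS != 0.
  by apply: (away_x (awayC (aw _ _ _ _ _)) EE SE);
    [exact: Or33|exact: Or32|left].
have nAU : xA - xU != 0.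
  by apply: (away_x (aw _ _ _ _ _) AE UE); [exact: Or31|exact: Or33|left].
have nBU : xB - xU != 0.
  by apply: (away_x (aw _ _ _ _ _) BE UE); [exact: Or32|exact: Or33|left].
have nSU : xS - xU != 0.
  by apply: (away_x (aw _ _ _ _ _) SE UE); [exact: Or33|exact: Or33|left].
have nUS : xU - xS != 0 by rewrite -opprB oppr_eq0.
have [h1 h2 h3] := h; have [h1' h2' h3'] := h'.
pose d := s' - s; pose g := c' - c; pose sg := s + s'; pose t := c + c'.
have M : (d * xD + g) * (d * xE + g) * (d * xU + g) =
         (d * xA + g) * (d * xB + g) * (d * xS + g).
  transitivity (d ^+ 3 * (e3 C + c' ^+ 2) + d ^+ 2 * g * (e2 C - 2%:R * s' * c')
    + d * g ^+ 2 * (e1 C + s' ^+ 2) + g ^+ 3).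
    by rewrite -h1' -h2' -h3'; ring.
  transitivity (d ^+ 3 * (e3 C + c ^+ 2) + d ^+ 2 * g * (e2 C - 2%:R * s * c)
    + d * g ^+ 2 * (e1 C + s ^+ 2) + g ^+ 3); last first.
    by rewrite -h1 -h2 -h3; ring.
  by rewrite /d /g; ring.
have eU : (sg * xU + t) * (d * xU + g) = (xU - xA) * (xU - xB) * (xU - xS).
  have k := meetsE h' xU; rewrite subrr mulr0 in k.
  rewrite -(meetsE h); apply: (comb1 (c1 := - 1) k); rewrite /sg /t /d /g; ring.
have eS : (sg * xS + t) * (d * xS + g) = - ((xS - xD) * (xS - xE) * (xS - xU)).
  have k := meetsE h xS; rewrite subrr mulr0 in k.
  rewrite -(meetsE h'); apply: (comb1 (c1 := 1) k); rewrite /sg /t /d /g; ring.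
have nU' : d * xU + g != 0.
  have : (sg * xU + t) * (d * xU + g) != 0.
    rewrite eU !mulf_neq0 //; by rewrite -opprB oppr_eq0.
  by rewrite mulf_eq0 negb_or => /andP[].
have nS' : d * xS + g != 0.
  have : (sg * xS + t) * (d * xS + g) != 0.
    rewrite eS oppr_eq0 !mulf_neq0 //; by rewrite -opprB oppr_eq0.
  by rewrite mulf_eq0 negb_or => /andP[].
have key : (d * xD + g) * (d * xE + g) * (sg * xS + t) * ((xA - xU) * (xB - xU))
  = (sg * xU + t) * (d * xA + g) * (d * xB + g) * ((xD - xS) * (xE - xS)).
  apply: (mulIf nU'); apply: (mulIf nS').
  transitivity ((d * xD + g) * (d * xE + g) * (d * xU + g) *
    ((sg * xS + t) * (d * xS + g)) * ((xA - xU) * (xB - xU))); first by ring.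
  transitivity ((d * xA + g) * (d * xB + g) * (d * xS + g) *
    ((sg * xU + t) * (d * xU + g)) * ((xD - xS) * (xE - xS))); last by ring.
  by rewrite M eU eS; ring.
have lD : yD - (s * xD + c) = d * xD + g by rewrite l1' /d /g; ring.
have lE : yE - (s * xE + c) = d * xE + g by rewrite l2' /d /g; ring.
have lA : yA - (s' * xA + c') = - (d * xA + g) by rewrite l1 /d /g; ring.
have lB : yB - (s' * xB + c') = - (d * xB + g) by rewrite l2 /d /g; ring.
have lS : - (s * xS + c) - (s' * xS + c') = - (sg * xS + t)
  by rewrite /sg /t; ring.
have lU : - (s' * xU + c') - (s * xU + c) = - (sg * xU + t)
  by rewrite /sg /t; ring.
rewrite lD lE lA lB lS lU.
apply: (mulIf nDS); apply: (mulIf nES); apply: (mulIf nAU); apply: (mulIf nBU).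
apply: (mulIf nSU).
transitivity (- ((d * xD + g) * (d * xE + g) * (sg * xS + t) *
  ((xA - xU) * (xB - xU)))); first by field; rewrite nDS nES nSU.
rewrite key; by field; rewrite nUS nAU nBU.
Qed.

End MillerFunctions.

Section WeilPairing.
Variables (L : closedFieldType) (C : curve L).
Implicit Types A B D E P Q Z : cpoint C.

(** The normalised function with divisor j P - (j P) - (j - 1) O. *)
Definition miller j P Z : L := \prod_(i < j) milC (P *+ i) P Z.

Lemma millerS j P Z : miller j.+1 P Z = miller j P Z * milC (P *+ j) P Z.
Proof. by rewrite /miller big_ord_recr. Qed.

Lemma miller0 P Z : miller 0 P Z = 1. Proof. by rewrite /miller big_ord0. Qed.

Lemma miller1 P Z : miller 1 P Z = 1.
Proof. by rewrite millerS miller0 mul1r mulr0n mil0l. Qed.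

Lemma miller_O j P : miller j P 0 = 1.
Proof. by rewrite /miller big1 // => i _; rewrite mil_O. Qed.

Section OneArgument.
Variables (Q Z : cpoint C).
Hypotheses (nZ : Z <> 0) (aw : forall i, away Z (Q *+ i)).

Lemma millerD j k :
  miller (j + k) Q Z = miller j Q Z * miller k Q Z * milC (Q *+ j) (Q *+ k) Z.
Proof.
elim: k => [|k IH]; first by rewrite addn0 miller0 mulr0n mil0r !mulr1.
have coc : milC (Q *+ j) (Q *+ k) Z * milC (Q *+ (j + k)) Q Z =
    milC (Q *+ k) Q Z * milC (Q *+ j) (Q *+ k.+1) Z.
  rewrite mulrnDr [Q *+ k.+1]mulrSr; apply: mil_cocycle => //.
  - by rewrite -mulrnDr.
  - by rewrite -mulrSr.
  - by rewrite -[X in away _ X]mulr1n.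
  - by rewrite -mulrnDr -mulrSr.
rewrite addnS !millerS {}IH.
by apply: (comb1 (c1 := miller j Q Z * miller k Q Z) coc); ring.
Qed.

Lemma miller_neq0 j : miller j Q Z != 0.
Proof.
apply/prodf_neq0 => i _; apply: mil_neq0 => //.
- by rewrite -[X in away _ X]mulr1n.
- by rewrite -mulrSr.
Qed.

(** Both sides have divisor j m Q - (j m Q) - (j m - 1) O. *)
Lemma millerM m j : miller j (Q *+ m) Z * miller m Q Z ^+ j = miller (m * j) Q
  Z.
Proof.
elim: j => [|j IH]; first by rewrite muln0 !miller0 expr0 mulr1.
rewrite mulnSr millerD -{}IH millerS exprS -!mulrnA.
by ring.
Qed.

Lemma millerX N m : Q *+ N = 0 -> miller (N * m) Q Z = miller N Q Z ^+ m.
Proof.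
move=> QN; elim: m => [|m IH]; first by rewrite muln0 miller0.
by rewrite mulnSr millerD IH QN mil0r mulr1 exprSr.
Qed.

End OneArgument.

Definition disj P Q := forall i j, P *+ i = Q *+ j -> P *+ i = 0.

Lemma disjC P Q : disj P Q -> disj Q P.
Proof. by move=> h i j e; have := h j i (esym e); rewrite e. Qed.

Lemma disj_mul P Q m : disj P Q -> disj (P *+ m) Q.
Proof. by move=> h i j; rewrite -mulrnA => /h. Qed.

Lemma disj_away n P Q i j : Q *+ (2 ^ n) = 0 -> disj P Q ->
  P *+ i <> 0 \/ Q *+ j <> 0 -> away (P *+ i) (Q *+ j).
Proof.
move=> Qn h n0; have z e : P *+ i = Q *+ e -> P *+ i = 0 by exact: h.
split=> e.
  by have z0 := z _ e; case: n0; rewrite -?e z0.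
have [j' jE] : gen Q (- (Q *+ j)) by apply: gen_opp Qn _; exists j.
have z0 : P *+ i = 0 by apply: (z j'); rewrite e.
by case: n0 => //; move/eqP: e; rewrite z0 eq_sym oppr_eq0 => /eqP.
Qed.

Section Reciprocity.
Variables (P Q : cpoint C) (n a b : nat).
Hypotheses (Qn : Q *+ (2 ^ n) = 0) (PQ : disj P Q).
Hypotheses (na : Q *+ a <> 0) (nb : Q *+ b <> 0).
Notation D := (Q *+ a).
Notation E := (Q *+ b).

Lemma mil_step j : P <> 0 -> P *+ j <> 0 ->
  milC (P *+ j) P D * milC (P *+ j) P E * milC D E (P *+ j.+1) =
  tame (P *+ j.+1) (D + E) *
    (milC (P *+ j) P (D + E) * milC D E (P *+ j) * milC D E P).
Proof.
move=> nP nj; rewrite mulrSr; apply: mil_reciprocity => // X Y hX hY nXY.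
have [i XE] : gen P X.
  by case: hX => ->; [exists j|exists 1%N|exists j.+1; rewrite mulrSr].
have [k YE] : gen Q Y.
  by case: hY => ->; [exists a|exists b|exists (a + b)%N; rewrite mulrnDr].
by rewrite XE YE in nXY *; apply: disj_away Qn PQ nXY.
Qed.

Lemma milDE_neq0 j : P *+ j <> 0 -> milC D E (P *+ j) != 0.
Proof.
move=> nj; apply: mil_neq0; rewrite -?mulrnDr; apply: disj_away Qn PQ _;
  by left.
Qed.

(** Reciprocity for each factor of the Miller function of P; the factors at i P
    and (i + 1) P telescope. *)
Lemma miller_reciprocity_partial j : (forall i, (0 < i <= j.+1)%N ->
  P *+ i <> 0) ->
  miller j.+1 P D * miller j.+1 P E * milC D E (P *+ j.+1) =
  tame P (D + E) ^+ j * miller j.+1 P (D + E) * milC D E P ^+ j.+1.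
Proof.
elim: j => [|j IH] nP; first by rewrite !miller1 !mul1r.
have nP' i : (0 < i <= j.+1)%N -> P *+ i <> 0.
  by move=> /andP[i0 ij]; apply: nP; rewrite i0 ltnW.
have {}IH := IH nP'.
have nj : P *+ j.+1 <> 0 by apply: nP; rewrite leqnSn.
have n1 : P <> 0 by apply: (nP 1%N).
have := mil_step n1 nj.
have -> : tame (P *+ j.+2) (D + E) = tame P (D + E).
  by rewrite /tame; have /eqP/negbTE -> := nP j.+2 (leqnn _);
    have /eqP/negbTE -> := n1.
have := milDE_neq0 nj; move: IH; rewrite !(millerS j.+1).
set t := tame _ _; set x := milC (P *+ j.+1) P D; set y := milC (P *+ j.+1) P E.
set z := milC D E (P *+ j.+1); set w := milC D E (P *+ j.+2);
  set u := milC (P *+ j.+1) P _.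
set v := milC D E P.
set f := miller _ P D; set g := miller _ P E; set h := miller _ P _.
move=> IH nz e; apply: (mulIf nz).
transitivity ((f * g * z) * (x * y * w)); first by ring.
by rewrite IH e !exprS; ring.
Qed.

(** The last factor is vertical and contributes no sign, and the number of the
    others, 2^(k+1) - 2, is even. *)
Lemma miller_reciprocity k : ord2 k.+1 P ->
  miller (2 ^ k.+1) P D * miller (2 ^ k.+1) P E =
  miller (2 ^ k.+1) P (D + E) * milC D E P ^+ (2 ^ k.+1).
Proof.
move=> hP; have NE : (2 ^ k.+1 = (2 ^ k.+1 - 2).+2)%N.
  by rewrite -[RHS]addn2 subnK // expnS leq_pmulr // expn_gt0.
set j := (2 ^ k.+1 - 2)%N in NE.
have nP i : (0 < i <= j.+1)%N -> P *+ i <> 0.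
  move=> /andP[i0 ij] /hP; rewrite NE => /(dvdn_leq i0).
  by rewrite ltnNge ij.
have := miller_reciprocity_partial nP.
have nj : P *+ j.+1 <> 0 by apply: nP; rewrite leqnn.
have n1 : P <> 0 by apply: (nP 1%N).
have := mil_step n1 nj.
have -> : P *+ j.+2 = 0 by rewrite -NE; apply: ord2_tors.
rewrite {1}/tame eqxx mil_O mulr1 mul1r.
have -> : tame P (D + E) ^+ j = 1.
  have : ~~ odd j.
    by have := erefl (odd (2 ^ k.+1)); rewrite {1}NE /= negbK oddX /= => ->.
  move/even_halfK <-; rewrite -mul2n exprM /tame.
  by case: ifP => _; rewrite ?sqrrN !expr1n.
have := milDE_neq0 nj; rewrite NE !(millerS j.+1) mul1r.
set x := milC (P *+ j.+1) P D; set y := milC (P *+ j.+1) P E.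
set z := milC D E (P *+ j.+1); set u := milC (P *+ j.+1) P _.
set v := milC D E P.
set f := miller _ P D; set g := miller _ P E; set h := miller _ P _.
move=> nz e IH; apply: (mulIf nz).
transitivity ((f * g * z) * (x * y)); first by ring.
by rewrite IH e !exprS; ring.
Qed.

End Reciprocity.

(** The Weil pairing on E[2^n], for points that generate disjoint subgroups. *)
Definition weil n P Q : L := miller (2 ^ n) P Q / miller (2 ^ n) Q P.

Lemma weilC n P Q : weil n Q P = (weil n P Q)^-1.
Proof. by rewrite /weil invf_div. Qed.

Section Bilinearity.
Variable k : nat.
Notation N := (2 ^ k.+1)%N.

(** Compared with the m-th powers, numerator and denominator both lose a factor
    [miller m Q P ^+ N], the first by reciprocity and the second by the cocycle
    relation. *)
Lemma weilMr P Q m : ord2 k.+1 P -> Q *+ N = 0 -> disj P Q ->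
  weil k.+1 P (Q *+ m) = weil k.+1 P Q ^+ m.
Proof.
move=> hP hQ PQ; have nP : P <> 0.
  by move=> P0; case: (ord2_top hP); rewrite P0 mul0rn.
have aw i : away P (Q *+ i).
  by rewrite -[P]mulr1n; apply: disj_away hQ PQ _; left.
have nm j := miller_neq0 aw j.
have e1 : miller N P (Q *+ m) * miller m Q P ^+ N = miller N P Q ^+ m.
  case: (pselect (Q = 0)) => [->|nQ].
    rewrite mul0rn miller_O mul1r expr1n /miller big1 ?expr1n // => i _.
    by rewrite mil0r.
  elim: m => [|m IH]; first by rewrite mulr0n miller_O miller0 expr1n mulr1.
  rewrite millerS exprMn exprS -{}IH.
  case: (pselect (Q *+ m = 0)) => [z|nz].
    by rewrite mulrSr z add0r miller_O mil0l expr1n mulr1 mul1r.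
  have := miller_reciprocity hQ PQ nz (_ : Q *+ 1 <> 0) hP;
    rewrite !mulr1n => /(_ nQ).
  rewrite -mulrSr => e; rewrite [in LHS]mulrCA -e; ring.
have e2 : miller N (Q *+ m) P * miller m Q P ^+ N = miller N Q P ^+ m.
  by rewrite millerM // mulnC millerX.
rewrite /weil expr_div_n -e1 -e2 -mulf_div divff ?mulr1 //.
by rewrite expf_neq0.
Qed.

Lemma weil_scale P Q m : ord2 k.+1 P -> ord2 k.+1 Q -> disj P Q ->
  odd m -> weil k.+1 (P *+ m) (Q *+ m) = weil k.+1 P Q ^+ (m * m).
Proof.
move=> hP hQ PQ om; have hPm : ord2 k.+1 (P *+ m).
  move=> j; rewrite -mulrnA hP mulnC Gauss_dvdl // coprimeXl //.
  by rewrite coprime2n.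
rewrite weilMr ?ord2_tors //; last exact: disj_mul.
rewrite exprM; congr (_ ^+ _).
rewrite -[weil _ (P *+ m) Q]invrK -weilC weilMr //; last exact: disjC.
  by rewrite weilC exprVn invrK.
exact: ord2_tors.
Qed.

(** Let P0 and Q0 be the points of order 2 of <P> and <Q>.  By [millerD] the
    numerator of the pairing of P and Q0 is a square times x(Q0) - x(P0); by
    reciprocity the denominator is the same square times x(P0) - x(Q0). *)
Lemma weil_top P Q : ord2 k.+1 P -> ord2 k.+1 Q -> disj P Q ->
  weil k.+1 P Q ^+ (2 ^ k) = - 1.
Proof.
move=> hP hQ PQ; rewrite -weilMr //; last exact: ord2_tors.
pose R := Q *+ (2 ^ k); pose S := P *+ (2 ^ k).
have nR : R <> 0 by exact: ord2_top.
have nS : S <> 0 by exact: ord2_top.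
have R2 : R *+ 2 = 0 by rewrite -mulrnA -expnSr; apply: ord2_tors.
have S2 : S *+ 2 = 0 by rewrite -mulrnA -expnSr; apply: ord2_tors.
have nP : P <> 0 by move=> P0; apply: nS; rewrite /S P0 mul0rn.
have awP i : away P (R *+ i).
  by rewrite -mulrnA -[P]mulr1n; apply: disj_away (ord2_tors hQ) PQ _; left.
have awR i : away R (P *+ i).
  by apply: disj_away (ord2_tors hP) (disjC PQ) _; left.
have awSR : away S R by apply: disj_away (ord2_tors hQ) PQ _; left.
have [xR [yR RE]] := affine_ex nR; have [xS [yS SE]] := affine_ex nS.
have NR : - R = R by apply/opp_eq.
have NS : - S = S by apply/opp_eq.
have x0 : xR - xS != 0 := away_x (awayC awSR) RE SE.
have eR : miller (2 ^ k.+1) R P = milC R R P ^+ (2 ^ k).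
  by rewrite expnS millerX // !millerS miller0 mulr0n mil0l !mul1r mulr1n.
have eP : miller (2 ^ k.+1) P R = miller (2 ^ k) P R ^+ 2 * (xR - xS).
  rewrite expnS mul2n -addnn millerD // -/S -{2}NS (milNE SE RE).
  by rewrite expr2.
have eS : miller (2 ^ k) P R ^+ 2 * (xS - xR) = milC R R P ^+ (2 ^ k).
  have kE : (2 ^ k = (2 ^ k).-1.+1)%N by rewrite prednK // expn_gt0.
  have := @miller_reciprocity_partial P Q k.+1 (2 ^ k) (2 ^ k) (ord2_tors hQ) PQ
    nR nR (2 ^ k).-1.
  rewrite -!kE -/R -/S.
  have -> : milC R R S = xS - xR by rewrite -{2}NR (milNE RE SE).
  have -> : R + R = 0 by rewrite -mulr2n.
  rewrite /tame eqxx orbT expr1n miller_O !mul1r -expr2; apply.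
  move=> i /andP[i0 ik] /hP /(dvdn_leq i0); rewrite leqNgt.
  by rewrite (leq_ltn_trans ik) // ltn_exp2l.
have nv : milC R R P != 0.
  apply: mil_neq0; rewrite -?mulr2n;
    [move: (awP 1%N)|move: (awP 1%N)|move: (awP 2%N)];
  by rewrite ?mulr1n.
rewrite /weil -/R eP eR -eS.
have nz : miller (2 ^ k) P R ^+ 2 * (xS - xR) != 0 by rewrite eS expf_neq0.
by apply: (mulIf nz); rewrite divfK //; ring.
Qed.

Lemma weil_primitive P Q : ord2 k.+1 P -> ord2 k.+1 Q -> disj P Q ->
  (2 ^ k.+1).-primitive_root (weil k.+1 P Q).
Proof.
move=> hP hQ PQ; have top := weil_top hP hQ PQ.
have w1 : weil k.+1 P Q ^+ (2 ^ k.+1) = 1.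
  by rewrite expnSr exprM top sqrrN expr1n.
have [m hm] := prim_order_exists (expn_gt0 2 k.+1 : (0 < 2 ^ k.+1)%N) w1.
case/dvdn_pfactor=> // j; rewrite leq_eqVlt ltnS => /orP[/eqP-> <- //|jk mE].
have : weil k.+1 P Q ^+ (2 ^ k) = 1.
  have -> : (2 ^ k = m * 2 ^ (k - j))%N by rewrite mE -expnD subnKC.
  by rewrite exprM (prim_expr_order hm) expr1n.
rewrite top => /eqP; rewrite eq_sym -subr_eq0 opprK -mulr2n.
by rewrite (negbTE (two_neq0 C)).
Qed.

End Bilinearity.

End WeilPairing.

(** * Isogenies of degree 2 *)

Section Isogeny.
Variables (L : closedFieldType) (C : curve L) (i : 'I_3).

Notation t := (C i).
Notation d := (C (i + 1) - C i).
Notation e := (C (i + 2%:R) - C i).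
Notation sd := (sqrtL d).
Notation se := (sqrtL e).

Lemma ord3P (j : 'I_3) : [\/ j = 0, j = 1 | j = 2%:R].
Proof.
case: j => [[|[|[|//]]] ?]; [apply: Or31|apply: Or32|apply: Or33];
exact: val_inj.
Qed.

Lemma ord3_neq : [/\ i + 1 != i, i + 2%:R != i & i + 1 != i + 2%:R].
Proof. by case: (ord3P i) => ->. Qed.

Lemma rot_sym (V : nmodType) (F : 'I_3 -> V) :
  F 0 + F 1 + F 2%:R = F i + F (i + 1) + F (i + 2%:R).
Proof.
rewrite -!(big_ord3 +%R) (reindex_inj (addrI i)) /=.
by rewrite big_ord3 addr0.
Qed.

Lemma e1_shift : e1 C = 3%:R * t + d + e.
Proof. by rewrite /e1 rot_sym; ring. Qed.

Lemma e2_shift : e2 C = 3%:R * t ^+ 2 + 2%:R * t * (d + e) + d * e.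
Proof.
have -> : 3%:R * t ^+ 2 + 2%:R * t * (d + e) + d * e =
  C i * C (i + 1) + C i * C (i + 2%:R) + C (i + 1) * C (i + 2%:R) by ring.
case: (ord3P i) => ->; rewrite /e2 ?add0r //.
- have -> : 1 + 1 = 2%:R :> 'I_3 by apply: val_inj.
  by have -> : 1 + 2%:R = 0 :> 'I_3 by [apply: val_inj]; ring.
- have -> : 2%:R + 1 = 0 :> 'I_3 by apply: val_inj.
  by have -> : 2%:R + 2%:R = 1 :> 'I_3 by [apply: val_inj]; ring.
Qed.

Lemma e3_shift : e3 C = t * (t + d) * (t + e).
Proof.
have -> : t * (t + d) * (t + e) = C i * C (i + 1) * C (i + 2%:R) by ring.
case: (ord3P i) => ->; rewrite /e3 ?add0r //.
- have -> : 1 + 1 = 2%:R :> 'I_3 by apply: val_inj.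
  by have -> : 1 + 2%:R = 0 :> 'I_3 by [apply: val_inj]; ring.
- have -> : 2%:R + 1 = 0 :> 'I_3 by apply: val_inj.
  by have -> : 2%:R + 2%:R = 1 :> 'I_3 by [apply: val_inj]; ring.
Qed.

Lemma de_neq0 : [/\ d != 0, e != 0 & d != e].
Proof.
have [n1 n2 n12] := ord3_neq.
rewrite !subr_eq0 !(inj_eq (@root_inj _ C)) n1 n2; split=> //.
by rewrite (inj_eq (addIr _)) (inj_eq (@root_inj _ C)).
Qed.

(** The roots of X^3 + 2 (d + e) X^2 + (d - e)^2 X, where d and e are the
    differences of the roots of C with the abscissa t of the kernel. *)
Definition isog_root (j : 'I_3) : L :=
  [:: 0; - (sd + se) ^+ 2; - (sd - se) ^+ 2]`_j.

Fact isog_root_inj : injective isog_root.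
Proof.
have [nd ne nde] := de_neq0.
have sdd := sqrtLK d; have see := sqrtLK e.
have nr1 : (sd + se) ^+ 2 != 0.
  rewrite sqrf_eq0; apply: contra nde => /eqP h.
  rewrite -subr_eq0 -sdd -see; apply/eqP.
  by apply: (comb1 (c1 := sd - se) h); ring.
have nr2 : (sd - se) ^+ 2 != 0.
  rewrite sqrf_eq0; apply: contra nde => /eqP h.
  rewrite -subr_eq0 -sdd -see; apply/eqP.
  by apply: (comb1 (c1 := sd + se) h); ring.
have nr12 : (sd + se) ^+ 2 != (sd - se) ^+ 2.
  rewrite -subr_eq0.
  have -> : (sd + se) ^+ 2 - (sd - se) ^+ 2 = 2%:R * 2%:R * (sd * se) by ring.
  rewrite !mulf_neq0 ?(two_neq0 C) //.
    by apply: contra nd => /eqP h; rewrite -sdd h expr0n.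
  by apply: contra ne => /eqP h; rewrite -see h expr0n.
have h1 : - (sd + se) ^+ 2 != 0 by rewrite oppr_eq0.
have h2 : - (sd - se) ^+ 2 != 0 by rewrite oppr_eq0.
have h3 : - (sd + se) ^+ 2 != - (sd - se) ^+ 2 by rewrite (inj_eq oppr_inj).
move=> j k; case: (ord3P j) => ->; case: (ord3P k) => ->;
  rewrite /isog_root //=.
- by move/esym/eqP; rewrite (negbTE h1).
- by move/esym/eqP; rewrite (negbTE h2).
- by move/eqP; rewrite (negbTE h1).
- by move/eqP; rewrite (negbTE h3).
- by move/eqP; rewrite (negbTE h2).
- by move/esym/eqP; rewrite (negbTE h3).
Qed.

Definition isog_curve : curve L := Curve isog_root_inj (two_neq0 C).
Notation C' := isog_curve.

Lemma isog_e1 : e1 C' = - (2%:R * (d + e)).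
Proof.
rewrite /e1 /= /isog_root /= -[in RHS](sqrtLK d) -[in RHS](sqrtLK e); ring.
Qed.

Lemma isog_e2 : e2 C' = (d - e) ^+ 2.
Proof.
rewrite /e2 /= /isog_root /= -[in RHS](sqrtLK d) -[in RHS](sqrtLK e); ring.
Qed.

Lemma isog_e3 : e3 C' = 0.
Proof. by rewrite /e3 /= /isog_root /= !mul0r. Qed.

Definition isog_pt (P : Defs.point L) : Defs.point L :=
  if P is Affine x y then
    if x == t then @Infinity L else
    Affine (y ^+ 2 / (x - t) ^+ 2) (y * (d * e - (x - t) ^+ 2) / (x - t) ^+ 2)
  else @Infinity L.

Lemma cubic_shift x :
  (cubic C).[x] = (x - t) * (x - t - d) * (x - t - e).
Proof. by rewrite cubicE e1_shift e2_shift e3_shift; ring. Qed.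

(** With w = y / (x - t), the image point is (w^2, w (d e / (x - t) - (x - t))),
    and the equation of C reads w^2 = (x - t) + d e / (x - t) - (d + e). *)
Lemma isog_ptE x y : x != t -> isog_pt (Affine x y) =
  Affine ((y / (x - t)) ^+ 2)
         ((y / (x - t)) * (d * e / (x - t) - (x - t))).
Proof.
move=> nx; rewrite /isog_pt (negbTE nx);
  have nu : x - t != 0 by rewrite subr_eq0.
by congr Affine; field; rewrite nu.
Qed.

Lemma isog_slope x y : x != t -> oncurve C (Affine x y) ->
  (y / (x - t)) ^+ 2 = (x - t) + d * e / (x - t) - (d + e).
Proof.
move=> nx; rewrite /= cubic_shift expr_div_n => ->.
have nu : x - t != 0 by rewrite subr_eq0.
by field; rewrite nu.
Qed.

Lemma on_isog P : oncurve C P -> oncurve C' (isog_pt P).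
Proof.
case: P => // x y onP; case: (eqVneq x t) => [xE|nx].
  by rewrite /isog_pt xE eqxx.
rewrite isog_ptE //=; have nu : x - t != 0 by rewrite subr_eq0.
rewrite cubicE isog_e1 isog_e2 isog_e3 exprMn (isog_slope nx onP).
by field; rewrite nu.
Qed.

Definition isog (P : cpoint C) : cpoint C' := mkP (on_isog (onP P)).

Lemma isogN P : isog (- P) = - isog P.
Proof.
apply: val_inj; rewrite /= ; case: P => -[|x y] h //=.
case: ifP => //= _; congr Affine; first by rewrite sqrrN.
by rewrite !mulNr.
Qed.

Lemma isog_eq0 P : isog P = 0 <-> P = 0 \/ P = T C i.
Proof.
split=> [|[->|->]]; last by apply: val_inj; rewrite /= eqxx.
  case: P => -[|x y] h e0; first by left; apply: val_inj.
  right; apply: val_inj => /=; move: e0 => /(congr1 val) /=.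
  case: eqVneq => // xE _; rewrite xE; congr Affine; apply/eqP.
  have := h; rewrite asboolE /= => onP; rewrite -sqrf_eq0 onP cubic_shift xE.
  by rewrite subrr !mul0r.
exact: val_inj.
Qed.

Lemma isogT : isog (T C i) = 0.
Proof. by apply/isog_eq0; right. Qed.

Local Arguments isog_pt : simpl never.
Local Arguments addP : simpl never.

Lemma isog_addT P : isog (P + T C i) = isog P.
Proof.
case: (pselect (P = 0)) => [->|nP]; first by rewrite add0r isogT;
  apply: val_inj.
case: (pselect (P = T C i)) => [->|nT].
  by rewrite -mulr2n T_double isogT; apply: val_inj.
case: P nP nT => -[|x y] h nP nT; first by case: nP; apply: val_inj.
have onP := onP (CPoint h); rewrite /= in onP.
have nx : x != t.
  apply/eqP => xE; apply: nT; apply: val_inj => /=; rewrite xE; congr Affine.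
  by apply/eqP; rewrite -sqrf_eq0 onP cubic_shift xE subrr !mul0r.
have nu : x - t != 0 by rewrite subr_eq0.
have [nd ne _] := de_neq0.
have hs := isog_slope nx onP.
set u := x - t in nu hs *; set s := y / u in hs.
pose c := - (s * t); pose x3 := t + d * e / u.
have xE : x = t + u by rewrite /u; ring.
have yE : y = s * u by rewrite /s divfK.
have hc : meets C s c x t x3.
  split; rewrite /x3 /c ?e1_shift ?e2_shift ?e3_shift xE.
  - by apply: (comb1 (c1 := - 1) hs); ring.
  - by apply: (comb1 (c1 := - 2%:R * t) hs); field; rewrite nu.
  - by apply: (comb1 (c1 := - t ^+ 2) hs); field; rewrite nu.
have n3 : x3 != t by rewrite /x3 -subr_eq0 addrC addrA addNr add0r !mulf_neq0
  ?invr_eq0.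
apply: val_inj; rewrite /= (isog_ptE _ nx) -/u -/s.
rewrite (meets_slope onP hc); last first.
- by rewrite /c; ring.
- by rewrite /c yE xE; ring.
rewrite (isog_ptE _ n3).
have -> : x3 - t = d * e / u by rewrite /x3; ring.
have -> : - (s * x3 + c) / (d * e / u) = - s.
  by rewrite /x3 /c; field; rewrite nu nd ne.
by congr Affine; [ring|field; rewrite nu nd ne].
Qed.

(** Putting w = y / (x - t) on the line y = s (x - t) + c0, the product of the
    abscissae x - t of the three points being c0^2, one gets w1 = s + (x2 - t)
    (x3 - t) / c0.  The symmetric functions of the wi follow, and those of their
    squares say that the image points lie on the line of slope d e / c0 - s. *)
Lemma isog_meets s c x1 x2 x3 y1 y2 :
  meets C s c x1 x2 x3 -> y1 = s * x1 + c -> y2 = s * x2 + c ->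
  x1 != t -> x2 != t -> x3 != t ->
  let y3 := s * x3 + c in
  let w x y := y / (x - t) in
  let Y x y := w x y * (d * e / (x - t) - (x - t)) in
  exists s' c', [/\ meets C' s' c' (w x1 y1 ^+ 2) (w x2 y2 ^+ 2) (w x3 y3 ^+ 2),
    Y x1 y1 = s' * w x1 y1 ^+ 2 + c', Y x2 y2 = s' * w x2 y2 ^+ 2 + c' &
    Y x3 y3 = s' * w x3 y3 ^+ 2 + c'].
Proof.
move=> [h1 h2 h3] l1 l2 n1 n2 n3 y3 w Y.
have l3 : y3 = s * x3 + c by [].
rewrite e1_shift e2_shift e3_shift in h1 h2 h3.
pose u1 := x1 - t; pose u2 := x2 - t; pose u3 := x3 - t; pose c0 := c + s * t.
have k1 : u1 + u2 + u3 = d + e + s ^+ 2.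
  by apply: (comb1 (c1 := 1) h1); rewrite /u1 /u2 /u3; ring.
have k2 : u1 * u2 + u1 * u3 + u2 * u3 = d * e - 2%:R * s * c0.
  apply: (comb2 (c1 := 1) (c2 := - 2%:R * t) h2 h1).
  by rewrite /u1 /u2 /u3 /c0; ring.
have k3 : u1 * u2 * u3 = c0 ^+ 2.
  apply: (comb3 (c1 := 1) (c2 := - t) (c3 := t ^+ 2) h3 h2 h1).
  by rewrite /u1 /u2 /u3 /c0; ring.
have m1 : u1 != 0 by rewrite subr_eq0.
have m2 : u2 != 0 by rewrite subr_eq0.
have m3 : u3 != 0 by rewrite subr_eq0.
have nc : c0 != 0 by rewrite -sqrf_eq0 -k3 !mulf_neq0.
pose w1 := s + u2 * u3 / c0; pose w2 := s + u1 * u3 / c0.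
pose w3 := s + u1 * u2 / c0; pose k := d * e / c0.
have wE x y : y = s * x + c -> x - t != 0 -> w x y = s + c0 / (x - t).
  by move=> -> n; rewrite /w /c0; field; rewrite n.
have w1E : w x1 y1 = w1.
  rewrite wE //; congr (_ + _); apply: (mulIf nc); rewrite divfK // -/u1.
  by rewrite mulrAC -expr2 -k3; field; rewrite m1.
have w2E : w x2 y2 = w2.
  rewrite wE //; congr (_ + _); apply: (mulIf nc); rewrite divfK // -/u2.
  by rewrite mulrAC -expr2 -k3; field; rewrite m2.
have w3E : w x3 y3 = w3.
  rewrite wE //; congr (_ + _); apply: (mulIf nc); rewrite divfK // -/u3.
  by rewrite mulrAC -expr2 -k3; field; rewrite m3.
have W1 : w1 + w2 + w3 = s + k.
  rewrite /w1 /w2 /w3 /k; apply: (comb1 (c1 := c0^-1) k2).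
  by field; rewrite nc.
have W2 : w1 * w2 + w1 * w3 + w2 * w3 = d + e + 2%:R * s * k.
  rewrite /w1 /w2 /w3 /k; apply: (comb3 (c1 := 2%:R * s / c0)
    (c2 := (u1 + u2 + u3) / c0 ^+ 2) (c3 := 1) k2 k3 k1).
  by field; rewrite nc.
have W3 : w1 * w2 * w3 = s * (d + e) + k * s ^+ 2 + c0.
  rewrite /w1 /w2 /w3 /k; apply: (comb4 (c1 := s ^+ 2 / c0)
    (c2 := s * (u1 + u2 + u3) / c0 ^+ 2) (c3 := s)
    (c4 := (u1 * u2 * u3 + c0 ^+ 2) / c0 ^+ 3) k2 k3 k1 k3).
  by field; rewrite nc.
pose s' := k - s; pose c' := - (s * (d + e) + k * s ^+ 2 + c0).
have YE x y ww : w x y = ww -> x - t != 0 -> ww = s + c0 / (x - t) ->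
    (ww - w1) * (ww - w2) * (ww - w3) = 0 ->
    ww ^+ 2 = (x - t) + d * e / (x - t) - (d + e) ->
    Y x y = s' * ww ^+ 2 + c'.
  move=> E n E2 z q; rewrite /Y E.
  have dE : d * e / (x - t) = k * (ww - s).
    by rewrite E2 /k; field; rewrite n nc.
  have uE : x - t = ww ^+ 2 + (d + e) - k * (ww - s) by rewrite -dE q; ring.
  rewrite dE uE.
  apply: (comb4 (c1 := - 1) (c2 := - ww ^+ 2) (c3 := ww) (c4 :=
    - 1) z W1 W2 W3).
  by rewrite /s' /c'; ring.
have on x y ww : w x y = ww -> x - t != 0 -> y = s * x + c ->
    (cubic C).[x] = y ^+ 2 -> ww ^+ 2 = (x - t) + d * e / (x - t) - (d + e).
  move=> <- n lxy onP; apply: isog_slope; first by rewrite -subr_eq0.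
  by rewrite /= onP.
have onl x y : (x - x1) * (x - x2) * (x - x3) = 0 -> y = s * x + c ->
    (cubic C).[x] = y ^+ 2.
  move=> z ->; apply/eqP; rewrite -subr_eq0 cubicE e1_shift e2_shift e3_shift.
  rewrite -z; apply/eqP.
  by apply: (comb3 (c1 := x ^+ 2) (c2 := - x) (c3 := 1) h1 h2 h3); ring.
exists s', c'; rewrite w1E w2E w3E; split.
- split; rewrite ?isog_e1 ?isog_e2 ?isog_e3.
  + by apply: (comb2 (c1 := w1 + w2 + w3 + s + k) (c2 := - 2%:R) W1 W2);
       rewrite /s'; ring.
  + apply: (comb3 (c1 := w1 * w2 + w1 * w3 + w2 * w3 + d + e + 2%:R * s * k)
      (c2 := - 2%:R * (w1 * w2 * w3)) (c3 := - 2%:R * (s + k)) W2 W1 W3).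
    by rewrite /s' /c' /k; field; rewrite nc.
  + by rewrite -!exprMn W3 /c'; ring.
- apply: (YE _ _ w1) => //; first by rewrite -w1E wE.
    by rewrite subrr !mul0r.
  by apply: on w1E _ _ _ => //; apply: onl => //; rewrite subrr !mul0r.
- apply: (YE _ _ w2) => //; first by rewrite -w2E wE.
    by rewrite subrr mulr0 mul0r.
  by apply: on w2E _ _ _ => //; apply: onl => //; rewrite subrr mulr0 mul0r.
- apply: (YE _ _ w3) => //; first by rewrite -w3E wE.
    by rewrite subrr mulr0.
  by apply: on w3E _ _ _ => //; apply: onl => //; rewrite subrr mulr0.
Qed.

Lemma isog_x_neq (P : cpoint C) x y : val P = Affine x y -> P <> T C i ->
  x != t.
Proof.
move=> PE nT; apply/eqP => xE; apply: nT; apply: val_inj => /=.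
have := onP P; rewrite PE xE /= cubic_alpha => /eqP;
  rewrite sqrf_eq0 => /eqP ->.
by [].
Qed.

(** [isog_meets] applies unless one of P, Q, P + Q is in the kernel. *)
Lemma isogD P Q : isog (P + Q) = isog P + isog Q.
Proof.
have T0 : - T C i = T C i by apply/opp_eq/T_double.
case: (pselect (P = 0)) => [->|nP]; first by rewrite add0r (_ :
  isog 0 = 0) ?add0r //; apply: val_inj.
case: (pselect (Q = 0)) => [->|nQ]; first by rewrite addr0 (_ :
  isog 0 = 0) ?addr0 //; apply: val_inj.
case: (pselect (P = T C i)) => [->|nPT];
  first by rewrite addrC isog_addT isogT add0r.
case: (pselect (Q = T C i)) => [->|nQT]; first by rewrite isog_addT isogT addr0.
case: (pselect (P + Q = 0)) => [S0|nS].
  have -> : Q = - P by apply/eqP; rewrite -addr_eq0 addrC S0.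
  by rewrite isogN !subrr; apply: val_inj.
case: (pselect (P + Q = T C i)) => [S0|nST].
  have -> : Q = - P + T C i by rewrite -S0 addKr.
  by rewrite addrA subrr add0r isog_addT isogN isogT subrr.
have [x1 [y1 PE]] := affine_ex nP; have [x2 [y2 QE]] := affine_ex nQ.
have [] := @add_meets _ C x1 y1 x2 y2.
- by rewrite -PE; apply: onP.
- by rewrite -QE; apply: onP.
- case=> xE yE; apply: nS; apply/eqP; rewrite addrC addr_eq0; apply/eqP.
  by apply: val_inj; rewrite val_opp PE QE /= xE yE opprK.
move=> s [c [x3 [h l1 l2 SE onS]]].
have n1 := isog_x_neq PE nPT; have n2 := isog_x_neq QE nQT.
have SE' : val (P + Q) = Affine x3 (- (s * x3 + c)) by rewrite val_add PE QE.
have n3 := isog_x_neq SE' nST.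
have [s' [c' [h' l1' l2' l3']]] := isog_meets h l1 l2 n1 n2 n3.
apply: val_inj; rewrite val_add.
have vE (R : cpoint C) : val (isog R) = isog_pt (val R) by [].
have onP' := onP (isog P); move: onP';
  rewrite !vE PE QE SE' !isog_ptE // => onP'.
rewrite (meets_slope onP' h' l1' l2'); congr Affine;
  first by rewrite mulNr sqrrN.
by rewrite -l3' !mulNr.
Qed.

Lemma isog_mul P n : isog (P *+ n) = isog P *+ n.
Proof.
elim: n => [|n IH]; first by apply: val_inj.
by rewrite !mulrS isogD IH.
Qed.

Lemma isog_sub P Q : isog (P - Q) = isog P - isog Q.
Proof. by rewrite isogD isogN. Qed.

(** A quadratic equation for x - t; the sign of the slope y / (x - t) adjusts
    the ordinate. *)
Lemma isog_surj (R : cpoint C') : exists P, isog P = R.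
Proof.
have [nd ne _] := de_neq0; have n2 := two_neq0 C.
have n4 : 4%:R != 0 :> L by rewrite (natrM _ 2 2) mulf_neq0.
case: R => -[|X Y] h; first by exists 0; apply: val_inj.
have := h; rewrite asboolE /= cubicE isog_e1 isog_e2 isog_e3 => onR.
pose m := X + d + e; pose r := sqrtL (m ^+ 2 - 2%:R * 2%:R * d * e).
have rE : r ^+ 2 = m ^+ 2 - 2%:R * 2%:R * d * e by exact: sqrtLK.
pose u := (m + r) / 2%:R.
have uE : u ^+ 2 = m * u - d * e.
  by rewrite /u; apply: (comb1 (c1 := (2%:R * 2%:R)^-1) rE); field;
    rewrite n4 n2.
have nu : u != 0.
  apply/eqP => u0; have /eqP : d * e = 0 by move: uE;
    rewrite u0 expr0n mulr0 add0r => /esym/eqP; rewrite oppr_eq0 => /eqP.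
  by rewrite mulf_eq0 (negbTE nd) (negbTE ne).
have XE : X = u + d * e / u - (d + e).
  apply: (mulIf nu); rewrite mulrBl mulrDl divfK //.
  by apply: (comb1 (c1 := - 1) uE); rewrite /m; ring.
pose w0 := sqrtL X; have w0E : w0 ^+ 2 = X by exact: sqrtLK.
have [w wE YE] : exists2 w, w ^+ 2 = X & w * (d * e / u - u) = Y.
  have /eqP : (w0 * (d * e / u - u)) ^+ 2 = Y ^+ 2.
    by rewrite exprMn w0E onR XE; field; rewrite nu.
  rewrite eqf_sqr => /orP[] /eqP E; first by exists w0.
  by exists (- w0); rewrite ?sqrrN // mulNr E opprK.
have onQ : oncurve C (Affine (t + u) (w * u)).
  by rewrite /= cubic_shift exprMn wE XE; field; rewrite nu.
exists (mkP onQ); apply: val_inj => /=.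
have nx : t + u != t by rewrite -subr_eq0 addrC addKr.
rewrite (isog_ptE _ nx).
have -> : t + u - t = u by ring.
by rewrite mulfK // wE YE.
Qed.

(** The point 2^m P has order 4, so it is not in the kernel, and its ordinate is
    not 0, so the abscissa (y / (x - t))^2 of its image is not 0 either. *)
Lemma ord2_isog m P : ord2 m.+2 P -> P *+ (2 ^ m.+1) = T C i ->
  ord2 m.+1 (isog P) /\ isog P *+ (2 ^ m) <> T C' 0.
Proof.
move=> hP PT; have n0 : isog (P *+ (2 ^ m)) <> 0.
  case/isog_eq0 => E; apply: (ord2_top hP); rewrite expnSr mulrnA E.
    by rewrite mul0rn.
  by rewrite T_double.
split; first by apply: ord2P; rewrite -isog_mul // PT isogT.
rewrite -isog_mul; set R := P *+ (2 ^ m) in n0 *.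
have R2 : R *+ 2 = T C i by rewrite -mulrnA -expnSr.
have nR : R <> 0 by move=> E; case: (@T_neq0 _ C i); rewrite -R2 E mul0rn.
have [x [y RE]] := affine_ex nR.
have nx : x != t.
  by apply: isog_x_neq RE _ => E; case: (@T_neq0 _ C i); rewrite -R2 E T_double.
have nu : x - t != 0 by rewrite subr_eq0.
move=> /(congr1 val); rewrite /= RE isog_ptE // /isog_root /= => -[/eqP + _].
rewrite sqrf_eq0 mulf_eq0 invr_eq0 (negbTE nu) orbF => /eqP y0.
case: (@T_neq0 _ C i); rewrite -R2 mulr2n; apply/eqP; rewrite addr_eq0.
by apply/eqP; apply: val_inj; rewrite val_opp RE /= y0 oppr0.
Qed.

End Isogeny.

(** * The tree of lattices *)

(** By [ord2_indep], for natural numbers that represent a - a' and b' - b modulo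
    the orders of A and B. *)
Lemma span_uniq (G : zmodType) p q (A B : G) a b a' b' : ord2 p A -> ord2 q B ->
  (0 < p -> 0 < q -> A *+ (2 ^ p.-1) <> B *+ (2 ^ q.-1))%N ->
  A *+ a + B *+ b = A *+ a' + B *+ b' ->
  a = a' %[mod 2 ^ p] /\ b = b' %[mod 2 ^ q].
Proof.
move=> hA hB top e.
have [|da db] := @ord2_indep _ p q A B (a + a' * (2 ^ p).-1)
    (b' + b * (2 ^ q).-1) hA hB top.
  rewrite !mulrnDr -!mulrn_opp ?ord2_tors //.
  apply: (addIr (A *+ a' + B *+ b)); rewrite addrA subrK e.
  by rewrite [X in _ = _ + X]addrC addrA subrK addrC.
have key r x y : (2 ^ r %| x + y * (2 ^ r).-1)%N -> x = y %[mod 2 ^ r].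
  move=> /eqP z; rewrite -(modnMDl y x) -[in RHS](mod0n (2 ^ r)).
  have -> : (y * 2 ^ r + x = (x + y * (2 ^ r).-1) + y)%N.
    by rewrite -{1}(prednK (expn_gt0 2 r :
      (0 < 2 ^ r)%N)) mulnS addnC [(y + _)%N]addnC addnA.
  by rewrite -modnDml z mod0n.
by split; [apply: key|apply/esym/key].
Qed.

Section Lattices.
Variables (L : closedFieldType) (C : curve L).
Implicit Types (P Q R : cpoint C) (g h : nat -> cpoint C) (v w : vec L).

(** Elements of V_2(E), as sequences in the group of points. *)
Definition dseq g : Prop :=
  (forall n, g n.+1 *+ 2 = g n) /\ exists m, g 0%N *+ (2 ^ m) = 0.

Definition vecof g : vec L := fun n => val (g n).

Lemma vecof_inj g h : vecof g = vecof h -> g = h.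
Proof.
by move=> e; apply: funext => n; apply: val_inj;
  apply: (congr1 (fun v => v n) e).
Qed.

Lemma dseqX g n k : (forall n, g n.+1 *+ 2 = g n) ->
  g (n + k)%N *+ (2 ^ k) = g n.
Proof.
move=> hg; elim: k => [|k IH]; first by rewrite addn0.
by rewrite addnS expnS mulrnA hg.
Qed.

Lemma dseq_tors g m n : (forall n, g n.+1 *+ 2 = g n) -> g 0%N *+ (2 ^ m) = 0 ->
  g n *+ (2 ^ (m + n)) = 0.
Proof. by move=> hg h0; rewrite addnC expnD mulrnA (dseqX 0 _ hg). Qed.

Lemma torsion2E n P : torsion2 C n (val P) <-> P *+ (2 ^ n) = 0.
Proof.
split=> [[_ h]|h]; first by apply: val_inj; rewrite val_mul.
by split; [apply: onP|rewrite -val_mul h].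
Qed.

Lemma V2P v : V2 C v <-> exists2 g, dseq g & v = vecof g.
Proof.
split=> [hv|[g [hg [m h0]] ->] n]; last first.
  split; last by rewrite -val_mul hg.
  by exists (m + n)%N => //; apply/torsion2E/dseq_tors.
have on n : oncurve C (v n) by case: (hv n) => -[k _ []].
exists (fun n => mkP (on n)); last by apply: funext.
split=> [n|]; first by apply: val_inj; rewrite val_mul; case: (hv n).
have [[k _ [_ hk]] _] := hv 0%N; exists k.
by apply: val_inj; rewrite val_mul.
Qed.

Lemma T2P g : dseq g -> (T2 C (vecof g) <-> g 0%N = 0).
Proof.
move=> hg; split=> [[_ /(_ 0%N)/torsion2E]|g0]; first by rewrite expn0.
split; first by apply/V2P; exists g.
move=> n; apply/torsion2E; have [h2 _] := hg.
by rewrite -[n in (2 ^ n)%N]add0n; apply: dseq_tors; rewrite ?g0 ?mul0rn.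
Qed.

Lemma vecof_add g h : addV C (vecof g) (vecof h) = vecof (fun n => g n + h n).
Proof. by []. Qed.

Lemma vecof_sub g h : subV C (vecof g) (vecof h) = vecof (fun n => g n - h n).
Proof. by []. Qed.

Lemma vecof_mul k g : mulV C k (vecof g) = vecof (fun n => g n *+ k).
Proof. by apply: funext => n; rewrite /vecof val_mul. Qed.

Lemma dseq_add g h : dseq g -> dseq h -> dseq (fun n => g n + h n).
Proof.
move=> [hg [m gm]] [hh [k hk]]; split=> [n|]; first by rewrite mulrnDl hg hh.
exists (m + k)%N; rewrite mulrnDl expnD mulrnA gm mul0rn add0r mulnC mulrnA hk.
by rewrite mul0rn.
Qed.

Lemma dseq_opp g : dseq g -> dseq (fun n => - g n).
Proof.
move=> [hg [m gm]]; split=> [n|]; first by rewrite mulNrn hg.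
by exists m; rewrite mulNrn gm oppr0.
Qed.

Lemma dseq_mul k g : dseq g -> dseq (fun n => g n *+ k).
Proof.
move=> [hg [m gm]]; split=> [n|]; first by rewrite mulrnAC hg.
by exists m; rewrite mulrnAC gm mul0rn.
Qed.

Lemma dseq_halves P m : P *+ (2 ^ m) = 0 -> dseq (halves P).
Proof. by move=> h; split; [apply: halvesS|exists m]. Qed.

(** The lattice with Lat P / T2 = <P>. *)
Definition Lat P : set (vec L) :=
  [set v | exists2 g, dseq g /\ gen P (g 0%N) & v = vecof g].

Lemma LatP P g : dseq g -> (Lat P (vecof g) <-> gen P (g 0%N)).
Proof. by move=> hg; split=> [[h [_ hh] /vecof_inj ->]|hh]; last exists g. Qed.

Lemma gen0 P : gen P 0. Proof. by exists 0%N. Qed.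

Lemma T2_Lat P : T2 C `<=` Lat P.
Proof.
move=> v hv; have [/V2P[g hg vE] _] := hv.
by rewrite vE in hv *; apply/LatP => //; rewrite ((T2P hg).1 hv); apply: gen0.
Qed.

Lemma is_scaleVP z g m w : dseq g -> g 0%N *+ (2 ^ m) = 0 -> Z2 z ->
  is_scaleV C z (vecof g) w ->
  w = vecof (fun n => g n *+ z (m + n)%N) /\ dseq (fun n => g n *+ z (m + n)%N).
Proof.
move=> [hg _] g0 hz hw; split.
  apply: funext => n; rewrite /vecof val_mul; apply: hw.
  by rewrite -val_mul dseq_tors.
split=> [n|]; last by exists m; rewrite mulrnAC g0 mul0rn.
have t := dseq_tors n hg g0.
by rewrite mulrnAC hg addnS (mulrn_mod _ t) hz -mulrn_mod.
Qed.

Lemma other_tors2 m P : ord2 m.+1 P -> exists2 i, T C i <> P *+ (2 ^ m) &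
  ~ gen P (T C i).
Proof.
move=> hP; have [i iP] := tors2_other (P *+ (2 ^ m)); exists i => // hg.
by have [/T_neq0|] := gen_tors2 hP hg (T_double _ i).
Qed.

Section LatticeOfPoint.
Variables (P : cpoint C) (m : nat).
Hypothesis hP : ord2 m.+1 P.

Let P0 : P *+ (2 ^ m.+1) = 0. Proof. exact: ord2_tors. Qed.

(** A basis of [Lat P] is given by the sequences P, P/2, P/4, ... and 0, R, R/2,
    R/4, ... with R a point of order 2 outside <P>. *)
Lemma Lat_lattice : lattice C (Lat P).
Proof.
have [i iP niP] := other_tors2 hP.
pose e1 := halves P; pose e2 n : cpoint C :=
  if n is n.+1 then halves (T C i) n else 0.
have h1 n : e1 n.+1 *+ 2 = e1 n by exact: halvesS.
have h2 n : e2 n.+1 *+ 2 = e2 n by case: n => [|n];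
  [exact: T_double|exact: halvesS].
have d1 : dseq e1 by split=> //; exists m.+1.
have d2 : dseq e2 by split=> //; exists 0%N; rewrite mul0rn.
have o1 n : ord2 (m + n).+1 (e1 n) by exact: ord2_halves.
have o2 n : ord2 n (e2 n).
  by case: n => [|n]; [apply/ord2_0|exact (@ord2_halves _ C (T C i) 0 n (ord2_T
    C i))].
have t1 n : e1 n *+ (2 ^ (m + n)) = P *+ (2 ^ m).
  by rewrite addnC expnD mulrnA (dseqX 0 _ h1).
have t2 n : e2 n.+1 *+ (2 ^ n) = T C i by exact: (halves_mul _ 0).
exists (vecof e1), (vecof e2); split.
- by apply/V2P; exists e1.
- by apply/V2P; exists e2.
- apply/seteqP; split=> [w [g [dg gP] ->]|w].
    have [hg _] := dg.
    have sp n : span (e1 n) (e2 n) (g n).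
      apply: span_chain h1 h2 _ _ _ _; last first.
        rewrite (dseqX 0 _ hg); case: gP => j ->; exists j, 0%N.
        by rewrite mulr0n addr0.
      move=> k Q Q2; have [|||a [b ->]] :=
        @tors2_span _ C (P *+ (2 ^ m)) (T C i) Q _ (T_double C i) _ _ (nesym iP)
          Q2.
      - by rewrite -mulrnA -expnSr; exact: P0.
      - exact: ord2_top.
      - exact: T_neq0.
      exists (2 ^ (m + k.+1) * a)%N, (2 ^ k * b)%N.
      by rewrite !mulrnA t1 t2.
    have [a ha] := choice sp.
    have [b hab] := choice ha.
    have cmp n : a n.+1 = a n %[mod 2 ^ (m + n).+1] /\ b n.+1 = b n %[mod 2 ^
      n].
      have e : e1 n *+ a n.+1 + e2 n *+ b n.+1 = e1 n *+ a n + e2 n *+ b n.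
        by rewrite -(hab n) -hg hab mulrnDl -!(mulrnAC _ 2) h1 h2.
      have tp : (0 < (m + n).+1 -> 0 < n ->
          e1 n *+ (2 ^ (m + n).+1.-1) <> e2 n *+ (2 ^ n.-1))%N.
        by move=> _; case: (n) => // k _; rewrite t1 t2 => E; apply: iP.
      exact: span_uniq (o1 n) (o2 n) tp e.
    have cmpa n k : a (n + k)%N = a n %[mod 2 ^ (m + n).+1].
      elim: k => [|k IH]; first by rewrite addn0.
      rewrite -IH addnS; have [h _] := cmp (n + k)%N.
      have dv : (2 ^ (m + n).+1 %| 2 ^ (m + (n + k)).+1)%N.
        by rewrite dvdn_exp2l // ltnS addnA leq_addr.
      by rewrite -(modn_dvdm _ dv) h modn_dvdm.
    have cmpb n k : b (n + k)%N = b n %[mod 2 ^ n].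
      elim: k => [|k IH]; first by rewrite addn0.
      rewrite -IH addnS; have [_ h] := cmp (n + k)%N.
      have dv : (2 ^ n %| 2 ^ (n + k))%N by rewrite dvdn_exp2l // leq_addr.
      by rewrite -(modn_dvdm _ dv) h modn_dvdm.
    have sc g' p (z : nat -> nat) : (forall n, ord2 (p + n) (g' n)) ->
        (forall n k, z (n + k)%N = z n %[mod 2 ^ (p + n)]) ->
        is_scaleV C z (vecof g') (vecof (fun n => g' n *+ z n)).
      move=> og zz n N; rewrite /vecof -!val_mul => hN.
      have /og/dvdn_pfactor[//|q qn E] : g' n *+ 2 ^ N = 0 by apply: val_inj.
      have nN : (n <= N)%N.
        rewrite -(@dvdn_Pexp2l 2) //.
        apply: dvdn_trans (_ : 2 ^ (p + n) %| 2 ^ N)%N; last by apply/og;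
          apply: val_inj.
        by rewrite dvdn_exp2l // leq_addl.
      congr val; apply/(ord2_eqmod _ _ (og n)).
      by rewrite -(subnKC nN) zz.
    exists a, b, (vecof (fun n => e1 n *+ a n)), (vecof (fun n => e2 n *+ b n)).
    split.
    + move=> n; have [h _] := cmp n.
      have dv : (2 ^ n %| 2 ^ (m + n).+1)%N by rewrite dvdn_exp2l // -addSn
        leq_addl.
      by rewrite -(modn_dvdm _ dv) h modn_dvdm.
    + by move=> n; case: (cmp n).
    + by apply: (sc _ m.+1) => // n k; rewrite cmpa.
    + by apply: (sc _ 0%N) => // n k; rewrite cmpb.
    + by rewrite vecof_add; congr vecof; apply: funext.
  case=> z1 [z2 [w1 [w2 [hz1 hz2 s1 s2 ->]]]].
  have [-> dd1] := is_scaleVP d1 P0 hz1 s1.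
  have [|-> dd2] := @is_scaleVP z2 e2 0 w2 d2 _ hz2 s2; first by rewrite mul0rn.
  rewrite vecof_add; apply/LatP; first exact: dseq_add.
  by rewrite mul0rn addr0; exists (z1 (m.+1 + 0)%N).
- move=> v /V2P[g dg ->]; have [hg [k gk]] := dg; exists k.
  rewrite vecof_mul; apply/LatP; first exact: dseq_mul.
  by rewrite gk; apply: gen0.
Qed.

Lemma Lat_tree : tree C (Lat P).
Proof.
split; [exact: Lat_lattice|exact: T2_Lat|].
have [i _ niP] := other_tors2 hP.
have dT : dseq (halves (T C i)).
  by apply: (@dseq_halves _ 1); rewrite expn1 T_double.
move=> /(_ (vecof (halves (T C i)))) h; apply: niP.
apply: (LatP P dT).1; apply: h; split; first by apply/V2P;
  exists (halves (T C i)).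
by rewrite vecof_mul; apply/T2P; [exact: dseq_mul|exact: T_double].
Qed.

Lemma Lat_level : level C m.+1 (Lat P).
Proof.
split; first exact: Lat_tree.
split; first exact: T2_Lat.
have d1 : dseq (halves P) by apply: dseq_halves P0.
exists (vecof (halves P)); split.
- by apply/LatP => //; apply: gen_id.
- move=> _ [g [dg [j gj]] ->]; exists j.
  rewrite vecof_mul vecof_sub; apply/T2P.
    by apply: dseq_add => //; apply: dseq_opp; apply: dseq_mul.
  by rewrite gj subrr.
- move=> j; rewrite vecof_mul; split=> [/T2P h|h]; first by apply/hP; apply: h;
    apply: dseq_mul.
  by apply/T2P; [exact: dseq_mul|apply/hP].
Qed.

End LatticeOfPoint.

Lemma Lat_parent P m : ord2 m.+2 P -> is_parent C m.+1 (Lat P) (Lat (P *+ 2)).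
Proof.
move=> hP; have hP2 := ord2_mul hP; have P0 := ord2_tors hP.
split; [exact: Lat_level|exact: Lat_level|right].
have d1 : dseq (halves P) by apply: dseq_halves P0.
split; first by move=> _ [g [dg [j gj]] ->]; exists g => //; split=> //;
  exists (2 * j)%N; rewrite mulrnA.
exists (vecof (halves P)); split.
- by apply/LatP => //; apply: gen_id.
- move=> _ [g [dg [j gj]] ->]; exists j.
  rewrite vecof_mul vecof_sub; apply/LatP.
    by apply: dseq_add => //; apply: dseq_opp; apply: dseq_mul.
  by rewrite gj subrr; apply: gen0.
- move=> j; rewrite vecof_mul; split=> [/LatP h|/dvdnP[q ->]]; last first.
    apply/LatP; first exact: dseq_mul.
    by exists q; rewrite -mulrnA mulnC.
  have [k] := h (dseq_mul _ d1); rewrite -mulrnA => /(ord2_eqmod _ _ hP) e.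
  have dv : (2 %| 2 ^ m.+2)%N by rewrite expnS dvdn_mulr.
  by rewrite /dvdn -(modn_dvdm _ dv) e modn_dvdm // modnMr.
Qed.

Lemma Lat_eq P Q : gen P Q -> gen Q P -> Lat P = Lat Q.
Proof.
case=> a QE [b PE].
by apply/seteqP; split=> v [g [dg [j gj]] ->]; exists g => //; split=> //;
  rewrite gj; [exists (b * j)%N; rewrite mulrnA -PE|
               exists (a * j)%N; rewrite mulrnA -QE].
Qed.

Lemma Lat_twin P R m : ord2 m.+2 P -> R *+ 2 = 0 -> ~ gen P R ->
  is_twin C m.+2 (Lat P) (Lat (P + R)).
Proof.
move=> hP R2 nR; have P0 := ord2_tors hP.
have E2 : (P + R) *+ 2 = P *+ 2 by rewrite mulrnDl R2 addr0.
have hPR : ord2 m.+2 (P + R).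
  by apply: ord2_half E2 _; apply: ord2_mul.
split; [exact: Lat_level|exact: Lat_level| |].
  move=> e; apply: nR; have d1 : dseq (halves (P + R)).
    by apply: dseq_halves; apply: ord2_tors hPR.
  have : Lat P (vecof (halves (P + R))).
    by rewrite e; apply/LatP => //; apply: gen_id.
  move/(LatP P d1) => h; rewrite -[R](addKr P) addrC; apply: gen_add => //.
  by apply: gen_opp P0 _; apply: gen_id.
exists (Lat (P *+ 2)); split; first exact: Lat_parent.
by rewrite -E2; apply: Lat_parent.
Qed.

Lemma Lat_T i : Lat (T C i) = lattice_of C i.
Proof.
apply/seteqP; split=> [_ [g [dg [j gj]] ->]|v [/V2P[g dg ->] h]].
  split; first by apply/V2P; exists g.
  rewrite /vecof gj (@mulrn_mod _ 1) ?expn1 ?T_double // modn2.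
  by case: odd; [right|left].
apply/LatP => //; case: h => h; first by exists 0%N; apply: val_inj.
by exists 1%N; apply: val_inj.
Qed.

(** A generator of Lam / T_2(E) takes its value in E[2^oo] at P; conversely Lam
    contains T_2(E) and is stable under addition. *)
Lemma level_point n Lam : level C n Lam -> exists2 P, ord2 n P & Lam = Lat P.
Proof.
case=> -[[e1 [e2 [he1 he2 LE _]]] T2L _] [_ [v [Lv hv1 hv2]]].
have [g1 dg1 E1] := (V2P e1).1 he1; have [g2 dg2 E2] := (V2P e2).1 he2.
subst e1 e2; have [_ [k1 gk1]] := dg1; have [_ [k2 gk2]] := dg2.
have LV w : Lam w -> exists2 g, dseq g & w = vecof g.
  rewrite LE => -[z1 [z2 [w1 [w2 [hz1 hz2 s1 s2 ->]]]]].
  have [-> dd1] := is_scaleVP dg1 gk1 hz1 s1.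
  have [-> dd2] := is_scaleVP dg2 gk2 hz2 s2.
  by rewrite vecof_add; eexists; last reflexivity; exact: dseq_add.
have LD w w' : Lam w -> Lam w' -> Lam (addV C w w').
  rewrite LE => -[z1 [z2 [w1 [w2 [hz1 hz2 s1 s2 ->]]]]].
  move=> [z1' [z2' [w1' [w2' [hz1' hz2' s1' s2' ->]]]]].
  exists (fun n => z1 n + z1' n)%N, (fun n => z2 n + z2' n)%N.
  have [w1E _] := is_scaleVP dg1 gk1 hz1 s1.
  have [w2E _] := is_scaleVP dg2 gk2 hz2 s2.
  have [w1E' _] := is_scaleVP dg1 gk1 hz1' s1'.
  have [w2E' _] := is_scaleVP dg2 gk2 hz2' s2'.
  have sc g (x y : nat -> cpoint C) z z' : is_scaleV C z (vecof g) (vecof x) ->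
      is_scaleV C z' (vecof g) (vecof y) ->
      is_scaleV C (fun n => z n + z' n)%N (vecof g) (vecof (fun n =>
        x n + y n)).
    move=> h h' p N hN; have := h p N hN; have := h' p N hN.
    by rewrite /vecof -!val_mul => /val_inj e' /val_inj e; rewrite e e' mulrnDr.
  rewrite w1E w1E' w2E w2E' in s1 s1' s2 s2' *.
  eexists; eexists; split.
  - by move=> p; rewrite -modnDm hz1 hz1' modnDm.
  - by move=> p; rewrite -modnDm hz2 hz2' modnDm.
  - exact: (sc _ _ _ _ _ s1 s1').
  - exact: (sc _ _ _ _ _ s2 s2').
  - by rewrite !vecof_add; congr vecof; apply: funext => p; exact: addrACA.
have [g dg vE] := LV v Lv; subst v; exists (g 0%N).
  move=> j; rewrite -hv2 vecof_mul; split=> [h|/T2P]; first by apply/T2P => //;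
    apply: dseq_mul.
  by apply; apply: dseq_mul.
have L0 j : Lam (vecof (fun n => g n *+ j)).
  elim: j => [|j IH].
    by apply: T2L; apply/T2P; [exact: dseq_mul|rewrite mulr0n].
  have := LD _ _ Lv IH; rewrite vecof_add.
  by congr (Lam (vecof _)); apply: funext => p; rewrite mulrS.
apply/seteqP; split=> w.
  move=> Lw; have [h dh wE] := LV w Lw; subst w.
  have [j] := hv1 _ Lw; rewrite vecof_mul vecof_sub => /T2P e.
  apply/LatP => //; exists j; apply/eqP; rewrite -subr_eq0; apply/eqP; apply: e.
  by apply: dseq_add => //; apply: dseq_opp; apply: dseq_mul.
case=> h [dh [j hj]] ->.
have : Lam (vecof (fun n => h n - g n *+ j)).
  apply: T2L; apply/T2P; last by rewrite hj subrr.
  by apply: dseq_add => //; apply: dseq_opp; apply: dseq_mul.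
move=> /LD/(_ (L0 j)); rewrite vecof_add.
by congr (Lam (vecof _)); apply: funext => p; rewrite subrK.
Qed.

End Lattices.

(** * Subfields *)

Section SubfieldSets.
Variable L : fieldType.
Implicit Types F S : set L.

Section Closure.
Variable F : set L.
Hypothesis hF : subfield_set F.

Lemma sf1 : F 1. Proof. by case: hF => /set_mem. Qed.
Lemma sfB x y : F x -> F y -> F (x - y).
Proof. by case: hF => _ h _ /mem_set hx /mem_set hy; apply/set_mem/h. Qed.
Lemma sfdiv x y : F x -> F y -> F (x / y).
Proof. by case: hF => _ _ h /mem_set hx /mem_set hy; apply/set_mem/h. Qed.
Lemma sf0 : F 0. Proof. by rewrite -(subrr 1); apply: sfB; apply: sf1. Qed.
Lemma sfN x : F x -> F (- x).
Proof. by move=> h; rewrite -sub0r; apply: sfB => //; apply: sf0. Qed.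
Lemma sfD x y : F x -> F y -> F (x + y).
Proof. by move=> hx hy; rewrite -[y]opprK; apply: sfB => //; apply: sfN. Qed.
Lemma sfV x : F x -> F x^-1.
Proof. by move=> h; rewrite -div1r; apply: sfdiv => //; apply: sf1. Qed.
Lemma sfM x y : F x -> F y -> F (x * y).
Proof. by move=> hx hy; rewrite -[y]invrK; apply: sfdiv => //; apply: sfV. Qed.
Lemma sfX x n : F x -> F (x ^+ n).
Proof.
move=> hx; elim: n => [|n IH]; first by rewrite expr0; apply: sf1.
by rewrite exprS; apply: sfM.
Qed.
Lemma sfn n : F n%:R.
Proof.
elim: n => [|n IH]; first exact: sf0.
by rewrite mulrS; apply: sfD => //; apply: sf1.
Qed.
End Closure.

Lemma adjoin_subfield F S : subfield_set (adjoin F S).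
Proof.
split; first by apply/mem_set => A [hA _]; apply: sf1.
- move=> x y /set_mem hx /set_mem hy; apply/mem_set => A hA.
  by apply: sfB; [case: hA|apply: hx|apply: hy].
- move=> x y /set_mem hx /set_mem hy; apply/mem_set => A hA.
  by apply: sfdiv; [case: hA|apply: hx|apply: hy].
Qed.

Lemma adjoin_base F S : F `<=` adjoin F S.
Proof. by move=> x Fx A [_ hA]; apply: hA; left. Qed.

Lemma adjoin_gen F S : S `<=` adjoin F S.
Proof. by move=> x Sx A [_ hA]; apply: hA; right. Qed.

Lemma adjoin_min F S A : subfield_set A -> F `<=` A -> S `<=` A ->
  adjoin F S `<=` A.
Proof. by move=> hA FA SA x; apply; split=> // y []; [apply: FA|apply: SA]. Qed.

Lemma adjoin_mono F S S' : S `<=` S' -> adjoin F S `<=` adjoin F S'.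
Proof.
move=> h; apply: adjoin_min; first exact: adjoin_subfield.
  exact: adjoin_base.
by move=> x /h; apply: adjoin_gen.
Qed.

Lemma adjoin_absorb F S : subfield_set F -> S `<=` F -> adjoin F S = F.
Proof.
by move=> hF SF; apply/seteqP; split; [apply: adjoin_min|apply: adjoin_base].
Qed.

Lemma bigcup_subfield (F : nat -> set L) : (forall n, subfield_set (F n)) ->
  (forall n, F n `<=` F n.+1) -> subfield_set (\bigcup_n F n).
Proof.
move=> hF mono.
have le m n : (m <= n)%N -> F m `<=` F n.
  elim: n => [|n IH]; first by rewrite leqn0 => /eqP ->.
  rewrite leq_eqVlt => /orP[/eqP -> //|/IH h]; exact: subset_trans h (mono n).
split; first by apply/mem_set; exists 0%N => //; apply: sf1.
- move=> x y /set_mem[m _ hx] /set_mem[n _ hy]; apply/mem_set.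
  exists (maxn m n) => //; apply: sfB => //.
    by apply: le hx; rewrite leq_maxl.
  by apply: le hy; rewrite leq_maxr.
- move=> x y /set_mem[m _ hx] /set_mem[n _ hy]; apply/mem_set.
  exists (maxn m n) => //; apply: sfdiv => //.
    by apply: le hx; rewrite leq_maxl.
  by apply: le hy; rewrite leq_maxr.
Qed.

End SubfieldSets.

(** The proof hF is a parameter so that the algebraic structures of [subF hF]
    can be inferred from its type. *)
Definition subfield_pred (L : fieldType) (F : set L) (hF : subfield_set F) :=
  fun x : L => x \in F.

HB.instance Definition _ (L : fieldType) (F : set L) (hF : subfield_set F) :=
  GRing.isDivringClosed.Build L (subfield_pred hF) hF.

Record subF (L : fieldType) (F : set L) (hF : subfield_set F) :=
  SubF { subF_val :> L; _ : subF_val \in subfield_pred hF }.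

Section SubfieldType.
Variables (L : fieldType) (F : set L) (hF : subfield_set F).
HB.instance Definition _ := [isSub for @subF_val L F hF].
HB.instance Definition _ := [Choice of subF hF by <:].
HB.instance Definition _ := [SubChoice_isSubComUnitRing of subF hF by <:].
HB.instance Definition _ :=
  [SubComUnitRing_isSubIntegralDomain of subF hF by <:].
HB.instance Definition _ := [SubIntegralDomain_isSubField of subF hF by <:].

Definition inF x (h : F x) : subF hF :=
  SubF (mem_set h : x \in subfield_pred hF).

Lemma subFP (x : subF hF) : F (val x).
Proof. by case: x => x h; apply/set_mem. Qed.

End SubfieldType.

(** * Extending embeddings of subfields *)

Section Embeddings.
Variable L : closedFieldType.

(** Graphs of ring morphisms from a subfield of L to L. *)
Definition embedding (G : set (L * L)) : Prop :=
  [/\ G (1, 1),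
      forall p q, G p -> G q -> G (p.1 - q.1, p.2 - q.2),
      forall p q, G p -> G q -> G (p.1 * q.1, p.2 * q.2),
      forall p, G p -> G (p.1^-1, p.2^-1) &
      forall p q, G p -> G q -> p.1 = q.1 -> p.2 = q.2].

Section Adjunction.
Variables (K : fieldType) (u v : {rmorphism K -> L}) (y : L) (m : {poly K}).
Hypotheses (m0 : m != 0) (my : root (map_poly u m) y).
Hypothesis m_min : forall p, root (map_poly u p) y -> p != 0 ->
  (size m <= size p)%N.

Lemma min_dvd p : root (map_poly u p) y -> m %| p.
Proof.
move=> py; have := divp_eq p m; set q := p %/ m; set r := p %% m => pE.
have ry : root (map_poly u r) y.
  move: py; rewrite pE rmorphD rmorphM rootE hornerD hornerM.
  by rewrite (eqP my) mulr0 add0r.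
have [r0|rn] := eqVneq r 0; first by rewrite /dvdp; apply/eqP.
by have := m_min ry rn; rewrite leqNgt /r ltn_modp m0.
Qed.

(** The polynomial m is irreducible: a factor of m that does not vanish at y is
    constant, since its cofactor vanishes at y and so is not smaller than m. *)
Lemma min_coprime p : ~~ root (map_poly u p) y -> coprimep p m.
Proof.
move=> py; rewrite coprimep_def.
set g := gcdp p m; have gp : g %| p by exact: dvdp_gcdl.
have /dvdpP[h mE] : g %| m by exact: dvdp_gcdr.
have : root (map_poly u h) y.
  move: my; rewrite mE rmorphM rootM => /orP[//|gy]; case/negP: py.
  by move/dvdpP: gp => [r ->]; rewrite rmorphM rootM gy orbT.
move/m_min => hm; have hn0 : h != 0.
  by apply: contraNneq m0 => h0; rewrite mE h0 mul0r.
have gn0 : g != 0 by apply: contraNneq m0 => g0; rewrite mE g0 mulr0.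
move: (hm hn0); rewrite mE size_mul //.
have : (0 < size g)%N by rewrite size_poly_gt0.
have : (0 < size h)%N by rewrite size_poly_gt0.
by case: (size g) => [|[|s]] // h0 _; rewrite addnS /= addnS ltnNge leq_addr.
Qed.

(** The graph of the extension of v u^-1 to u(K)(y) that maps y to a root y' of
    the image of the minimal polynomial m of y. *)
Definition adj_graph y' : set (L * L) :=
  [set q | exists p, q = ((map_poly u p).[y], (map_poly v p).[y'])].

Lemma adj_embedding y' : root (map_poly v m) y' -> embedding (adj_graph y').
Proof.
move=> my'; split.
- by exists 1; rewrite !rmorph1 !hornerE.
- by move=> _ _ [p ->] [q ->]; exists (p - q); rewrite !rmorphB !hornerE.
- by move=> _ _ [p ->] [q ->]; exists (p * q); rewrite !rmorphM !hornerE.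
- move=> _ [p ->] /=; have [z|n] := boolP (root (map_poly u p) y).
    have /dvdpP[q pE] := min_dvd z; exists 0.
    rewrite (eqP z) pE rmorphM hornerM (eqP my') mulr0.
    by rewrite !rmorph0 !horner0 !invr0.
  have /Bezout_eq1_coprimepP[[a b] /= ab] := min_coprime n; exists a.
  have n1 : (map_poly u a).[y] * (map_poly u p).[y] = 1.
    have := congr1 (fun r => (map_poly u r).[y]) ab.
    rewrite rmorphD !rmorphM !rmorph1 hornerD !hornerM (eqP my) mulr0 addr0.
    by rewrite hornerC.
  have n2 : (map_poly v a).[y'] * (map_poly v p).[y'] = 1.
    have := congr1 (fun r => (map_poly v r).[y']) ab.
    rewrite rmorphD !rmorphM !rmorph1 hornerD !hornerM (eqP my') mulr0 addr0.
    by rewrite hornerC.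
  have inv1 (r s : L) : r * s = 1 -> s^-1 = r.
    move=> rs; have s0 : s != 0.
      by apply: contra_eq_neq rs => ->; rewrite mulr0 eq_sym oner_neq0.
    by apply: (mulIf s0); rewrite mulVf.
  by rewrite (inv1 _ _ n1) (inv1 _ _ n2).
- move=> _ _ [p ->] [q ->] /= e.
  have : root (map_poly u (p - q)) y by rewrite rootE rmorphB !hornerE e subrr.
  case/min_dvd/dvdpP => r /(congr1 (fun s => (map_poly v s).[y'])).
  rewrite rmorphB rmorphM !hornerE (eqP my') mulr0 => /eqP.
  by rewrite subr_eq0 => /eqP.
Qed.

Lemma adj_base y' a : adj_graph y' (u a, v a).
Proof. by exists a%:P; rewrite !map_polyC !hornerC. Qed.

Lemma adj_gen y' : adj_graph y' (y, y').
Proof. by exists 'X; rewrite !map_polyX !hornerX. Qed.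

(** In characteristic 0 the derivative of m is not 0; being smaller than m, it
    does not vanish at y, so the cofactor of X - y in m does not either. *)
Lemma other_root : [pchar K] =i pred0 -> (2 < size m)%N ->
  exists2 y', root (map_poly u m) y' & y' != y.
Proof.
move=> pK0 sm; have /factor_theorem[N NE] := my.
have Ny : N.[y] != 0.
  have dE : (map_poly u m^`()).[y] = N.[y].
    by rewrite -deriv_map NE derivM !hornerE derivXsubC !hornerE subrr mulr0
      add0r.
  rewrite -dE; apply/negP => z.
  have dm0 : m^`() != 0.
    have mE : size m = (size m).-2.+2 by case: (size m) sm => [|[|]].
    apply: contraNneq m0 => /(congr1 (fun r : {poly K} => r`_(size m).-2)).
    rewrite coef_deriv coef0 -mulr_natr => /eqP; rewrite mulf_eq0.
    by rewrite ((pcharf0P K).1 pK0) orbF -lead_coef_eq0 lead_coefE {2}mE.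
  have := m_min z dm0; rewrite leqNgt lt_size_deriv //.
have N0 : N != 0 by apply: contraNneq Ny => ->; rewrite horner0.
have : size N != 1%N.
  have := congr1 (fun r : {poly L} => size r) NE.
  rewrite size_map_poly size_Mmonic ?monicXsubC // size_XsubC addn2 /= => sE.
  by move: sm; rewrite sE ltnS; case: (size N) => [|[|]].
move/closed_rootP => [y' Ny'].
exists y'; first by rewrite NE rootM Ny'.
by apply: contraNneq Ny => <-.
Qed.

End Adjunction.

Lemma minimal_poly (K : fieldType) (u : {rmorphism K -> L}) (y : L) :
  (exists2 p : {poly K}, p != 0 & root (map_poly u p) y) ->
  exists m : {poly K}, [/\ m != 0, root (map_poly u m) y &
    forall p, root (map_poly u p) y -> p != 0 -> (size m <= size p)%N].
Proof.
case=> p p0 py.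
pose Q n := `[< exists q : {poly K}, [/\ q != 0,
  root (map_poly u q) y & size q = n] >].
have exQ : exists n, Q n by exists (size p); apply/asboolP; exists p.
case: (ex_minnP exQ) => n /asboolP[m [m0 my mE]] n_min.
exists m; split=> // q qy q0; rewrite mE; apply: n_min.
by apply/asboolP; exists q.
Qed.

Section Domain.
Variable G : set (L * L).
Hypothesis hG : embedding G.

Definition dom : set L := [set a | exists b, G (a, b)].

Lemma dom_subfield : subfield_set dom.
Proof.
case: hG => h1 hB hM hV _; split; first by apply/mem_set; exists 1.
- move=> a b /set_mem[a' ha] /set_mem[b' hb]; apply/mem_set.
  by exists (a' - b'); apply: (hB _ _ ha hb).
- move=> a b /set_mem[a' ha] /set_mem[b' hb]; apply/mem_set.
  by exists (a' * b'^-1); apply: (hM _ _ ha (hV _ hb)).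
Qed.

Notation D := (subF dom_subfield).

Definition emb_fun (a : D) : L := sval (cid (subFP a)).
Lemma emb_funP a : G (val a, emb_fun a). Proof. exact: (svalP (cid (subFP a))).
  Qed.

Lemma emb_fun_eq a b : G (val a, b) -> emb_fun a = b.
Proof. by case: hG => _ _ _ _ hu h; apply: (hu _ _ (emb_funP a) h). Qed.

Fact emb_fun_zmod : zmod_morphism emb_fun.
Proof.
case: hG => _ hB _ _ _ a b; apply: emb_fun_eq.
by rewrite rmorphB; apply: (hB _ _ (emb_funP a) (emb_funP b)).
Qed.

Fact emb_fun_monoid : monoid_morphism emb_fun.
Proof.
case: hG => h1 _ hM _ _; split; first by apply: emb_fun_eq; rewrite rmorph1.
move=> a b; apply: emb_fun_eq; rewrite rmorphM.
exact: (hM _ _ (emb_funP a) (emb_funP b)).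
Qed.

HB.instance Definition _ := GRing.isZmodMorphism.Build D L emb_fun emb_fun_zmod.
HB.instance Definition _ :=
  GRing.isMonoidMorphism.Build D L emb_fun emb_fun_monoid.

Lemma lift_poly (F : set L) (p : {poly L}) : F `<=` dom ->
  p \is a polyOver (mem F) ->
  exists q : {poly D}, map_poly val q = p.
Proof.
move=> FD; rewrite qualifE => /allP pF; exists (map_poly (insubd (0 : D)) p).
apply/polyP => i; rewrite coef_map /= coef_map_id0; last first.
  by apply: val_inj; rewrite val_insubd; case: ifP => // _.
have h : dom p`_i.
  have [lt|ge] := ltnP i (size p); last first.
    by rewrite nth_default //; apply: sf0; apply: dom_subfield.
  by apply: FD; apply/set_mem; apply: pF; apply: mem_nth.
by rewrite val_insubd; have -> : p`_i \in subfield_pred dom_subfield by exact: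
  mem_set.
Qed.

Lemma embedding_extend (F : set L) y : F `<=` dom -> algebraic_over F ->
  exists2 G', embedding G' /\ G `<=` G' & exists y', G' (y, y').
Proof.
move=> FD /(_ y)[p [pF p0 py]]; have [q qE] := lift_poly FD pF.
have [|m [m0 my m_min]] := @minimal_poly D val y.
  exists q; last by rewrite qE.
  by apply: contraNneq p0 => q0; rewrite -qE q0 rmorph0.
have [y' my'] : exists y', root (map_poly emb_fun m) y'.
  apply/closed_rootP; rewrite size_map_poly -(size_map_poly val m).
  apply/closed_rootP; by exists y.
exists (adj_graph val emb_fun y y'); last first.
  by exists y'; apply: adj_gen.
split; first exact (adj_embedding m0 my m_min my').
move=> [a b] ab; have ha : dom a by exists b.
have <- : emb_fun (inF dom_subfield ha) = b by apply: emb_fun_eq.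
exact: (adj_base _ _ _ _ (inF dom_subfield ha)).
Qed.

End Domain.

Section Total.
Variables (s : L -> L) (G : set (L * L)).
Hypotheses (hG : embedding G) (hs : forall a, G (a, s a)).

Fact total_zmod : zmod_morphism s.
Proof.
by case: hG => _ hB _ _ hu a b; apply: (hu _ _ (hs (a - b)) (hB _ _ (hs a) (hs
  b))).
Qed.

Fact total_monoid : monoid_morphism s.
Proof.
case: hG => h1 _ hM _ hu; split; first exact: (hu _ _ (hs 1) h1).
by move=> a b; apply: (hu _ _ (hs (a * b)) (hM _ _ (hs a) (hs b))).
Qed.

Lemma total_rmorphism : exists sigma : {rmorphism L ->
  L}, forall a, G (a, sigma a).
Proof.
pose sigma : {rmorphism L -> L} := HB.pack s
  (GRing.isZmodMorphism.Build L L s total_zmod)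
  (GRing.isMonoidMorphism.Build L L s total_monoid).
by exists sigma.
Qed.

End Total.

(** Zorn's lemma on the graphs of embeddings.  Adding G0 to every graph gives
    the empty chain an upper bound. *)
Lemma embedding_total (F : set L) G0 : embedding G0 -> F `<=` dom G0 ->
  algebraic_over F ->
  exists sigma : {rmorphism L -> L}, forall p, G0 p -> p.2 = sigma p.1.
Proof.
move=> hG0 FD alg; pose P (G : set (L * L)) := embedding (G0 `|` G).
have [|A [PA maxA]] := @Zorn_bigcup _ P.
  move=> H HP tot; rewrite /P.
  have [p0|/existsNP[X /contrapT HX]] := pselect (forall X, ~ H X).
    have -> : \bigcup_(X in H) X = set0.
      by apply/seteqP; split=> // p [X /p0].
    by rewrite setU0.
  have two p q : (G0 `|` \bigcup_(X in H) X) p ->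
    (G0 `|` \bigcup_(X in H) X) q ->
      exists2 Y, H Y & (G0 `|` Y) p /\ (G0 `|` Y) q.
    move=> [p1|[X1 H1 p1]] [q1|[X2 H2 q1]].
    - by exists X => //; split; left.
    - by exists X2 => //; split; [left|right].
    - by exists X1 => //; split; [right|left].
    - case: (tot _ _ H1 H2) => h.
        by exists X2 => //; split; right => //; apply: h.
      by exists X1 => //; split; right => //; apply: h.
  have sub Y : H Y -> G0 `|` Y `<=` G0 `|` \bigcup_(X in H) X.
    by move=> HY p [p1|p1]; [left|right; exists Y].
  split.
  - by left; case: hG0.
  - move=> p q hp hq; have [Y HY [h1 h2]] := two p q hp hq; apply: (sub _ HY).
    by case: (HP _ HY) => _ hB _ _ _; apply: hB.
  - move=> p q hp hq; have [Y HY [h1 h2]] := two p q hp hq; apply: (sub _ HY).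
    by case: (HP _ HY) => _ _ hM _ _; apply: hM.
  - move=> p hp; have [Y HY [h1 _]] := two p p hp hp; apply: (sub _ HY).
    by case: (HP _ HY) => _ _ _ hV _; apply: hV.
  - move=> p q hp hq; have [Y HY [h1 h2]] := two p q hp hq.
    by case: (HP _ HY) => _ _ _ _ hu; apply: hu.
set G := G0 `|` A in PA; have FG : F `<=` dom G.
  by move=> a /FD[b ab]; exists b; left.
have tot y : exists y', G (y, y').
  have [G' [hG' GG'] [y' yy']] := embedding_extend PA y FG alg.
  exists y'; apply: contrapT => nG; apply: (maxA G').
    split; first by move=> p Ap; apply: GG'; right.
    by move=> G'A; apply: nG; right; apply: G'A.
  rewrite /P (_ : G0 `|` G' = G') //; apply/seteqP; split=> p; last by right.
  by case=> // p0; apply: GG'; left.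
have [sigma hs] := total_rmorphism PA (fun y => svalP (cid (tot y))).
exists sigma => p p0; case: PA => _ _ _ _ hu.
exact: (hu p (p.1, sigma p.1) (or_introl p0) (hs _) erefl).
Qed.

(** The element x has a conjugate x' <> x over F, and the embedding of F(x) that
    maps x to x' extends to L. *)
Lemma fixed_field (F : set L) x : [pchar L] =i pred0 -> subfield_set F ->
  algebraic_over F -> ~ F x ->
  exists sigma : {rmorphism L -> L}, (forall a, F a ->
    sigma a = a) /\ sigma x != x.
Proof.
move=> pL hF alg nFx.
pose diag : set (L * L) := [set p | F p.1 /\ p.1 = p.2].
have hd : embedding diag.
  split.
  - by split=> //; apply: sf1.
  - by move=> [a b] [c d] [/= h1 <-] [/= h2 <-]; split=> //=; apply: sfB.
  - by move=> [a b] [c d] [/= h1 <-] [/= h2 <-]; split=> //=; apply: sfM.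
  - by move=> [a b] [/= h1 <-]; split=> //=; apply: sfV.
  - by move=> [a b] [c d] [/= h1 <-] [/= h2 <-].
have FD : F `<=` dom diag by move=> a Fa; exists a.
have [p [pF p0 px]] := alg x; have [q qE] := lift_poly hd FD pF.
set D := subF (dom_subfield hd) in q qE.
have [|m [m0 mx m_min]] := @minimal_poly D val x.
  exists q; last by rewrite qE.
  by apply: contraNneq p0 => q0; rewrite -qE q0 rmorph0.
have Fval (a : D) : F (val a) by case: (subFP a) => b [].
have [||x' mx' nx] := other_root m0 mx m_min.
- by move=> n; rewrite -(fmorph_pchar (val : {rmorphism D -> L})); apply: pL.
- rewrite ltnNge; apply/negP => sm; apply: nFx.
  have mE : m = (m`_1)%:P * 'X + (m`_0)%:P.
    apply/polyP => i; rewrite coefD coefCM coefX coefC.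
    case: i => [|[|i]] /=; rewrite ?mulr0 ?mulr1 ?addr0 ?add0r //.
    by rewrite nth_default //; apply: leq_trans sm _.
  have := mx; rewrite rootE (@horner_coef_wide _ 2) ?size_map_poly //.
  rewrite big_ord_recl big_ord1 !coef_map expr0 mulr1 expr1 addrC addr_eq0.
  move=> /eqP e; have {}e : val m`_1 * x = - val m`_0 by exact: e.
  have val0 (c : D) : (val c == 0) = (c == 0) by rewrite -(inj_eq val_inj).
  have [z|n1] := eqVneq m`_1 0.
    have m00 : m`_0 = 0.
      apply/eqP; rewrite -val0 -oppr_eq0 -e; apply/eqP.
      by have /eqP -> : val m`_1 == 0 by [rewrite val0 z]; rewrite mul0r.
    by case/eqP: m0; rewrite mE z m00 mul0r add0r.
  have n1' : val m`_1 != 0 by rewrite val0.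
  have -> : x = - val m`_0 / val m`_1 by rewrite -e mulrAC divff // mul1r.
  by apply: sfdiv => //; apply: sfN => //.
have hG := adj_embedding m0 mx m_min mx'.
have [|sigma hs] := embedding_total hG _ alg.
  by move=> a Fa; exists a; apply: (adj_base _ _ _ _ (inF (dom_subfield hd) (FD
    _ Fa))).
exists sigma; split.
  move=> a Fa; apply/esym.
  exact: (hs _ (adj_base _ _ _ _ (inF (dom_subfield hd) (FD _ Fa)))).
by rewrite -(hs _ (adj_gen _ _ _ _)).
Qed.

End Embeddings.

(** * Decorations and iterated isogenies *)

Section Decorations.
Variables (L : closedFieldType) (C : curve L).
Implicit Types (P Q R : cpoint C) (D : curve L).

(** Curves reached from C by a chain of n isogenies of degree 2 without
    backtracking: the root of index 0 generates the kernel of the dual of the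
    last isogeny. *)
Inductive reach : nat -> curve L -> Prop :=
| reach1 i : reach 1 (isog_curve C i)
| reachS n D j : reach n D -> j != 0 -> reach n.+1 (isog_curve D j).

Lemma reach_gt0 n D : reach n D -> (0 < n)%N.
Proof. by case. Qed.

Lemma reach_root0 n D : reach n D -> D 0 = 0.
Proof. by case=> *; rewrite /= /isog_root. Qed.

Lemma isog_root_quad D j k : k != 0 -> let x := isog_curve D j k in
  let d := D (j + 1) - D j in let e := D (j + 2%:R) - D j in
  x ^+ 2 + 2%:R * (d + e) * x + (d - e) ^+ 2 = 0.
Proof.
move=> nk x d e; rewrite {}/x /= /isog_root -/d -/e.
move: (sqrtL d) (sqrtL e) (sqrtLK d) (sqrtLK e) => sd se <- <-.
by case: (ord3P k) nk => -> //= _; ring.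
Qed.

Lemma quad_match (s m a b c d : L) : a != b -> c != d ->
  a ^+ 2 + s * a + m = 0 -> b ^+ 2 + s * b + m = 0 ->
  c ^+ 2 + s * c + m = 0 -> d ^+ 2 + s * d + m = 0 ->
  (a = c /\ b = d) \/ (a = d /\ b = c).
Proof.
move=> ab cd ha hb hc hd; rewrite -subr_eq0 in ab; rewrite -subr_eq0 in cd.
have sE : s = - (a + b).
  by apply: (mulIf ab); apply: (comb2 (c1 := 1) (c2 := - 1) ha hb); ring.
have k x : x ^+ 2 + s * x + m = 0 -> x = a \/ x = b.
  move=> hx; have /eqP : (x - a) * (x - b) = 0.
    by apply: (comb2 (c1 := 1) (c2 := - 1) hx ha); rewrite sE; ring.
  by rewrite mulf_eq0 !subr_eq0 => /orP[] /eqP; [left|right].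
case: (k _ hc) (k _ hd) cd => -> [] -> ; rewrite ?subrr ?eqxx // => _;
  by [left|right].
Qed.

Variable psi : cpoint C -> L.

(** The axioms of a decoration for the function psi P = Psi (Lat P). *)
Record decorated : Prop := Decorated {
  psi_gen : forall P Q, gen P Q -> gen Q P -> psi P = psi Q;
  psi_T : forall i, psi (T C i) = C (i + 1) - C (i + 2%:R);
  psi_4 : forall P i, P *+ 2 = T C i ->
    psi P ^+ 2 - 2%:R * (2%:R * psi (T C (i + 1)) + psi (T C i)) * psi P
      + psi (T C i) ^+ 2 = 0;
  psi_8 : forall m P R, ord2 m.+3 P -> R *+ 2 = 0 -> ~ gen (P *+ 2) R ->
    psi P ^+ 2 - 2%:R * (psi (P *+ 2 + R) - 2%:R * psi (P *+ 2)) * psi P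
      + psi (P *+ 2 + R) ^+ 2 = 0;
  psi_twin : forall m P R, ord2 m.+2 P -> R *+ 2 = 0 -> ~ gen P R ->
    psi P != psi (P + R) }.

Hypothesis hpsi : decorated.

(** The indices j, j' are left unordered, because the two roots of D come in the
    order of a choice of square roots, and a decoration may exchange twins. *)
Definition fits (s : L) D Q R : Prop := exists j j' : 'I_3,
  [/\ j != 0, j' != 0, j != j', D j = s * psi Q & D j' = s * psi (Q + R)].

Lemma not_gen_half m Q R : ord2 m.+1 (Q *+ 2) -> R *+ 2 = 0 ->
  ~ gen (Q *+ 2) R -> ~ gen Q R.
Proof.
move=> hQ R2 nR hR; have hQ' : ord2 m.+2 Q := ord2_half erefl hQ.
case: (gen_tors2 hQ' hR R2) => E; apply: nR; first by rewrite E; apply: gen0.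
by exists (2 ^ m)%N; rewrite E expnS mulrnA.
Qed.

Lemma fits_first i Q R : Q *+ 2 = T C i -> R *+ 2 = 0 -> ~ gen Q R ->
  fits (- 1) (isog_curve C i) Q R.
Proof.
move=> QT R2 nR; have hQ : ord2 2 Q := ord2_half QT (ord2_T C i).
have QRT : (Q + R) *+ 2 = T C i by rewrite mulrnDl R2 addr0.
pose D := isog_curve C i.
have h4 P : P *+ 2 = T C i -> (- psi P) ^+ 2 +
    2%:R * ((C (i + 1) - C i) + (C (i + 2%:R) - C i)) * (- psi P) +
    ((C (i + 1) - C i) - (C (i + 2%:R) - C i)) ^+ 2 = 0.
  move=> PT; apply: etrans (psi_4 hpsi PT); rewrite !(psi_T hpsi).
  have -> : i + 1 + 1 = i + 2%:R by rewrite -addrA.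
  have -> : i + 1 + 2%:R = i.
    by rewrite -addrA (_ : 1 + 2%:R = 0) ?addr0 //; apply: val_inj.
  by ring.
have n12 : D 1 != D 2%:R by rewrite (inj_eq (@root_inj _ D)).
have nQ : - psi Q != - psi (Q + R).
  by rewrite (inj_eq oppr_inj); exact (psi_twin hpsi hQ R2 nR).
have := quad_match n12 nQ (@isog_root_quad C i 1 isT)
  (@isog_root_quad C i 2%:R isT) (h4 _ QT) (h4 _ QRT).
case=> -[E1 E2].
- by exists 1, 2%:R; rewrite !mulN1r.
- by exists 2%:R, 1; rewrite !mulN1r.
Qed.

Lemma fits_next s D Q R m : s ^+ 2 = 1 -> D 0 = 0 -> ord2 m.+2 (Q *+ 2) ->
  R *+ 2 = 0 -> ~ gen (Q *+ 2) R -> forall j j', j != 0 -> j' != 0 -> j != j' ->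
  D j = s * psi (Q *+ 2) -> D j' = s * psi (Q *+ 2 + R) ->
  fits (- s) (isog_curve D j) Q R.
Proof.
move=> s2 D0 hQ2 R2 nR2 j j' nj nj' jj' E E'.
have hQ : ord2 m.+3 Q := ord2_half erefl hQ2.
have nR := not_gen_half hQ2 R2 nR2.
have QR2 : (Q + R) *+ 2 = Q *+ 2 by rewrite mulrnDl R2 addr0.
have hQR : ord2 m.+3 (Q + R) := ord2_half QR2 hQ2.
pose D' := isog_curve D j.
set d := D (j + 1) - D j; set e := D (j + 2%:R) - D j.
have de : d + e = D j' - 2%:R * D j /\ (d - e) ^+ 2 = D j' ^+ 2.
  have o1 : 1 + 1 = 2%:R :> 'I_3 by apply: val_inj.
  have o2 : 1 + 2%:R = 0 :> 'I_3 by apply: val_inj.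
  have o3 : 2%:R + 1 = 0 :> 'I_3 by apply: val_inj.
  have o4 : 2%:R + 2%:R = 1 :> 'I_3 by apply: val_inj.
  rewrite /d /e; case: (ord3P j) nj jj' => ->; case: (ord3P j') nj' => -> // *.
    by rewrite o1 o2 D0; split; ring.
  by rewrite o3 o4 D0; split; ring.
have h8 P : ord2 m.+3 P -> P *+ 2 = Q *+ 2 -> (- s * psi P) ^+ 2 +
    2%:R * (d + e) * (- s * psi P) + (d - e) ^+ 2 = 0.
  move=> hP PQ; have := psi_8 hpsi hP R2; rewrite PQ => /(_ nR2) h.
  have [-> ->] := de; rewrite E E'.
  by apply: (comb2 (c1 := 1) (c2 := psi P ^+ 2 + psi (Q *+ 2 + R) ^+ 2 -
   2%:R * (psi (Q *+ 2 + R) - 2%:R * psi (Q *+ 2)) * psi P) h s2); ring.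
have n12 : D' 1 != D' 2%:R by rewrite (inj_eq (@root_inj _ D')).
have s0 : - s != 0 by rewrite oppr_eq0 -sqrf_eq0 s2 oner_neq0.
have nQ : - s * psi Q != - s * psi (Q + R).
  by rewrite (inj_eq (mulfI s0)); exact (psi_twin hpsi hQ R2 nR).
have := quad_match n12 nQ (@isog_root_quad D j 1 isT)
  (@isog_root_quad D j 2%:R isT) (h8 _ hQ erefl) (h8 _ hQR QR2).
case=> -[E1 E2].
- by exists 1, 2%:R.
- by exists 2%:R, 1.
Qed.

(** The quadratic equations of a decoration and those of the roots of the
    isogenous curves differ by a sign, which changes at each isogeny. *)
Definition sgn n : L := (- 1) ^+ n.

Lemma sgnS n : sgn n.+1 = - sgn n. Proof. by rewrite /sgn exprS mulN1r. Qed.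
Lemma sgn2 n : sgn n ^+ 2 = 1. Proof. by rewrite /sgn sqrr_sign. Qed.

(** The values of a decoration at level n + 1 are the roots of the curves
    reached by n isogenies, by induction along both trees: two distinct roots of
    the same quadratic equation match up to order. *)
Lemma fits_of_point n Q R : (0 < n)%N -> ord2 n.+1 Q -> R *+ 2 = 0 ->
  ~ gen Q R ->
  exists2 D, reach n D & fits (sgn n) D Q R.
Proof.
case: n => // n _; elim: n Q => [|n IH] Q hQ R2 nR.
  have : Q *+ 2 *+ 2 = 0 by rewrite -mulrnA; apply: ord2_tors hQ.
  case/tors2P=> [Q0|[i QT]].
    by case: (ord2_top hQ); rewrite expn1.
  exists (isog_curve C i); first exact: reach1.
  by rewrite /sgn expr1; apply: fits_first.
have hQ2 := ord2_mul hQ.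
have nR2 : ~ gen (Q *+ 2) R.
  by case=> k Rk; apply: nR; exists (2 * k)%N; rewrite mulrnA.
have [D hD [j [j' [nj nj' jj' E E']]]] := IH _ hQ2 R2 nR2.
exists (isog_curve D j); first exact: reachS.
rewrite sgnS; apply: fits_next (sgn2 _) (reach_root0 hD) hQ2 R2 nR2 _ _ nj nj'
  jj' E E'.
Qed.

Lemma point_of_reach n D : reach n D -> exists Q R,
  [/\ ord2 n.+1 Q, R *+ 2 = 0, ~ gen Q R & fits (sgn n) D Q R].
Proof.
elim=> {n D} [i|n D j0 hD [Q [R [hQ R2 nR hf]]] nj0].
  have QT : halfpt (T C i) *+ 2 = T C i by exact: halfK.
  have hQ : ord2 2 (halfpt (T C i)) := ord2_half QT (ord2_T C i).
  have [k _ nk] := other_tors2 hQ.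
  exists (halfpt (T C i)), (T C k); split=> //; first exact: T_double.
  by rewrite /sgn expr1; apply: fits_first => //; apply: T_double.
have n0 := reach_gt0 hD; case: n n0 hD hQ hf => // n _ hD hQ hf.
have step Q1 : ord2 n.+2 Q1 -> ~ gen Q1 R ->
    (exists j', [/\ j' != 0, j0 != j', D j0 = sgn n.+1 * psi Q1 &
                    D j' = sgn n.+1 * psi (Q1 + R)]) ->
    exists Q R, [/\ ord2 n.+3 Q, R *+ 2 = 0, ~ gen Q R &
      fits (sgn n.+2) (isog_curve D j0) Q R].
  move=> hQ1 nR1 [j' [nj' jj' E E']].
  have hK : halfpt Q1 *+ 2 = Q1 by exact: halfK.
  exists (halfpt Q1), R; split=> //.
  - exact: ord2_half hK hQ1.
  - by apply: (@not_gen_half n.+1) => //; rewrite hK.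
  - rewrite -hK in hQ1 nR1 E E'; rewrite sgnS.
    exact: fits_next (sgn2 _) (reach_root0 hD) hQ1 R2 nR1 _ _ nj0 nj' jj' E E'.
have nQR : ~ gen (Q + R) R.
  have Q2 : (Q + R) *+ 2 = Q *+ 2 by rewrite mulrnDl R2 addr0.
  have hQR : ord2 n.+2 (Q + R) by apply: ord2_half Q2 _; apply: ord2_mul.
  move=> hR; case: (gen_tors2 hQR hR R2) => E; apply: nR.
    by rewrite E; apply: gen0.
  by exists (2 ^ n.+1)%N; rewrite E expnS !mulrnA Q2.
have hQR : ord2 n.+2 (Q + R).
  by apply: (@ord2_half _ n (Q *+ 2));
    [rewrite mulrnDl R2 addr0|apply: ord2_mul].
case: hf => j [j' [nj nj' jj' E E']].
have [j0E|n0] := eqVneq j0 j.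
  by apply: (step Q) => //; exists j'; rewrite j0E.
have j0E : j0 = j'.
  move: nj0 nj nj' jj' n0; case: (ord3P j0) => ->; case: (ord3P j) => ->;
  by case: (ord3P j') => ->.
apply: (step (Q + R)) => //; exists j; rewrite j0E -addrA -mulr2n R2 addr0.
by split=> //; rewrite eq_sym.
Qed.

(** On abscissae the isogeny is a rational function over the field of the roots,
    and a 2^m-torsion point of the target lifts to a 2^(m+1)-torsion point. *)
Lemma isog_abscissa D j (F : set L) m : subfield_set F -> (forall k, F (D k)) ->
  (forall (P : cpoint D) x y, P *+ (2 ^ m.+1) = 0 -> val P = Affine x y ->
    F x) ->
  forall (P : cpoint (isog_curve D j)) x y, P *+ (2 ^ m) = 0 ->
    val P = Affine x y -> F x.
Proof.
move=> hF FD Fx P x y P0 PE; have [Q QP] := isog_surj P.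
have Q0 : Q *+ (2 ^ m.+1) = 0.
  have : isog j (Q *+ (2 ^ m)) = 0 by rewrite isog_mul QP.
  by rewrite expnSr mulrnA => /isog_eq0[] ->; rewrite ?mul0rn ?T_double.
have := congr1 val QP; rewrite PE /=; case QE : (val Q) => [//|x' y'] /=.
have Fx' := Fx Q x' y' Q0 QE.
case: ifP => // nx [<- _]; apply: sfdiv => //; last first.
  by apply: sfX => //; apply: sfB.
have := onP Q; rewrite QE /= cubicP => ->.
by apply: sfM => //; [apply: sfM => //|]; apply: sfB.
Qed.

Lemma torsion2_mono (D : curve L) n : torsion2 D n `<=` torsion2 D n.+1.
Proof.
move=> P [onP hP]; split=> //; have := val_mul (2 ^ n.+1) (mkP onP).
have P0 : mkP onP *+ (2 ^ n) = 0 by apply: val_inj; rewrite val_mul.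
by rewrite expnSr mulrnA P0 mul0rn /= => <-.
Qed.

Variable K : set L.

Lemma Kx_mono n m : (n <= m)%N -> Kx C K n `<=` Kx C K m.
Proof.
elim: m => [|m IH]; first by rewrite leqn0 => /eqP ->.
rewrite leq_eqVlt => /orP[/eqP -> //|/IH h]; apply: subset_trans h _.
by apply: adjoin_mono => x [y /torsion2_mono]; exists y.
Qed.

Lemma Kx_abscissa n P x y : P *+ (2 ^ n) = 0 -> val P = Affine x y ->
  Kx C K n x.
Proof.
by move=> P0 PE; apply: adjoin_gen; exists y; rewrite -PE; apply/torsion2E.
Qed.

Lemma Kx_root n i : (0 < n)%N -> Kx C K n (C i).
Proof.
move=> n0; apply: (Kx_mono n0); apply: (@Kx_abscissa 1 (T C i) _ 0) => //.
exact: T_double.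
Qed.

Lemma reach_abscissa n D m (P : cpoint D) x y : reach n D -> P *+ (2 ^ m) = 0 ->
  val P = Affine x y -> Kx C K (m + n) x.
Proof.
move=> hD; elim: hD m P x y => {n D} [i|n D j hD IH _] m P x y.
  apply: isog_abscissa; first exact: adjoin_subfield.
    by move=> k; apply: Kx_root; rewrite addn1.
  by move=> Q x' y'; rewrite addn1; apply: Kx_abscissa.
apply: isog_abscissa; first exact: adjoin_subfield.
  move=> k; apply: (@Kx_mono (1 + n)); first by rewrite addnS ltnS leq_addl.
  exact: (IH 1%N (T D k) _ 0 (T_double D k)).
by move=> Q x' y' Q0 QE; rewrite addnS -addSn; apply: IH Q0 QE.
Qed.

Lemma psi_Kx n P : (0 < n)%N -> ord2 n P -> Kx C K n (psi P).
Proof.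
case: n => // -[|n] _ hP.
  have : P *+ 2 = 0 by apply: ord2_tors hP.
  case/tors2P=> [P0|[i ->]]; first by case: (ord2_top hP).
  rewrite (psi_T hpsi); apply: (sfB (adjoin_subfield _ _)); exact: Kx_root.
have [k _ nk] := other_tors2 hP.
have [D hD [j [j' [_ _ _ E _]]]] := fits_of_point (isT :
  (0 < n.+1)%N) hP (T_double C k) nk.
have hF := adjoin_subfield K (xcoords (torsion2 C n.+2)).
have -> : psi P = sgn n.+1 * D j by rewrite E mulrA -expr2 sgn2 mul1r.
apply: (sfM hF); first by rewrite /sgn; apply: (sfX hF); apply: (sfN hF);
  apply: (sf1 hF).
exact (@reach_abscissa n.+1 D 1 (T D j) (D j) 0 hD (T_double D j) erefl).
Qed.

End Decorations.

(** * Field morphisms acting on torsion points *)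

Section Action.
Variables (L : closedFieldType) (sigma : {rmorphism L -> L}).

Definition mapP (P : Defs.point L) : Defs.point L :=
  if P is Affine x y then Affine (sigma x) (sigma y) else @Infinity L.

Definition fixes (D : curve L) : Prop := forall k, sigma (D k) = D k.

Section FixedCurve.
Variables (D : curve L).
Hypothesis hD : fixes D.

Lemma map_e1 : sigma (e1 D) = e1 D.
Proof. by rewrite /e1 !rmorphD !hD. Qed.
Lemma map_e2 : sigma (e2 D) = e2 D.
Proof. by rewrite /e2 !(rmorphD, rmorphM) /= !hD. Qed.
Lemma map_e3 : sigma (e3 D) = e3 D.
Proof. by rewrite /e3 !rmorphM /= !hD. Qed.

Lemma map_cubic x : sigma (cubic D).[x] = (cubic D).[sigma x].
Proof.
rewrite !cubicE; move: (e1 D) (e2 D) (e3 D) map_e1 map_e2 map_e3.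
by move=> a b c ha hb hc; rewrite !(rmorphXn, rmorphB, rmorphD,
  rmorphM) /= ha hb hc.
Qed.

Lemma map_dcubic x : sigma (cubic D)^`().[x] = (cubic D)^`().[sigma x].
Proof.
rewrite !dcubicE; move: (e1 D) (e2 D) map_e1 map_e2 => a b ha hb.
by rewrite !(rmorph_nat, rmorphXn, rmorphB, rmorphD, rmorphM) /= ha hb.
Qed.

Lemma map_on P : oncurve D P -> oncurve D (mapP P).
Proof. by case: P => //= x y onP; rewrite -rmorphXn /= onP map_cubic. Qed.

Lemma map_chord s x1 y1 x2 :
  mapP (chord D s x1 y1 x2) = chord D (sigma s) (sigma x1) (sigma y1) (sigma
    x2).
Proof.
rewrite /chord /= sum_rootsE; move: (e1 D) map_e1 => a ha.
by congr Affine; rewrite !(rmorphXn, rmorphN, rmorphB, rmorphD, rmorphM) /= ha.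
Qed.

Lemma map_addP P Q : mapP (addP D P Q) = addP D (mapP P) (mapP Q).
Proof.
case: P Q => [|x1 y1] [|x2 y2] //=.
have -> : (sigma y1 == - sigma y2) = (y1 == - y2).
  by rewrite -rmorphN (inj_eq (fmorph_inj sigma)).
rewrite (inj_eq (fmorph_inj sigma)).
case: ifP => _; first by rewrite map_chord fmorph_div !rmorphB.
case: ifP => _ //; rewrite map_chord fmorph_div map_dcubic rmorphM /=.
by rewrite rmorph_nat.
Qed.

Lemma map_mil A B Z : sigma (mil D A B Z) = mil D (mapP A) (mapP B) (mapP Z).
Proof.
case: A B Z => [|x1 y1] [|x2 y2] [|x y] /=; rewrite ?rmorph1 //.
have -> : (sigma y1 == - sigma y2) = (y1 == - y2).
  by rewrite -rmorphN (inj_eq (fmorph_inj sigma)).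
rewrite !(inj_eq (fmorph_inj sigma)).
case: ifP => _; first by rewrite rmorphB.
set s := if _ then _ else _.
have -> : (if x1 != x2 then (sigma y2 - sigma y1) / (sigma x2 - sigma x1)
   else (cubic D)^`().[sigma x1] / (2%:R * sigma y1)) = sigma s.
  rewrite /s; case: ifP => _; first by rewrite fmorph_div !rmorphB.
  by rewrite fmorph_div map_dcubic rmorphM /= rmorph_nat.
move: (e1 D) map_e1 => a ha.
by rewrite fmorph_div !(rmorphXn, rmorphB, rmorphD, rmorphM) /= ha.
Qed.

Lemma map_isog_pt j P : mapP (isog_pt D j P) = isog_pt D j (mapP P).
Proof.
case: P => //= x y; have -> : (sigma x == D j) = (x == D j).
  by rewrite -{1}(hD j) (inj_eq (fmorph_inj sigma)).
case: ifP => //= _; congr Affine;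
by rewrite fmorph_div !(rmorphXn, rmorphB, rmorphM) /= !hD.
Qed.

Definition act (P : cpoint D) : cpoint D := mkP (map_on (onP P)).

Lemma val_act P : val (act P) = mapP (val P). Proof. by []. Qed.

Lemma actD P Q : act (P + Q) = act P + act Q.
Proof. by apply: val_inj; rewrite val_act !val_add map_addP. Qed.

Lemma act0 : act 0 = 0. Proof. exact: val_inj. Qed.

Lemma act_mul P n : act (P *+ n) = act P *+ n.
Proof. by elim: n => [|n IH]; rewrite ?act0 // !mulrS actD IH. Qed.

Lemma act_T k : act (T D k) = T D k.
Proof. by apply: val_inj; rewrite val_act /= hD rmorph0. Qed.

End FixedCurve.

(** The action commutes with an isogeny of degree 2 whose source and target have
    fixed roots, and the kernel of the isogeny lies in <P>. *)
Lemma act_gen_isog (D : curve L) j m P (hD : fixes D) (hD' :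
  fixes (isog_curve D j)) :
  ord2 m.+2 P -> P *+ (2 ^ m.+1) = T D j ->
  gen (isog j P) (act hD' (isog j P)) -> gen P (act hD P).
Proof.
move=> hP PT [u E]; have : isog j (act hD P - P *+ u) = 0.
  rewrite isog_sub isog_mul -E; apply/eqP; rewrite subr_eq0; apply/eqP.
  by apply: val_inj; rewrite /= -map_isog_pt.
case/isog_eq0 => /eqP; rewrite subr_eq => /eqP ->.
  by rewrite add0r; exists u.
by rewrite -PT -mulrnDr; eexists.
Qed.

Variable C : curve L.
Hypothesis hC : fixes C.
Hypothesis h_reach : forall n D, reach C n D -> fixes D.

Lemma act_gen_reach n D m (P : cpoint D) (hD : fixes D) : reach C n D ->
  ord2 m.+1 P -> P *+ (2 ^ m) <> T D 0 -> gen P (act hD P).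
Proof.
elim: m n D P hD => [|m IH] n D P hD rD hP nT.
  have : P *+ 2 = 0 by apply: ord2_tors hP.
  case/tors2P=> [P0|[j PT]]; first by case: (ord2_top hP).
  by rewrite PT act_T; apply: gen_id.
have : P *+ (2 ^ m.+1) *+ 2 = 0 by rewrite -mulrnA -expnSr; apply: ord2_tors.
case/tors2P=> [P0|[j PT]]; first by case: (ord2_top hP).
have nj : j != 0 by apply/eqP => j0; apply: nT; rewrite PT j0.
have rD' := reachS rD nj; have hD' := h_reach rD'.
have [hP' nT'] := ord2_isog hP PT.
exact: act_gen_isog hP PT (IH _ _ _ hD' rD' hP' nT').
Qed.

Lemma act_gen m P : P *+ (2 ^ m) = 0 -> gen P (act hC P).
Proof.
case/ord2_ex=> [[|[|k]] _ hP].
- by move/ord2_0: hP => ->; rewrite act0; apply: gen_id.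
- have : P *+ 2 = 0 by apply: ord2_tors hP.
  case/tors2P=> [P0|[j PT]]; first by case: (ord2_top hP).
  by rewrite PT act_T; apply: gen_id.
have : P *+ (2 ^ k.+1) *+ 2 = 0 by rewrite -mulrnA -expnSr; apply: ord2_tors.
case/tors2P=> [P0|[j PT]]; first by case: (ord2_top hP).
have rD := reach1 C j; have hD := h_reach rD.
have [hP' nT'] := ord2_isog hP PT.
exact: act_gen_isog hP PT (act_gen_reach hD rD hP' nT').
Qed.

(** The multipliers of A, B and A + B agree modulo 2^N, since A and B are
    independent. *)
Lemma act_scalar k : exists (A B : cpoint C) u, [/\ ord2 k.+1 A, ord2 k.+1 B,
  disj A B, odd u &
  forall P, P *+ (2 ^ k.+1) = 0 -> act hC P = P *+ u].
Proof.
have [A [B [hA hB tA tB sp]]] := @tors_basis _ C k.+1 isT.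
have A0 := ord2_tors hA; have B0 := ord2_tors hB.
have top : (0 < k.+1 -> 0 < k.+1 ->
    A *+ (2 ^ k.+1.-1) <> B *+ (2 ^ k.+1.-1))%N.
  by move=> _ _; rewrite tA tB => /T_inj.
have AB : disj A B.
  move=> i j e; have [d _] := ord2_indep hA hB top e; exact/hA.
have [u uE] := act_gen A0; have [v vE] := act_gen B0.
have [w wE] : gen (A + B) (act hC (A + B)).
  by apply: (@act_gen k.+1); rewrite mulrnDl A0 B0 addr0.
have [uw vw] : u = w %[mod 2 ^ k.+1] /\ v = w %[mod 2 ^ k.+1].
  by apply: (span_uniq hA hB top); rewrite -mulrnDl -wE actD uE vE.
have vE' : act hC B = B *+ u.
  by rewrite vE; apply/(ord2_eqmod _ _ hB); rewrite vw uw.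
exists A, B, u; split=> //.
  apply: contraT => eu; case: (@T_neq0 _ C 0).
  rewrite -(act_T hC) -tA act_mul uE -mulrnA -(odd_double_half u) (negbTE eu).
  by rewrite add0n -mul2n mulnAC -expnS mulrnA A0 mul0rn.
move=> P /sp[a [b ->]]; rewrite actD !act_mul uE vE' mulrnDl -!mulrnA.
by rewrite !(mulnC u).
Qed.

Lemma map_miller j P Q : sigma (miller j P Q) = miller j (act hC P) (act hC Q).
Proof.
rewrite /miller rmorph_prod; apply: eq_bigr => i _.
by rewrite -(act_mul hC) /milC (map_mil hC).
Qed.

(** With u = 2 h + 1, 2^(n-1) divides h (h + 1), hence one of these two coprime
    factors. *)
Lemma odd_sqr_pm n u : (0 < n)%N -> odd u -> (u * u = 1 %[mod 2 ^ n.+1])%N ->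
  (u = 1 %[mod 2 ^ n])%N \/ (2 ^ n %| u.+1)%N.
Proof.
case: n => // n _ ou; rewrite -(odd_double_half u) ou add1n; set h := u./2.
rewrite -mul2n => e.
have : (2 ^ n.+2 %| (2 * h).+1 * (2 * h).+1 - 1)%N by rewrite -eqn_mod_dvd //;
  apply/eqP.
have -> : ((2 * h).+1 * (2 * h).+1 - 1 = 4 * (h * h.+1))%N.
  by rewrite (_ : ((2 * h).+1 * (2 * h).+1 = (4 * (h * h.+1)).+1)%N) ?subn1 //;
    ring.
rewrite !expnS mulnA dvdn_pmul2l // => dv.
have [oh|eh] := boolP (odd h).
  right; rewrite -[(2 * h).+2]/(2 + 2 * h)%N -mulnS dvdn_pmul2l //.
  by move: dv; rewrite Gauss_dvdr // coprimeXl // coprime2n.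
left; apply/eqP; rewrite eqn_mod_dvd // subn1 /= dvdn_pmul2l //.
by move: dv; rewrite Gauss_dvdl // coprimeXl // coprime2n.
Qed.

Hypothesis h_unity : forall n z, z ^+ (2 ^ n) = 1 -> sigma z = z.

(** The Weil pairing turns the scalar u into u^2, and roots of unity are fixed,
    so u^2 = 1 modulo 2^(n + 1) and u = 1 or -1 modulo 2^n. *)
Theorem act_pm n P : P *+ (2 ^ n) = 0 -> act hC P = P \/ act hC P = - P.
Proof.
case: n => [|n] P0; first by left; move: P0; rewrite expn0 mulr1n => ->;
  rewrite act0.
have [A [B [u [hA hB AB ou sc]]]] := act_scalar n.+1.
have prim := weil_primitive hA hB AB.
have : sigma (weil n.+2 A B) = weil n.+2 A B ^+ (u * u).
  rewrite -weil_scale // /weil fmorph_div !map_miller.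
  by rewrite (sc A) ?(sc B) ?ord2_tors.
rewrite (h_unity (prim_expr_order prim)) -{1}[weil _ _ _]expr1 => /eqP.
rewrite (eq_prim_root_expr prim) eq_sym => /eqP /(@odd_sqr_pm n.+1) h.
have actP : act hC P = P *+ u.
  by apply: sc; rewrite expnSr mulrnA P0 mul0rn.
case: (h isT ou) => [e|/dvdnP[q e]].
  by left; rewrite actP (mulrn_mod _ P0) e -mulrn_mod // mulr1n.
right; rewrite actP; apply/eqP; rewrite -addr_eq0 -mulrSr e mulnC mulrnA P0.
by rewrite mul0rn.
Qed.

Theorem act_abscissa n (P : cpoint C) x y : P *+ (2 ^ n) = 0 ->
  val P = Affine x y -> sigma x = x.
Proof.
move=> P0 PE; case: (act_pm P0) => /(congr1 val); rewrite ?val_opp val_act PE.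
  by case.
by case.
Qed.

End Action.

(** * Ordinates of torsion points *)

Section Ordinates.
Variables (L : closedFieldType) (C : curve L) (K : set L).
Variables (sqrta : 'I_3 -> L) (im : L).
Hypothesis ha : forall i, sqrta i ^+ 2 = C (i + 1) - C (i + 2%:R).
Hypotheses (im2 : im ^+ 2 = - 1) (Kim : K im).

Lemma im_neq0 : im != 0.
Proof.
by apply: contra_eq_neq im2 => ->; rewrite expr0n eq_sym oppr_eq0 oner_eq0.
Qed.

(** x(P + Q) is an affine function of y(P) y(Q) over the field of abscissae. *)
Lemma mul_ordinates n (P Q : cpoint C) xP yP xQ yQ : (0 < n)%N ->
  P *+ (2 ^ n) = 0 -> Q *+ (2 ^ n) = 0 ->
  val P = Affine xP yP -> val Q = Affine xQ yQ -> Kx C K n (yP * yQ).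
Proof.
move=> n0 P0 Q0 PE QE; have hF := adjoin_subfield K (xcoords (torsion2 C n)).
have Fr k : Kx C K n (C k) by exact: Kx_root.
have FP : Kx C K n xP := Kx_abscissa P0 PE.
have FQ : Kx C K n xQ := Kx_abscissa Q0 QE.
have onP' := onP P; rewrite PE in onP'; have onQ' := onP Q; rewrite QE in onQ'.
have Ff x : Kx C K n x -> Kx C K n (cubic C).[x].
  by move=> Fx; rewrite cubicP; apply: (sfM hF); [apply: (sfM hF)|];
    apply: (sfB hF) => //; exact: Fr.
have [xE|nx] := eqVneq xP xQ.
  subst xQ; have [->|->] := on_sameX onQ' onP'.
    by rewrite -expr2 [_ ^+ 2]onP'; apply: Ff.
  by rewrite mulrN -expr2 [_ ^+ 2]onP'; apply: (sfN hF); apply: Ff.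
have [|s [c [x3 [h l1 l2 SE _]]]] := add_meets onP' onQ'.
  by case=> xE; rewrite xE eqxx in nx.
have F3 : Kx C K n x3.
  have S0 : (P + Q) *+ (2 ^ n) = 0 by rewrite mulrnDl P0 Q0 addr0.
  by apply: (Kx_abscissa S0 (y := - (s * x3 + c))); rewrite val_add PE QE.
have Fe1 : Kx C K n (e1 C) by rewrite /e1; apply: (sfD hF); [apply: (sfD hF)|];
  exact: Fr.
have Fs : Kx C K n (s ^+ 2).
  have [h1 _ _] := h.
  have -> : s ^+ 2 = xP + xQ + x3 - e1 C.
    by apply: (comb1 (c1 := - 1) h1); move: (e1 C) => a; ring.
  exact (sfB hF (sfD hF (sfD hF FP FQ) F3) Fe1).
have n2 := two_neq0 C.
have -> : yP * yQ =
    ((cubic C).[xP] + (cubic C).[xQ] - s ^+ 2 * (xQ - xP) ^+ 2) / 2%:R.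
  apply: (mulIf n2); rewrite divfK // -[(cubic C).[xP]]onP' -[(cubic
    C).[xQ]]onQ'.
  by rewrite l1 l2; ring.
apply: (sfdiv hF); last exact: (sfn hF).
apply: (sfB hF); first by apply: (sfD hF); apply: Ff.
by apply: (sfM hF) => //; apply: (sfX hF); apply: (sfB hF).
Qed.

(** The tangents through T j have slopes im (sd - se), for the square roots sd
    and se of the differences of the other two roots with C j. *)
Lemma point4 j sd se : sd ^+ 2 = C (j + 1) - C j ->
  se ^+ 2 = C (j + 2%:R) - C j ->
  exists2 P : cpoint C, P *+ (2 ^ 2) = 0 &
    val P = Affine (C j + sd * se) (im * (sd * se) * (sd - se)).
Proof.
move=> dE eE; pose s := im * (sd - se); pose x := C j + sd * se.
have hm : meets C s (- (s * C j)) x x (C j).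
  split; rewrite ?(e1_shift C j) ?(e2_shift C j) ?(e3_shift C j) -dE -eE /x /s.
  - apply: (comb1 (c1 := - (sd - se) ^+ 2) im2); ring.
  - apply: (comb1 (c1 := - 2%:R * C j * (sd - se) ^+ 2) im2); ring.
  - apply: (comb1 (c1 := - (C j * (sd - se)) ^+ 2) im2); ring.
have yE : im * (sd * se) * (sd - se) = s * x - s * C j by rewrite /s /x; ring.
have onM : oncurve C (Affine x (im * (sd * se) * (sd - se))).
  have := meetsE hm x; rewrite subrr !mul0r => /eqP;
    rewrite subr_eq0 => /eqP /= ->.
  by rewrite yE.
exists (mkP onM); last by [].
have M2 : mkP onM *+ 2 = T C j.
  apply: val_inj; rewrite mulr2n val_add.
  by rewrite (meets_slope onM hm) //=; congr Affine; ring.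
by rewrite (mulrnA _ 2 2) M2 T_double.
Qed.

Lemma ord3_add3 (i : 'I_3) : [/\ i + 2%:R + 1 = i, i + 2%:R + 2%:R = i + 1 &
  i + 1 + 2%:R = i].
Proof. by case: (ord3P i) => ->; split; apply: val_inj. Qed.

Section FixRoot.
Variables (n : nat) (i : 'I_3).
Hypothesis n2 : (1 < n)%N.
Let j : 'I_3 := i + 2%:R.
Let se := sqrta i.
Let sd := im * sqrta (i + 1).

Let tors4 (P : cpoint C) : P *+ (2 ^ 2) = 0 -> P *+ (2 ^ n) = 0.
Proof. by move=> P0; rewrite -(subnKC n2) expnD mulrnA P0 mul0rn. Qed.

Let seE : se ^+ 2 = C (j + 2%:R) - C j.
Proof. by have [_ -> _] := ord3_add3 i; rewrite ha. Qed.

Let sdE : sd ^+ 2 = C (j + 1) - C j.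
Proof.
have [-> _ h] := ord3_add3 i; rewrite exprMn im2 ha mulN1r opprB.
by rewrite h -[i + 1 + 1]addrA.
Qed.

Let r_neq0 : [/\ sd != 0, se != 0 & sd - se != 0].
Proof.
have [d0 e0 de] := de_neq0 C j; rewrite -sdE -seE in d0 e0 de.
split; first by rewrite -sqrf_eq0.
  by rewrite -sqrf_eq0.
by rewrite subr_eq0; apply: contra de => /eqP ->.
Qed.

(** With M of order 4 as in [point4], y(M) is im r (r / se - se) for r = sd se,
    and every other ordinate is a quotient by y(M). *)
Lemma Kdiv_sub : Kdiv C K n `<=` adjoin (Kx C K n) [set sqrta i].
Proof.
have [nd ne nde] := r_neq0; have n0 := ltnW n2.
set G := adjoin _ _; have hG : subfield_set G := adjoin_subfield _ _.
have FG : Kx C K n `<=` G by exact: adjoin_base.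
have KF : K `<=` Kx C K n by exact: adjoin_base.
have Gse : G se by exact: adjoin_gen.
apply: adjoin_min => //; first exact: subset_trans KF FG.
move=> z [x [y [/[dup] Pt [onP' _] zE]]].
have P0 : mkP onP' *+ (2 ^ n) = 0 by apply/torsion2E; exact: Pt.
case: zE => ->; first by apply: FG; apply: (Kx_abscissa P0 (y := y)).
have [M /tors4 M0 ME] := point4 sdE seE.
have hF := adjoin_subfield K (xcoords (torsion2 C n)).
have Gr : G (sd * se).
  apply: FG; rewrite -[sd * se](addKr (C j)) addrC.
  by apply: (sfB hF); [apply: Kx_abscissa M0 ME|apply: Kx_root].
have yM0 : im * (sd * se) * (sd - se) != 0.
  by apply: mulf_neq0 nde; apply: mulf_neq0; [exact: im_neq0|exact: mulf_neq0].
have := mul_ordinates n0 P0 M0 (erefl : val (mkP onP') = Affine x y) ME.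
move/FG => Gy; rewrite -[y](mulfK yM0); apply: (sfdiv hG) => //.
apply: (sfM hG).
  exact: (sfM hG (FG _ (KF _ Kim)) Gr).
apply: (sfB hG) => //; rewrite -[sd](mulfK ne); exact: (sfdiv hG).
Qed.

(** The points of order 4 for (sd, se) and (-sd, se) have ordinates whose
    difference is 2 im (sd se) se. *)
Lemma sub_Kdiv : adjoin (Kx C K n) [set sqrta i] `<=` Kdiv C K n.
Proof.
have [nd ne nde] := r_neq0.
have hD : subfield_set (Kdiv C K n) := adjoin_subfield _ _.
have KD : K `<=` Kdiv C K n by exact: adjoin_base.
apply: adjoin_min => //.
  apply: adjoin_min => // x [y xy]; apply: adjoin_gen; exists x, y.
  by split=> //; left.
move=> _ ->; have coordE (P : cpoint C) x y : P *+ (2 ^ n) = 0 ->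
    val P = Affine x y -> Kdiv C K n x /\ Kdiv C K n y.
  move=> /torsion2E + PE; rewrite PE => tP.
  by split; apply: adjoin_gen; exists x, y; split=> //; [left|right].
have sdN : (- sd) ^+ 2 = C (j + 1) - C j by rewrite sqrrN sdE.
have [M /tors4 M0 ME] := point4 sdE seE.
have [N /tors4 N0 NE] := point4 sdN seE.
have [_ yM] := coordE _ _ _ M0 ME; have [xM _] := coordE _ _ _ M0 ME.
have [_ yN] := coordE _ _ _ N0 NE.
have [xT _] : Kdiv C K n (C j) /\ Kdiv C K n 0.
  apply: (coordE (T C j)) => //.
  by rewrite -(subnKC (ltnW n2)) expnD mulrnA T_double mul0rn.
have rE : Kdiv C K n (sd * se).
  by rewrite -[sd * se](addKr (C j)) addrC; apply: (sfB hD).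
have t2 := two_neq0 C.
have -> : sqrta i = (im * (- sd * se) * (- sd - se) - im * (sd * se) * (sd -
  se)) /
    (2%:R * im * (sd * se)).
  by rewrite -/se; field; rewrite nd ne im_neq0 t2.
apply: (sfdiv hD); first exact: (sfB hD).
apply: (sfM hD) => //; apply: (sfM hD); first exact: (sfn hD).
exact: KD.
Qed.

End FixRoot.
End Ordinates.

(** * The fields generated by a decoration *)

Section PointDecoration.
Variables (L : closedFieldType) (C : curve L) (Psi : set (vec L) -> L).
Hypothesis hPsi : decoration C Psi.

Lemma decorated_points : decorated (fun P : cpoint C => Psi (Lat P)).
Proof.
have [hI hII h4 h8] := hPsi; split.
- by move=> P Q h h'; rewrite (Lat_eq h h').
- by move=> i; rewrite Lat_T hII.
- move=> P i Pi; have hP : ord2 2 P := ord2_half Pi (ord2_T C i).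
  have := Lat_parent hP; rewrite Pi => par.
  have tw : is_twin C 1 (Lat (T C i)) (Lat (T C (i + 1))).
    by exists i; rewrite !Lat_T.
  have /eqP := h4 _ _ _ (Lat_level hP) par tw.
  by rewrite !hornerE.
- move=> m P R hP R2 nR.
  have tw := Lat_twin (ord2_mul hP) R2 nR.
  have /eqP := h8 m.+2 _ _ _ isT (Lat_level hP) (Lat_parent hP) tw.
  by rewrite !hornerE.
- by move=> m P R hP R2 nR; apply/eqP; apply: hI (Lat_twin hP R2 nR).
Qed.

End PointDecoration.

Section GenericRoots.
Variables (k : fieldType) (L : closedFieldType) (iota : {rmorphism k -> L}).
Variable alpha : 'I_3 -> L.

Lemma alg_independent_inj : alg_independent iota alpha -> injective alpha.
Proof.
move=> ind i j e; apply/eqP; apply: contraT => ij.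
have : mmap iota alpha ('X_i - 'X_j) = 0.
  by rewrite mmapB !mmapX !mmap1U e subrr.
move/ind/(congr1 (fun p : {mpoly k[3]} => p@_U_(i)%MM)).
rewrite mcoeffB !mcoeffXU eqxx eq_sym (negbTE ij) mcoeff0 subr0 => /eqP.
by rewrite oner_eq0.
Qed.

Lemma baseK_sum : baseK iota alpha (e1 alpha).
Proof.
apply: adjoin_gen; exists 0 => //.
by rewrite mesym1E big_ord3 /= !mevalD !mevalXU.
Qed.

End GenericRoots.

Section DecorationField.
Variables (L : closedFieldType) (C : curve L) (K : set L) (Psi : set (vec L) ->
  L).
Hypothesis hPsi : decoration C Psi.
Notation Kdec := (Kdec C K Psi).
Notation F := (Kdec_infty C K Psi).

Lemma Kdec_Kx n : Kdec n `<=` Kx C K n.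
Proof.
apply: adjoin_min; [exact: adjoin_subfield|exact: adjoin_base|].
move=> _ [m [Lam [/andP[m0 mn] /level_point[P hP ->] ->]]].
apply: (Kx_mono mn); exact (psi_Kx (decorated_points hPsi) m0 hP).
Qed.

Lemma Kx_sub_infty n : Kx C K n `<=` Kx_infty C K.
Proof. by apply: adjoin_mono => x [y xy]; exists y, n. Qed.

Lemma Kdec_infty_subfield : subfield_set F.
Proof.
apply: bigcup_subfield => n; first exact: adjoin_subfield.
apply: adjoin_mono => x [m [Lam [/andP[m0 mn] h ->]]].
by exists m, Lam; split=> //; rewrite m0 leqW.
Qed.

Lemma K_Kdec_infty : K `<=` F.
Proof. by move=> x Kx; exists 0%N => //; apply: adjoin_base. Qed.

Lemma Psi_Kdec_infty m (P : cpoint C) : ord2 m.+1 P -> F (Psi (Lat P)).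
Proof.
move=> hP; exists m.+1 => //; apply: adjoin_gen.
by exists m.+1, (Lat P); split=> //; [rewrite leqnn|exact: Lat_level].
Qed.

Hypotheses (p0 : [pchar L] =i pred0) (Ke1 : K (e1 C)).

(** 3 C i is e1 plus the two differences of C i with the other roots, which are
    values of the decoration at level 1 up to sign. *)
Lemma root_Kdec_infty i : F (C i).
Proof.
have hF := Kdec_infty_subfield; have [_ hII _ _] := hPsi.
have Fa j : F (C (j + 1) - C (j + 2%:R)).
  by rewrite -hII -Lat_T; apply: Psi_Kdec_infty (ord2_T C j).
have n3 : 3%:R != 0 :> L by rewrite ((pcharf0P _).1 p0).
have -> : C i = (e1 C + (C (i + 2%:R + 1) - C (i + 2%:R + 2%:R)) -
    (C (i + 1 + 1) - C (i + 1 + 2%:R))) / 3%:R.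
  have [-> -> ->] := ord3_add3 i; rewrite -[i + 1 + 1]addrA /e1 (rot_sym i).
  by rewrite (_ : 1 + 1 = 2%:R :> 'I_3) //; field; rewrite n3.
apply: (sfdiv hF); last exact: (sfn hF).
by apply: (sfB hF) => //; apply: (sfD hF) => //; apply: K_Kdec_infty.
Qed.

Lemma reach_Kdec_infty n D : reach C n D -> forall i, F (D i).
Proof.
have hF := Kdec_infty_subfield.
move=> rD i; have [Q [R [hQ R2 nR [j [j' [nj nj' jj' E E']]]]]] :=
  point_of_reach (decorated_points hPsi) rD.
have n0 := reach_gt0 rD; case: n n0 rD hQ E E' => // n _ rD hQ E E'.
have hQR : ord2 n.+2 (Q + R).
  by apply: (@ord2_half _ n (Q *+ 2));
    [rewrite mulrnDl R2 addr0|apply: ord2_mul].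
have Fs : F (sgn L n.+1) by apply: (sfX hF); apply: (sfN hF); apply: (sf1 hF).
have Fj : F (D j) by rewrite E; apply: (sfM hF Fs); apply: Psi_Kdec_infty hQ.
have Fj' : F (D j') by rewrite E'; apply: (sfM hF Fs);
  apply: Psi_Kdec_infty hQR.
have [->|n0] := eqVneq i 0; first by rewrite (reach_root0 rD); apply: (sf0 hF).
have [->//|nij] := eqVneq i j.
suff -> : i = j' by [].
move: n0 nj nj' jj' nij; case: (ord3P i) => ->; case: (ord3P j) => ->;
by case: (ord3P j') => ->.
Qed.

Hypothesis unity : forall n z, z ^+ (2 ^ n) = 1 -> K z.
Hypothesis alg : algebraic_over K.

(** An embedding over F fixes the roots of all isogenous curves, so it acts on
    E[2^n] as 1 or -1 and fixes the abscissae. *)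
Lemma Kx_infty_Kdec : Kx_infty C K `<=` F.
Proof.
have hF := Kdec_infty_subfield.
apply: adjoin_min => //; first exact: K_Kdec_infty.
move=> x [y [n _ /[dup] tP [onP' _]]]; apply: contrapT => nFx.
have algF : algebraic_over F.
  move=> z; have [p [pK pn pz]] := alg z; exists p; split=> //.
  move: pK; rewrite !qualifE => /allP h; apply/allP => c /h /set_mem Kc.
  by apply/mem_set/K_Kdec_infty.
have [sigma [fixF /eqP]] := fixed_field p0 hF algF nFx; apply.
have P0 : mkP onP' *+ (2 ^ n) = 0 by apply/torsion2E; exact: tP.
apply: (@act_abscissa _ sigma C _ _ _ n (mkP onP') x y P0) => //.
- by move=> i; apply/fixF/root_Kdec_infty.
- by move=> m D rD i; apply/fixF; apply: reach_Kdec_infty rD i.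
- by move=> m z z1; apply/fixF/K_Kdec_infty; apply: unity z1.
Qed.

End DecorationField.

Theorem theorem3p1 (k : fieldType) (Kbar : closedFieldType)
    (iota : {rmorphism k -> Kbar}) (alpha : 'I_3 -> Kbar)
    (zeta : nat -> Kbar) (sqrta : 'I_3 -> Kbar)
    (Psi : set (vec Kbar) -> Kbar) :
  let K := baseK iota alpha in
  [pchar k] =i pred0 ->
  (forall (n : nat) (z : Kbar), z ^+ (2 ^ n) = 1 -> range iota z) ->
  alg_independent iota alpha ->
  algebraic_over K ->
  compatible_roots zeta ->
  (forall i : 'I_3, sqrta i ^+ 2 = alpha (i + 1) - alpha (i + 2%:R)) ->
  decoration alpha Psi ->
  [/\ forall (n : nat) (i : 'I_3), (2 <= n)%N ->
        Kdiv alpha K n = adjoin (Kx alpha K n) [set sqrta i],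
      forall n : nat, (1 <= n)%N ->
        adjoin (Kdec alpha K Psi n) [set zeta n] `<=` Kx alpha K n &
      adjoin_mu2 zeta (Kdec_infty alpha K Psi) = Kx_infty alpha K].
Proof.
move=> K pk unity ind alg comp ha hPsi.
have p0 : [pchar Kbar] =i pred0 by move=> p; rewrite (fmorph_pchar iota) pk.
have n2 : 2%:R != 0 :> Kbar by rewrite ((pcharf0P _).1 p0).
pose C := Curve (alg_independent_inj ind) n2.
have uK n z : z ^+ (2 ^ n) = 1 -> K z by move=> /unity h; apply: adjoin_base.
have zK n : K (zeta n) by apply: (uK n); apply: prim_expr_order (comp n).1.
pose im := sqrtL (- 1 : Kbar).
have im2 : im ^+ 2 = - 1 by exact: sqrtLK.
have Kim : K im by apply: (uK 2%N); rewrite (exprM im 2 2) im2 sqrrN expr1n.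
have hPsiC : decoration C Psi by exact: hPsi.
have bK n : Kdec alpha K Psi n `<=` Kx alpha K n by exact: (@Kdec_Kx _ C).
split.
- move=> n i n1; apply/seteqP; split.
    exact: (@Kdiv_sub _ C K sqrta im ha im2 Kim n i n1).
  exact: (@sub_Kdiv _ C K sqrta im ha im2 Kim n i n1).
- move=> n n1; apply: adjoin_min => //; first exact: adjoin_subfield.
  by move=> _ ->; apply: adjoin_base.
- have FX : Kdec_infty alpha K Psi `<=` Kx_infty alpha K.
    by move=> x [n _ /bK]; apply: (@Kx_sub_infty _ C).
  have zF n : Kdec_infty alpha K Psi (zeta n).
    by exists 0%N => //; apply: adjoin_base.
  have hF : subfield_set (Kdec_infty alpha K Psi) := @Kdec_infty_subfield _ C K Psi.
  apply/seteqP; split=> [x [n _]|x xK].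
    by rewrite adjoin_absorb // => [/FX //|_ ->].
  exists 1%N => //; apply: adjoin_base.
  apply: (@Kx_infty_Kdec _ C K Psi) => //; exact: baseK_sum.
Qed.
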